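(* Let $\Lambda$ be a basic Artin algebra with Jacobson radical $J$ and $e\in\Lambda$ an idempotent such that $\operatorname{pdim}_\Lambda\Lambda(1-e)/J(1-e)<\infty$, $\operatorname{pdim}_{e\Lambda e}e\Lambda(1-e)<\infty$, and $\mathcal{P}^{<\infty}(e\Lambda e\text{-mod})$ is contravariantly finite in $e\Lambda e\text{-mod}$. Let $T=T'\oplus T''$ be the basic strong tilting module in $\Lambda\text{-mod}$, decomposed as described in the context, $\widetilde{\Lambda}=\operatorname{End}_\Lambda(T)^{\mathrm{op}}$ with Jacobson radical $\widetilde{J}$, and let $\widetilde{e}\in\widetilde{\Lambda}$ be the idempotent given by the projection $T\to T'\subseteq T$ along $T''$. Then the corner algebra $\widetilde{e}\widetilde{\Lambda}\widetilde{e}$ is isomorphic to $\bigl(\operatorname{End}_{e\Lambda e}(eT')\bigr)^{\mathrm{op}}$, where $eT'$ is the basic strong tilting module in $e\Lambda e\text{-mod}$. Moreover: (i) the right $\widetilde{\Lambda}$-module $(1-\widetilde{e})\widetilde{\Lambda}/(1-\widetilde{e})\widetilde{J}$ has finite projective dimension, and (ii) the right $\widetilde{e}\widetilde{\Lambda}\widetilde{e}$-module $(1-\widetilde{e})\widetilde{\Lambda}\widetilde{e}$ has finite projective dimension.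
   Context: For an Artin algebra $A$, $A\text{-mod}$ is the category of finitely generated left $A$-modules and $\mathcal{P}^{<\infty}(A\text{-mod})$ its full subcategory of modules of finite projective dimension. $A$ is basic if $A/J(A)$ is a product of division rings; a module is basic if it has no indecomposable direct summand of multiplicity $>1$. $\operatorname{add}(M)$ denotes the direct summands of finite direct sums of copies of $M$. A (right) $\mathcal{P}^{<\infty}(A\text{-mod})$-approximation of $M\in A\text{-mod}$ is a map $\phi:X\to M$ with $X\in\mathcal{P}^{<\infty}(A\text{-mod})$ through which every homomorphism from an object of $\mathcal{P}^{<\infty}(A\text{-mod})$ to $M$ factors. It is minimal if every endomorphism $u$ of $X$ with $\phi\circ u=\phi$ is an automorphism; the minimal one is unique up to isomorphism, and its domain is also called the minimal approximation. $\mathcal{P}^{<\infty}(A\text{-mod})$ is contravariantly finite in $A\text{-mod}$ if every $M\in A\text{-mod}$ has an approximation. Under the hypotheses of the claim, $\mathcal{P}^{<\infty}(\Lambda\text{-mod})$ is contravariantly finite in $\Lambda\text{-mod}$. $T\in A\text{-mod}$ is a tilting module if (1) $T\in\mathcal{P}^{<\infty}(A\text{-mod})$, (2) $\operatorname{Ext}^i_A(T,T)=0$ for $i\ge1$, (3) there is an exact sequence $0\to A\to T_0\to\cdots\to T_s\to0$ with all $T_j\in\operatorname{add}(T)$. It is strong if, in addition, $\operatorname{Ext}^i_A(M,T)=0$ for all $M\in\mathcal{P}^{<\infty}(A\text{-mod})$, $i\ge1$. A strong tilting module exists in $A\text{-mod}$ if and only if $\mathcal{P}^{<\infty}(A\text{-mod})$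 is contravariantly finite, and the basic one is unique up to isomorphism. Decomposition of $T$: write $e=e_1+\cdots+e_m$ and $1-e=e_{m+1}+\cdots+e_n$ with orthogonal primitive idempotents, $S_i=\Lambda e_i/Je_i$, and let $\mathcal{A}_i$ be the minimal $\mathcal{P}^{<\infty}(\Lambda\text{-mod})$-approximation of the injective envelope $E(S_i)$. Then $\operatorname{add}(\bigoplus_{1\le i\le m}\mathcal{A}_i)$ contains precisely $m$ isomorphism classes of indecomposable modules, represented by $T_1,\dots,T_m$, and $T'=\bigoplus_{1\le i\le m}T_i$. For $m+1\le i\le n$, $\mathcal{A}_i=T_i\oplus U_i$ with $U_i\in\operatorname{add}(T')$ and $T_i$ the indecomposable summand having $S_i$ in its socle; $T''=\bigoplus_{m+1\le i\le n}T_i$. Then $T=T'\oplus T''$ up to isomorphism, and $eT'$ is the basic strong tilting module in $e\Lambda e\text{-mod}$. *)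

(* Defs.v *)
(* Left R-modules are [lmodType R] and right R-modules are [lmodType R^c].
   Rings are [pzRingType]s because the corner ring e R e is trivial if e = 0. *)
From HB Require Import structures.
From mathcomp Require Import all_boot all_algebra.
From mathcomp Require Import boolp.

Set Implicit Arguments.
Unset Strict Implicit.
Unset Printing Implicit Defensive.

Import GRing.Theory.
Local Open Scope ring_scope.
Local Open Scope quotient_scope.

Record submodule (R : pzRingType) (V : lmodType R) := Submodule {
  submod_pred :> {pred V};
  submod_predP : submod_closed submod_pred }.

HB.instance Definition _ (R : pzRingType) (V : lmodType R) (S : submodule V) :=
  GRing.isSubmodClosed.Build R V (submod_pred S)
    (GRing.submod_closed_semi (submod_predP S)).

Section Submod.
Variables (R : pzRingType) (V : lmodType R) (S : submodule V).

Record submod := Submod {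
  submod_val :> V;
  submod_valP : submod_val \in submod_pred S }.

HB.instance Definition _ := [isSub for submod_val].
HB.instance Definition _ := [Choice of submod by <:].
HB.instance Definition _ := [SubChoice_isSubZmodule of submod by <:].
HB.instance Definition _ := [SubZmodule_isSubLmodule of submod by <:].

End Submod.

Section QuotMod.
Variables (R : pzRingType) (V : lmodType R) (S : submodule V).

Definition quotmod := Quotient.quot (submod_pred S).

HB.instance Definition _ := GRing.Zmodule.on quotmod.

Definition quotmod_pi (v : V) : quotmod := \pi_(Quotient.quot (submod_pred S)) v.
Definition quotmod_repr (x : quotmod) : V := repr x.

Lemma quotmod_reprK : cancel quotmod_repr quotmod_pi.
Proof. by move=> x; apply: reprK. Qed.

Lemma quotmod_piP u v : quotmod_pi u = quotmod_pi v <-> u - v \in submod_pred S.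
Proof.
by rewrite Quotient.idealrBE; split=> [/eqP|/eqP].
Qed.

Lemma quotmod_piD u v : quotmod_pi (u + v) = quotmod_pi u + quotmod_pi v.
Proof. exact: (Quotient.pi_add (submod_pred S)). Qed.

Definition quotmod_scale (a : R) (x : quotmod) : quotmod :=
  quotmod_pi (a *: quotmod_repr x).

Lemma quotmod_scale_pi a v :
  quotmod_scale a (quotmod_pi v) = quotmod_pi (a *: v).
Proof.
apply/quotmod_piP; rewrite -scalerBr rpredZ //.
exact/quotmod_piP/quotmod_reprK.
Qed.

Fact quotmod_scaleA a b x :
  quotmod_scale a (quotmod_scale b x) = quotmod_scale (a * b) x.
Proof. by rewrite -[x]quotmod_reprK !quotmod_scale_pi scalerA. Qed.

Fact quotmod_scale1 : left_id 1 quotmod_scale.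
Proof. by move=> x; rewrite -[x]quotmod_reprK quotmod_scale_pi scale1r. Qed.

Fact quotmod_scaleDr : right_distributive quotmod_scale +%R.
Proof.
move=> a x y; rewrite -[x]quotmod_reprK -[y]quotmod_reprK -quotmod_piD.
by rewrite !quotmod_scale_pi scalerDr quotmod_piD.
Qed.

Fact quotmod_scaleDl x : {morph quotmod_scale^~ x : a b / a + b}.
Proof.
move=> a b; rewrite -[x]quotmod_reprK !quotmod_scale_pi scalerDl.
exact: quotmod_piD.
Qed.

HB.instance Definition _ := GRing.Zmodule_isLmodule.Build R quotmod
  quotmod_scaleA quotmod_scale1 quotmod_scaleDr quotmod_scaleDl.

End QuotMod.

Section DirectSum.
Variables (R : pzRingType) (n : nat) (M : 'I_n -> lmodType R).

Definition dsum := forall i, M i.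

HB.instance Definition _ := gen_eqMixin dsum.
HB.instance Definition _ := gen_choiceMixin dsum.

Definition dsum_zero : dsum := fun i => 0.
Definition dsum_opp (x : dsum) : dsum := fun i => - x i.
Definition dsum_add (x y : dsum) : dsum := fun i => x i + y i.
Definition dsum_scale a (x : dsum) : dsum := fun i => a *: x i.

Fact dsum_addA : associative dsum_add.
Proof. by move=> x y z; apply: functional_extensionality_dep=> i; apply: addrA. Qed.
Fact dsum_addC : commutative dsum_add.
Proof. by move=> x y; apply: functional_extensionality_dep=> i; apply: addrC. Qed.
Fact dsum_add0 : left_id dsum_zero dsum_add.
Proof. by move=> x; apply: functional_extensionality_dep=> i; apply: add0r. Qed.
Fact dsum_addN : left_inverse dsum_zero dsum_opp dsum_add.
Proof. by move=> x; apply: functional_extensionality_dep=> i; apply: addNr. Qed.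

HB.instance Definition _ :=
  GRing.isZmodule.Build dsum dsum_addA dsum_addC dsum_add0 dsum_addN.

Fact dsum_scaleA a b x : dsum_scale a (dsum_scale b x) = dsum_scale (a * b) x.
Proof. by apply: functional_extensionality_dep=> i; apply: scalerA. Qed.
Fact dsum_scale1 : left_id 1 dsum_scale.
Proof. by move=> x; apply: functional_extensionality_dep=> i; apply: scale1r. Qed.
Fact dsum_scaleDr : right_distributive dsum_scale +%R.
Proof. by move=> a x y; apply: functional_extensionality_dep=> i; apply: scalerDr. Qed.
Fact dsum_scaleDl x : {morph dsum_scale^~ x : a b / a + b}.
Proof. by move=> a b; apply: functional_extensionality_dep=> i; apply: scalerDl. Qed.

HB.instance Definition _ := GRing.Zmodule_isLmodule.Build R dsum
  dsum_scaleA dsum_scale1 dsum_scaleDr dsum_scaleDl.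

End DirectSum.

(* The product of [endo M] is composition: f * g = f \o g. *)
Section Endo.
Variables (R : pzRingType) (M : lmodType R).

Record endo := Endo { endo_fun :> {linear M -> M} }.

HB.instance Definition _ := gen_eqMixin endo.
HB.instance Definition _ := gen_choiceMixin endo.

Lemma endoP (f g : endo) : f =1 g -> f = g.
Proof.
case: f g => [[f cf]] [[g cg]] /= fg.
have E : f = g by apply: functional_extensionality_dep.
case: _ / E cg {fg} => cg.
case: cf cg => [[fa] [fs]] [[ga] [gs]].
by rewrite (Prop_irrelevance fa ga) (Prop_irrelevance fs gs).
Qed.

Definition endo_zero := Endo (\0 : {linear M -> M}).
Definition endo_opp (f : endo) := Endo (\- f : {linear M -> M}).
Definition endo_add (f g : endo) := Endo (f \+ g : {linear M -> M}).
Definition endo_one := Endo (idfun : {linear M -> M}).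
Definition endo_mul (f g : endo) := Endo (f \o g : {linear M -> M}).

Fact endo_addA : associative endo_add.
Proof. by move=> f g h; apply: endoP => x; apply: addrA. Qed.
Fact endo_addC : commutative endo_add.
Proof. by move=> f g; apply: endoP => x; apply: addrC. Qed.
Fact endo_add0 : left_id endo_zero endo_add.
Proof. by move=> f; apply: endoP => x; apply: add0r. Qed.
Fact endo_addN : left_inverse endo_zero endo_opp endo_add.
Proof. by move=> f; apply: endoP => x; apply: addNr. Qed.

HB.instance Definition _ :=
  GRing.isZmodule.Build endo endo_addA endo_addC endo_add0 endo_addN.

Fact endo_mulA : associative endo_mul.
Proof. by move=> f g h; apply: endoP. Qed.
Fact endo_mul1l : left_id endo_one endo_mul.
Proof. by move=> f; apply: endoP. Qed.
Fact endo_mul1r : right_id endo_one endo_mul.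
Proof. by move=> f; apply: endoP. Qed.
Fact endo_mulDl : left_distributive endo_mul +%R.
Proof. by move=> f g h; apply: endoP. Qed.
Fact endo_mulDr : right_distributive endo_mul +%R.
Proof. by move=> f g h; apply: endoP => x; apply: linearD. Qed.

HB.instance Definition _ := GRing.Zmodule_isPzRing.Build endo
  endo_mulA endo_mul1l endo_mul1r endo_mulDl endo_mulDr.

End Endo.

Record idem (R : pzRingType) := Idem {
  idem_val :> R;
  idemE : idem_val * idem_val = idem_val }.

Section Idem.
Variable R : pzRingType.

Fact idem_compl_subproof (e : idem R) :
  (1 - (e : R)) * (1 - (e : R)) = 1 - (e : R).
Proof. by rewrite mulrBr mulr1 mulrBl mul1r idemE subrr subr0. Qed.
Definition idem_compl e := Idem (idem_compl_subproof e).

Definition idem_conv (e : idem R) : idem R^c :=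
  @Idem R^c (e : R) (idemE e).

End Idem.

Section Corner.
Variables (R : pzRingType) (e : idem R).

Definition corner_pred : {pred R} := fun x => (e : R) * x * (e : R) == x.

Fact corner_zmod_closed : zmod_closed corner_pred.
Proof.
split=> [|x y]; rewrite !unfold_in ?mulr0 ?mul0r // => /eqP xP /eqP yP.
by rewrite mulrBr mulrBl xP yP.
Qed.
HB.instance Definition _ :=
  GRing.isZmodClosed.Build R corner_pred corner_zmod_closed.

Record corner := Corner {
  corner_val :> R;
  corner_valP : corner_val \in corner_pred }.

HB.instance Definition _ := [isSub for corner_val].
HB.instance Definition _ := [Choice of corner by <:].

Lemma cornerl (x : corner) : (e : R) * (x : R) = (x : R).
Proof. by rewrite -(eqP (corner_valP x)) !mulrA idemE. Qed.
Lemma cornerr (x : corner) : (x : R) * (e : R) = (x : R).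
Proof. by rewrite -(eqP (corner_valP x)) -!mulrA idemE. Qed.

HB.instance Definition _ := [SubChoice_isSubZmodule of corner by <:].

Fact corner_one_subproof : (e : R) \in corner_pred.
Proof. by rewrite unfold_in !idemE. Qed.
Definition corner_one := Corner corner_one_subproof.

Fact corner_mul_subproof (x y : corner) :
  (x : R) * (y : R) \in corner_pred.
Proof. by rewrite unfold_in mulrA cornerl -mulrA cornerr. Qed.
Definition corner_mul x y := Corner (corner_mul_subproof x y).

Fact corner_mulA : associative corner_mul.
Proof. by move=> x y z; apply: val_inj; apply: mulrA. Qed.
Fact corner_mul1l : left_id corner_one corner_mul.
Proof. by move=> x; apply: val_inj; apply: cornerl. Qed.
Fact corner_mul1r : right_id corner_one corner_mul.
Proof. by move=> x; apply: val_inj; apply: cornerr. Qed.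
Fact corner_mulDl : left_distributive corner_mul +%R.
Proof. by move=> x y z; apply: val_inj; apply: mulrDl. Qed.
Fact corner_mulDr : right_distributive corner_mul +%R.
Proof. by move=> x y z; apply: val_inj; apply: mulrDr. Qed.

HB.instance Definition _ := GRing.Zmodule_isPzRing.Build corner
  corner_mulA corner_mul1l corner_mul1r corner_mulDl corner_mulDr.

End Corner.

(* The left eRe-module eM of a left R-module M. *)
Section CornerMod.
Variables (R : pzRingType) (e : idem R) (M : lmodType R).

Definition emod_pred : {pred M} := fun x => (e : R) *: x == x.

Fact emod_zmod_closed : zmod_closed emod_pred.
Proof.
split=> [|x y]; rewrite !unfold_in ?scaler0 // => /eqP xP /eqP yP.
by rewrite scalerBr xP yP.
Qed.
HB.instance Definition _ :=
  GRing.isZmodClosed.Build M emod_pred emod_zmod_closed.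

Record emod := Emod {
  emod_val :> M;
  emod_valP : emod_val \in emod_pred }.

HB.instance Definition _ := [isSub for emod_val].
HB.instance Definition _ := [Choice of emod by <:].

HB.instance Definition _ := [SubChoice_isSubZmodule of emod by <:].

Fact emod_scale_subproof (a : corner e) (x : emod) :
  (a : R) *: (x : M) \in emod_pred.
Proof. by rewrite unfold_in scalerA cornerl. Qed.
Definition emod_scale a x := Emod (emod_scale_subproof a x).

Fact emod_scaleA a b x : emod_scale a (emod_scale b x) = emod_scale (a * b) x.
Proof. by apply: val_inj; apply: scalerA. Qed.
Fact emod_scale1 : left_id 1 emod_scale.
Proof. by move=> x; apply: val_inj; apply/eqP/emod_valP. Qed.
Fact emod_scaleDr : right_distributive emod_scale +%R.
Proof. by move=> a x y; apply: val_inj; apply: scalerDr. Qed.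
Fact emod_scaleDl x : {morph emod_scale^~ x : a b / a + b}.
Proof. by move=> a b; apply: val_inj; apply: scalerDl. Qed.

HB.instance Definition _ := GRing.Zmodule_isLmodule.Build (corner e) emod
  emod_scaleA emod_scale1 emod_scaleDr emod_scaleDl.

End CornerMod.

(* The right eRe-module Me of a right R-module M. *)
Section CornerModRight.
Variables (R : pzRingType) (e : idem R) (M : lmodType R^c).

Definition mode_pred : {pred M} := fun x => ((e : R) : R^c) *: x == x.

Fact mode_zmod_closed : zmod_closed mode_pred.
Proof.
split=> [|x y]; rewrite !unfold_in ?scaler0 // => /eqP xP /eqP yP.
by rewrite scalerBr xP yP.
Qed.
HB.instance Definition _ :=
  GRing.isZmodClosed.Build M mode_pred mode_zmod_closed.

Record mode := Mode {
  mode_val :> M;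
  mode_valP : mode_val \in mode_pred }.

HB.instance Definition _ := [isSub for mode_val].
HB.instance Definition _ := [Choice of mode by <:].

HB.instance Definition _ := [SubChoice_isSubZmodule of mode by <:].

Fact mode_scale_subproof (a : corner e) (x : mode) :
  ((a : R) : R^c) *: (x : M) \in mode_pred.
Proof.
rewrite unfold_in scalerA; apply/eqP.
exact: (congr1 (fun r : R^c => r *: (x : M)) (cornerr a)).
Qed.
Definition mode_scale (a : (corner e)^c) x := Mode (mode_scale_subproof a x).

Fact mode_scaleA a b x : mode_scale a (mode_scale b x) = mode_scale (a * b) x.
Proof. by apply: val_inj; apply: scalerA. Qed.
Fact mode_scale1 : left_id 1 mode_scale.
Proof. by move=> x; apply: val_inj; apply/eqP/mode_valP. Qed.
Fact mode_scaleDr : right_distributive mode_scale +%R.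
Proof. by move=> a x y; apply: val_inj; apply: scalerDr. Qed.
Fact mode_scaleDl x : {morph mode_scale^~ x : a b / a + b}.
Proof. by move=> a b; apply: val_inj; apply: scalerDl. Qed.

HB.instance Definition _ := GRing.Zmodule_isLmodule.Build (corner e)^c mode
  mode_scaleA mode_scale1 mode_scaleDr mode_scaleDl.

End CornerModRight.

Section Radical.
Variable R : pzRingType.

Definition max_left_ideal (m : {pred R^o}) : Prop :=
  [/\ submod_closed m, 1 \notin m &
      forall m' : {pred R^o}, submod_closed m' -> 1 \notin m' ->
        {subset m <= m'} -> {subset m' <= m}].

Definition jrad_pred : {pred R} :=
  fun x => `[< forall m : {pred R^o}, max_left_ideal m -> (x : R^o) \in m >].

Lemma jrad_predP (x : R) :
  reflect (forall m : {pred R^o}, max_left_ideal m -> (x : R^o) \in m)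
          (x \in jrad_pred).
Proof. exact: asboolP. Qed.

Fact jrad_submod_closed : submod_closed (jrad_pred : {pred R^o}).
Proof.
split=> [|a x y]; first by apply/jrad_predP=> m [[]].
move=> /jrad_predP xJ /jrad_predP yJ; apply/jrad_predP=> m mm.
have [[_ mlin] _ _] := mm.
by apply: mlin; [apply: xJ | apply: yJ].
Qed.

Definition jrad : submodule R^o := Submodule jrad_submod_closed.

Lemma jrad_mulr (x r : R) : x \in jrad_pred -> x * r \in jrad_pred.
Proof.
move=> /jrad_predP xJ; apply/jrad_predP=> m mm.
have [[m0 mlin] m1 mmax] := mm.
have mZ (a : R) (b : R^o) : b \in m -> (a * b : R^o) \in m.
  by move=> bm; rewrite -[_ * _]addr0; apply: (mlin a b 0).
have [rm|rNm] := boolP ((r : R^o) \in m); first exact: mZ.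
pose L : {pred R^o} := fun a => ((a : R) * r : R^o) \in m.
have LP (a : R) : (a \in L) = ((a * r : R^o) \in m) by [].
suff Lmax : max_left_ideal L by rewrite -LP; apply: xJ.
split=> [|| L' [L'0 L'lin] L'1 LL' b bL'].
- split=> [|a u v]; first by rewrite LP mul0r.
  by rewrite !LP mulrDl -mulrA => um vm; apply: (mlin a).
- by rewrite LP mul1r.
rewrite LP; apply/negPn/negP => brm.
(* [m + R b r] is a left ideal strictly larger than [m], so it is [R]. *)
pose M : {pred R^o} :=
  fun y => `[< exists2 z, z \in m & exists c : R, y = (z : R) + c * (b * r) >].
have M1 : 1 \in M.
  apply/negPn/negP => M1.
  suff : (b * r : R^o) \in m by apply/negP.
  apply: (mmax M) => //.
  - split; first by apply/asboolP; exists 0 => //; exists 0; rewrite mul0r addr0.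
    move=> a u v /asboolP[z zm [c ->]] /asboolP[z' z'm [c' ->]].
    apply/asboolP; exists (a *: z + z'); first exact: mlin.
    exists (a * c + c'); rewrite /GRing.scale/= mulrDl mulrDr addrACA.
    by rewrite !mulrA.
  - by move=> z zm; apply/asboolP; exists z => //; exists 0; rewrite mul0r addr0.
  - by apply/asboolP; exists 0 => //; exists 1; rewrite mul1r add0r.
have /asboolP[z zm [c E]] := M1.
have zE : (z : R) = 1 - c * (b * r) by rewrite E addrK.
have rL : (1 - r * c * b : R^o) \in L.
  rewrite LP mulrBl mul1r -!mulrA.
  have -> : r - r * (c * (b * r)) = r * z by rewrite zE mulrBr mulr1.
  exact: mZ.
move/negP: L'1; apply.
have := L'lin (r * c : R) b (1 - r * c * b) bL' (LL' _ rL).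
by rewrite /GRing.scale /= addrC subrK.
Qed.

(* The Jacobson radical is a two-sided ideal, hence also a right ideal. *)
Fact jrad_conv_submod_closed : submod_closed (jrad_pred : {pred (R^c)^o}).
Proof.
have [J0 Jlin] := jrad_submod_closed; split=> // a x y xJ yJ.
have := Jlin 1 (@GRing.mul R x a) y (jrad_mulr a xJ) yJ.
by rewrite /GRing.scale /= mul1r.
Qed.

Definition jrad_conv : submodule (R^c)^o := Submodule jrad_conv_submod_closed.

End Radical.

Section PrincipalModule.
Variables (R : pzRingType) (e : idem R).

Definition lprin_pred : {pred R^o} := fun x => (x : R) * (e : R) == x.

Fact lprin_submod_closed : submod_closed lprin_pred.
Proof.
split=> [|a x y]; rewrite !unfold_in ?mul0r // => /eqP xe /eqP ye.
by rewrite mulrDl -mulrA xe ye.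
Qed.

(* R e, as the set of all x with x e = x *)
Definition lprin : lmodType R := submod (Submodule lprin_submod_closed).

Variable I : submodule R^o.

Definition lprin_ideal_pred : {pred lprin} :=
  fun u => `[< exists2 x : R, (x : R^o) \in I & submod_val u = x * (e : R) >].

Fact lprin_ideal_submod_closed : submod_closed lprin_ideal_pred.
Proof.
split; first by apply/asboolP; exists 0; rewrite ?rpred0 ?mul0r.
move=> a u v /asboolP[x xI ux] /asboolP[y yI vy]; apply/asboolP.
exists (a *: (x : R^o) + y); first by rewrite rpredD ?rpredZ.
have -> : submod_val (a *: u + v) = a * (submod_val u : R) + (submod_val v : R).
  by [].
by rewrite ux vy mulrA -mulrDl.
Qed.

(* R e / I e *)
Definition lprin_quot : lmodType R := quotmod (Submodule lprin_ideal_submod_closed).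

End PrincipalModule.

(* The projection M x N -> M x 0 along N, as an idempotent endomorphism. *)
Section SummandProjection.
Variables (R : pzRingType) (M N : lmodType R).

Definition summand_proj_fun (x : M * N) : M * N := (x.1, 0).

Fact summand_proj_is_linear : linear summand_proj_fun.
Proof.
by move=> a [x x'] [y y']; congr pair; rewrite /= -[LHS]addr0 ?addr0 ?scaler0.
Qed.
HB.instance Definition _ := GRing.isLinear.Build R (M * N)%type (M * N)%type _
  summand_proj_fun summand_proj_is_linear.

Fact summand_proj_idem_subproof :
  Endo summand_proj_fun * Endo summand_proj_fun = Endo summand_proj_fun.
Proof. by apply: endoP. Qed.

Definition summand_proj : idem (endo (M * N)%type) :=
  Idem summand_proj_idem_subproof.

End SummandProjection.

Section ModuleNotions.
Variable R : pzRingType.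
Implicit Types M N X Y E T U : lmodType R.

Definition fin_gen M : Prop :=
  exists n (g : 'I_n -> M), forall x, exists a : 'I_n -> R,
    x = \sum_(i < n) a i *: g i.

Definition zero_module M : Prop := forall x : M, x = 0.

Definition mod_iso M N : Prop := exists f : {linear M -> N}, bijective f.

Definition mod_power M n : lmodType R := dsum (fun _ : 'I_n => M).

Definition in_add M X : Prop :=
  exists n Y, mod_iso (X * Y)%type (mod_power M n).

Definition indecomposable M : Prop :=
  ~ zero_module M /\
  forall X Y, mod_iso M (X * Y)%type -> zero_module X \/ zero_module Y.

Definition basic_module M : Prop :=
  forall X Y, indecomposable X -> ~ mod_iso M ((X * X) * Y)%type.

Definition projective M : Prop :=
  forall X Y (g : {linear X -> Y}) (f : {linear M -> Y}),
    (forall y, exists x, g x = y) ->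
    exists h : {linear M -> X}, forall x, f x = g (h x).

Definition injective_module M : Prop :=
  forall X Y (g : {linear X -> Y}) (f : {linear X -> M}),
    injective g ->
    exists h : {linear Y -> M}, forall x, f x = h (g x).

Definition injective_envelope M E (iota : {linear M -> E}) : Prop :=
  [/\ injective_module E, injective iota &
      forall S : submodule E, (exists2 x, x \in S & x != 0) ->
        exists2 x, iota x \in S & x != 0].

Record proj_resolution M := ProjResolution {
  pres_mod :> nat -> lmodType R;
  pres_d : forall i, {linear pres_mod i.+1 -> pres_mod i};
  pres_aug : {linear pres_mod 0 -> M};
  pres_proj : forall i, projective (pres_mod i);
  pres_aug_surj : forall x, exists p, pres_aug p = x;
  pres_exact0 : forall p, pres_aug p = 0 <-> exists q, p = pres_d 0 q;
  pres_exactS : forall i p, pres_d i p = 0 <-> exists q, p = pres_d i.+1 q }.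

Definition finite_pdim M : Prop :=
  exists n (P : proj_resolution M), forall i, (n < i)%N -> zero_module (P i).

(* Ext^i(M, N) = 0 for all i >= 1: the complex Hom(P, N) has no cohomology in
   positive degrees, for P a projective resolution of M. *)
Definition Ext_pos_vanish M N : Prop :=
  forall (P : proj_resolution M) i (f : {linear P i.+1 -> N}),
    (forall p, f (pres_d P i.+1 p) = 0) ->
    exists g : {linear P i -> N}, forall p, f p = g (pres_d P i p).

(* P^{<oo}(R-mod) *)
Definition Pfin M : Prop := fin_gen M /\ finite_pdim M.

Definition Pfin_approx X M (phi : {linear X -> M}) : Prop :=
  Pfin X /\
  forall Y (f : {linear Y -> M}), Pfin Y ->
    exists g : {linear Y -> X}, forall y, f y = phi (g y).

Definition minimal_Pfin_approx X M (phi : {linear X -> M}) : Prop :=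
  Pfin_approx phi /\
  forall u : {linear X -> X}, (forall x, phi (u x) = phi x) -> bijective u.

Definition Pfin_contravariantly_finite : Prop :=
  forall M, fin_gen M -> exists X (phi : {linear X -> M}), Pfin_approx phi.

(* An exact sequence 0 -> R -> T_0 -> ... -> T_s -> 0 with all T_j in add T,
   continued by T_j = 0 for j > s. *)
Definition has_add_coresolution T : Prop :=
  exists (s : nat) (C : nat -> lmodType R) (iota : {linear R^o -> C 0%N})
         (d : forall j, {linear C j -> C j.+1}),
    [/\ forall j, in_add T (C j),
        forall j, (s < j)%N -> zero_module (C j),
        injective iota,
        forall x, d 0%N x = 0 <-> exists r, x = iota r &
        forall j x, d j.+1 x = 0 <-> exists y, x = d j y].

Definition tilting T : Prop :=
  [/\ Pfin T, Ext_pos_vanish T T & has_add_coresolution T].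

Definition strong_tilting T : Prop :=
  tilting T /\ forall M, Pfin M -> Ext_pos_vanish M T.

Definition basic_strong_tilting T : Prop :=
  strong_tilting T /\ basic_module T.

Definition primitive_idem (e : idem R) : Prop :=
  (e : R) <> 0 /\
  forall f g : idem R, (f : R) * (g : R) = 0 -> (g : R) * (f : R) = 0 ->
    (e : R) = (f : R) + (g : R) -> (f : R) = 0 \/ (g : R) = 0.

(* The simple module S_e = R e / J e, for e a primitive idempotent *)
Definition simple_top (e : idem R) : lmodType R := lprin_quot e (jrad R).

(* R/J is a product of division rings *)
Definition basic_ring : Prop :=
  exists (q : nat) (D : 'I_q -> unitRingType)
         (pi : forall i, {rmorphism R -> D i}),
    [/\ forall i (x : D i), x != 0 -> x \is a GRing.unit,
        forall d : forall i, D i, exists x, forall i, pi i x = d i &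
        forall x, (x : R^o) \in jrad R <-> forall i, pi i x = 0].

End ModuleNotions.

Definition artinian_ring (k : comNzRingType) : Prop :=
  forall I : nat -> submodule k^o,
    (forall n, {subset I n.+1 <= I n}) ->
    exists n, forall m, (n <= m)%N -> I m =i I n.

Definition artin_algebra (k : comNzRingType) (A : algType k) : Prop :=
  artinian_ring k /\ fin_gen (A : lmodType k).

(* The modules T_1, ..., T_m, T_{m+1}, ..., T_{m+p} that make up the basic
   strong tilting module, relative to orthogonal primitive idempotents
   eps_1, ..., eps_{m+p} of which the first m sum to e and the others to 1 - e;
   A_i is the minimal approximation of the injective envelope E_i of the simple
   module S_i. *)
Section Decomposition.
Variables (R : pzRingType) (m p : nat).

Definition idem_splitting (e : idem R) (eps : 'I_(m + p) -> idem R) : Prop :=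
  [/\ forall i, primitive_idem (eps i),
      forall i j, i != j -> (eps i : R) * (eps j : R) = 0,
      (e : R) = \sum_(i < m) (eps (lshift p i) : R) &
      1 - (e : R) = \sum_(j < p) (eps (rshift m j) : R)].

Variable T : 'I_(m + p) -> lmodType R.

Definition T_left : lmodType R := dsum (fun i : 'I_m => T (lshift p i)).
Definition T_right : lmodType R := dsum (fun j : 'I_p => T (rshift m j)).

Definition tilting_decomposition (eps : 'I_(m + p) -> idem R)
    (A : 'I_(m + p) -> lmodType R) : Prop :=
  let A_left : lmodType R := dsum (fun i : 'I_m => A (lshift p i)) in
  [/\ forall i : 'I_m,
        indecomposable (T (lshift p i)) /\ in_add A_left (T (lshift p i)),
      forall i j : 'I_m,
        mod_iso (T (lshift p i)) (T (lshift p j)) -> i = j,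
      forall X, indecomposable X -> in_add A_left X ->
        exists i : 'I_m, mod_iso X (T (lshift p i)) &
      forall j : 'I_p, let l := rshift m j in
        [/\ indecomposable (T l),
            (* a copy of S_l in T_l is contained in the socle *)
            exists f : {linear simple_top (eps l) -> T l}, injective f &
            exists U, in_add T_left U /\ mod_iso (A l) (T l * U)%type]].

End Decomposition.

(* Main.v *)
Require Import Defs.
From HB Require Import structures.
From mathcomp Require Import all_boot all_algebra.
From mathcomp Require Import boolp classical_sets functions.

(* Write S'' for the direct sum of the simple modules annihilated by e.  Finitely
   generated modules annihilated by e lie in P^{<oo}, so a finitely generated M lies
   in P^{<oo} if and only if eM does.  Minimality of the approximations A_i forces
   their e-annihilated submodules to embed into E(S_i); hence A_i has none for i <= m,
   T' has none, and the e-annihilated part of the socle of T is exactly the copy of S'' in T''.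

   Since Hom(S'', T') = Ext^1(S'', T') = 0, every map eM -> eT' extends uniquely to
   M -> T'; this gives End(T') = End(eT') and Ext(eM, eT') = 0 for M in P^{<oo}.
   Modules in P^{<oo} embed into products of the A_i with cokernel in P^{<oo}, and the
   resulting coresolutions by add(T), resp. add(eT'), are finite because the
   projective dimensions are bounded.  Applying Hom(-, eT') to a coresolution of eT''
   gives a finite projective resolution of Hom(eT'', eT') = Hom(T'', T'), which is
   (ii).  For (i), Hom(T'', T) -> Hom(S'', T) is onto with kernel the radical part:
   an endomorphism of T'' that vanishes on S'' is nilpotent, as by Fitting's lemma a
   nonzero summand of T'' on which it is bijective would contain some S_j. *)

Set Implicit Arguments.
Unset Strict Implicit.
Unset Printing Implicit Defensive.
Import GRing.Theory.
Local Open Scope ring_scope.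

(** * Submodules, quotients and short exact sequences *)

(** Ext groups are never formed. Only their vanishing is needed, and [ext0] phrases it as
    extendability of maps along short exact sequences, so that each piece of a long exact sequence
    becomes a pullback argument valid for arbitrary modules; quantified over all second arguments,
    it measures projective dimension. Hom(S'', T') = 0 because S'' is e-torsion and T' is
    e-torsion-free; Ext^1(S'', T') = 0 because S'' lies in P^{<oo} and T is strong. The bound on
    projective dimensions comes from the coresolution of A by add(T): if s is its length, then
    Ext^i(M, A) = 0 for M in P^{<oo} and i > s, whereas a finitely generated M of finite projective
    dimension d > 0 has Ext^d(M, A) nonzero. As A is basic, the one-sided ideals of A/J are
    generated by central idempotents. Lifting these ([ideal_cut]) replaces the structure theory of
    semisimple modules: modulo J, the annihilator of a semisimple element is generated by a single
    ring element. *)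

Section Linear.
Variable R : pzRingType.
Implicit Types (A B C K U V W M N Q X Y Z : lmodType R).

Definition lin U V (f : U -> V)
    (H : forall a x y, f (a *: x + y) = a *: f x + f y) : {linear U -> V} :=
  HB.pack f (GRing.isLinear.Build R U V _ f H).

Arguments lin {U V} f H.

Lemma linE U V (f : U -> V) H : lin f H =1 f.
Proof. by []. Qed.

Fact inL_linear M N a (x y : M) :
  (a *: x + y, 0) = a *: (x, 0) + (y, 0) :> (M * N)%type.
Proof. by congr pair; rewrite /= scaler0 addr0. Qed.
Definition inL M N : {linear M -> (M * N)%type} := lin (fun x => (x, 0)) (@inL_linear M N).
Fact inR_linear M N a (x y : N) :
  (0, a *: x + y) = a *: (0, x) + (0, y) :> (M * N)%type.
Proof. by congr pair; rewrite /= scaler0 addr0. Qed.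
Definition inR M N : {linear N -> (M * N)%type} := lin (fun x => (0, x)) (@inR_linear M N).

Fact scal_map_linear M (x : M) a (u v : R^o) :
  (a *: u + v : R) *: x = a *: ((u : R) *: x) + (v : R) *: x.
Proof. by rewrite scalerDl scalerA. Qed.
Definition scal_map M (x : M) : {linear R^o -> M} :=
  lin (fun u : R^o => (u : R) *: x) (scal_map_linear x).

(** Submodules are handled as [Prop]-valued predicates, so that kernels, images and torsion parts
    need no boolean form. *)
Definition psub V (P : V -> Prop) : Prop :=
  P 0 /\ forall a x y, P x -> P y -> P (a *: x + y).

Lemma psub0 V (P : V -> Prop) : psub P -> P 0. Proof. by case. Qed.
Lemma psubD V (P : V -> Prop) : psub P -> forall x y, P x -> P y -> P (x + y).
Proof. by case=> _ H x y Px Py; have := H 1 x y Px Py; rewrite scale1r. Qed.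
Lemma psubZ V (P : V -> Prop) : psub P -> forall a x, P x -> P (a *: x).
Proof. by case=> P0 H a x Px; have := H a x 0 Px P0; rewrite addr0. Qed.
Lemma psubB V (P : V -> Prop) : psub P -> forall x y, P x -> P y -> P (x - y).
Proof. by case=> P0 H x y Px Py; have := H (-1) y x Py Px; rewrite scaleN1r addrC. Qed.
Lemma psub_sum V (P : V -> Prop) (I : finType) (F : I -> V) :
  psub P -> (forall i, P (F i)) -> P (\sum_i F i).
Proof. by move=> sP PF; elim/big_ind: _ => //; [apply: psub0|apply: psubD]. Qed.

Lemma psub_ker U V (f : {linear U -> V}) : psub (fun x => f x = 0).
Proof.
by split=> [|a x y]; rewrite ?linear0 // linearP => -> ->; rewrite scaler0 addr0.
Qed.
Lemma psub_im U V (f : {linear U -> V}) : psub (fun y => exists x, y = f x).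
Proof.
split=> [|a _ _ [x ->] [y ->]]; first by exists 0; rewrite linear0.
by exists (a *: x + y); rewrite linearP.
Qed.
Lemma psub_preim U V (f : {linear U -> V}) (P : V -> Prop) :
  psub P -> psub (fun x => P (f x)).
Proof.
by move=> [P0 PL]; split=> [|a x y Px Py]; rewrite ?linear0 // linearP; apply: PL.
Qed.

Fact psub_submod V (P : V -> Prop) :
  psub P -> submod_closed ((fun x => `[< P x >]) : {pred V}).
Proof.
case=> P0 PL; split; first exact/asboolP.
by move=> a x y /asboolP Px /asboolP Py; apply/asboolP/PL.
Qed.
Definition mksub V (P : V -> Prop) (H : psub P) := Submodule (psub_submod H).
Lemma mksubP V (P : V -> Prop) (H : psub P) x : reflect (P x) (x \in mksub H).
Proof. exact: asboolP. Qed.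

Lemma sub_ex V (P : V -> Prop) : psub P ->
  exists K (j : {linear K -> V}), injective j /\ forall x, P x <-> exists k, x = j k.
Proof.
move=> H; pose S := mksub H.
exists (submod S), (@lin (submod S) V (@submod_val R V S) (fun a x y => erefl _)).
split=> [|x]; first exact: val_inj.
split=> [Px|[k ->]]; last exact/(mksubP H)/submod_valP.
by exists (Submod ((introT (mksubP H x) Px) : x \in submod_pred S)).
Qed.

Lemma quo_ex V (P : V -> Prop) : psub P ->
  exists Q (q : {linear V -> Q}), (forall y, exists x, q x = y) /\
    forall x, q x = 0 <-> P x.
Proof.
move=> H; pose S := mksub H.
have qL a x y : @quotmod_pi R V S (a *: x + y) = a *: (quotmod_pi S x : quotmod S) + quotmod_pi S y.
  by rewrite quotmod_piD; congr (_ + _); rewrite -quotmod_scale_pi.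
exists (quotmod S), (@lin V (quotmod S) _ qL); split=> [y|x].
  by exists (quotmod_repr y); apply: quotmod_reprK.
rewrite linE; have q0 : quotmod_pi S 0 = 0 :> quotmod S.
  have E := qL 1 0 0; rewrite !scale1r addr0 in E.
  by apply: (addrI (quotmod_pi S 0 : quotmod S)); rewrite addr0 -E.
rewrite -q0; split=> [/quotmod_piP|Px]; first by rewrite subr0 => /mksubP.
by apply/quotmod_piP; rewrite subr0; apply/mksubP.
Qed.

Lemma lin_inj U V (f : {linear U -> V}) : (forall x, f x = 0 -> x = 0) -> injective f.
Proof. by move=> H x y E; apply/subr0_eq/H; rewrite linearB E subrr. Qed.

Lemma inj0 U V (f : {linear U -> V}) x : injective f -> f x = 0 -> x = 0.
Proof. by move=> fi; rewrite -[X in _ = X](linear0 f); apply: fi. Qed.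

Lemma factor V Q Z (q : {linear V -> Q}) (f : {linear V -> Z}) :
  (forall y, exists x, q x = y) -> (forall x, q x = 0 -> f x = 0) ->
  exists g : {linear Q -> Z}, forall x, g (q x) = f x.
Proof.
move=> /choice[s sP] H.
have E x y : q x = q y -> f x = f y.
  by move=> E; apply/subr0_eq; rewrite -linearB H // linearB E subrr.
have L a x y : f (s (a *: x + y)) = a *: f (s x) + f (s y).
  by rewrite -linearP; apply: E; rewrite linearP !sP.
by exists (lin (fun x => f (s x)) L) => x; apply: E; rewrite sP.
Qed.

Lemma colift V K Z (j : {linear K -> V}) (f : {linear Z -> V}) :
  injective j -> (forall z, exists k, f z = j k) ->
  exists g : {linear Z -> K}, forall z, j (g z) = f z.
Proof.
move=> ji /choice[s sP].
have L a x y : s (a *: x + y) = a *: s x + s y.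
  by apply: ji; rewrite linearP -!sP linearP.
by exists (lin s L) => z; rewrite linE sP.
Qed.

Lemma bij_lin_inv U V (f : {linear U -> V}) :
  injective f -> (forall y, exists x, f x = y) ->
  exists g : {linear V -> U}, cancel f g /\ cancel g f.
Proof.
move=> fi fs; have [|g gP] := @colift V U V f idfun fi.
  by move=> z; have [x <-] := fs z; exists x.
by exists g; split=> x; [apply: fi|]; rewrite gP.
Qed.

Lemma surj_inj_bij U V (f : {linear U -> V}) :
  injective f -> (forall y, exists x, f x = y) -> bijective f.
Proof. by move=> fi fs; have [g [fK gK]] := bij_lin_inv fi fs; exists g. Qed.

Definition ses K W M (j : {linear K -> W}) (p : {linear W -> M}) : Prop :=
  [/\ injective j, forall y, exists x, p x = y & forall x, p x = 0 <-> exists k, x = j k].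

Lemma ses0 K W M (j : {linear K -> W}) (p : {linear W -> M}) k : ses j p -> p (j k) = 0.
Proof. by case=> _ _ H; apply/H; exists k. Qed.

Lemma ses_ker W M (p : {linear W -> M}) : (forall y, exists x, p x = y) ->
  exists K (j : {linear K -> W}), ses j p.
Proof.
move=> ps; have [K [j [ji jP]]] := sub_ex (psub_ker p).
by exists K, j.
Qed.

Lemma ses_coker K W (j : {linear K -> W}) : injective j ->
  exists M (p : {linear W -> M}), ses j p.
Proof.
move=> ji; have [Q [q [qs qP]]] := quo_ex (psub_im j).
by exists Q, q.
Qed.

Lemma image_ex V W (f : {linear V -> W}) :
  exists N (q : {linear V -> N}) (j : {linear N -> W}),
  [/\ forall y, exists x, q x = y, injective j & forall x, f x = j (q x)].
Proof.
have [N [j [ji jP]]] := sub_ex (psub_im f).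
have [|q qP] := colift (f := f) ji; first by move=> z; apply/jP; exists z.
exists N, q, j; split=> // y.
have /jP[x xE] : exists k, j y = j k by exists y.
by exists x; apply: ji; rewrite qP.
Qed.

Lemma pullback B Q C (p : {linear B -> C}) (g : {linear Q -> C}) :
  exists Z (z1 : {linear Z -> B}) (z2 : {linear Z -> Q}),
  [/\ forall z, p (z1 z) = g (z2 z),
      forall b q, p b = g q -> exists z, z1 z = b /\ z2 z = q &
      forall z, z1 z = 0 -> z2 z = 0 -> z = 0].
Proof.
have [|Z [j [ji jP]]] := @sub_ex (B * Q)%type (fun x => p x.1 = g x.2).
  by split=> [|a x y /= E1 E2]; rewrite ?linear0 // !linearP E1 E2.
exists Z, (fst \o j), (snd \o j); split=> [z|b q E|z /= z1 z2].
- by apply/jP; exists z.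
- by have /jP[z zE] : p (b, q).1 = g (b, q).2 by []; exists z; rewrite /= -zE.
by apply: (inj0 ji); rewrite [j z]surjective_pairing z1 z2.
Qed.

(** Direct summands up to isomorphism, without a chosen complement; [retract_compl] supplies one
    where it is needed. *)
Definition retract M N : Prop :=
  exists (s : {linear M -> N}) (r : {linear N -> M}), forall x, r (s x) = x.

Lemma retract_prodl M N : retract M (M * N)%type.
Proof. by exists (inL M N), fst.
Qed.
Lemma retract_prodr M N : retract N (M * N)%type.
Proof. by exists (inR M N), snd.
Qed.

Lemma ses_prod M N : exists (j : {linear M -> (M * N)%type}) (p : {linear (M * N)%type -> N}),
  ses j p.
Proof.
exists (inL M N), snd; split=> [x y [] //|y|[x y]]; first by exists (0, y).
by split=> [/= -> |[k [_ ->]]] //; exists x.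
Qed.

Lemma proj_split (P W : lmodType R) (p : {linear W -> P}) : projective P -> (forall y, exists x, p x = y) ->
  exists s : {linear P -> W}, forall x, p (s x) = x.
Proof.
by move=> Pp ps; have [h hP] := Pp _ _ p idfun ps; exists h => x; rewrite -hP.
Qed.

Lemma proj_retract (P N : lmodType R) : retract P N -> projective N -> projective P.
Proof.
move=> [s [r rs]] Np X Y g f gs; have [h hP] := Np X Y g (f \o r) gs.
by exists (h \o s) => x; rewrite /= -hP /= rs.
Qed.

Lemma proj_prod (P N : lmodType R) : projective P -> projective N -> projective (P * N)%type.
Proof.
move=> Pp Np X Y g f gs.
have [s1 [r1 _]] := retract_prodl P N; have [s2 [r2 _]] := retract_prodr P N.
have [h1 h1P] := Pp X Y g (f \o inL P N) gs.
have [h2 h2P] := Np X Y g (f \o inR P N) gs.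
exists ((h1 \o fst) \+ (h2 \o snd)) => -[x y] /=.
rewrite linearD -h1P -h2P /= -linearD; congr (f _).
by congr pair; rewrite /= ?addr0 ?add0r.
Qed.

End Linear.
Arguments lin {R U V} f H.
Arguments inL {R} M N.
Arguments inR {R} M N.


(** * Free modules *)

Section Free.
Variables (R : pzRingType) (I : choiceType).

Local Notation fct := (I -> R^o : lmodType R).

Lemma fct_linE a (f g : fct) x : (a *: f + g) x = a *: f x + g x.
Proof. by []. Qed.

Lemma fct_addE (f g : fct) x : (f + g) x = f x + g x.
Proof. by []. Qed.

Definition fin_supp (f : fct) := exists s : seq I, forall x, x \notin s -> f x = 0.

Lemma fin_supp_psub : psub fin_supp.
Proof.
split=> [|a f g [s sP] [t tP]]; first by exists [::].
exists (s ++ t) => x; rewrite mem_cat negb_or => /andP[xs xt].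
by rewrite fct_linE sP // tP // scaler0 addr0.
Qed.

Section Eval.
Variables (X : lmodType R) (v : I -> X).

Lemma fin_supp_sum (f : fct) (s t : seq I) :
  uniq s -> uniq t -> {subset s <= t} -> (forall x, x \notin s -> f x = 0) ->
  \sum_(x <- t) (f x : R) *: v x = \sum_(x <- s) (f x : R) *: v x.
Proof.
move=> us ut st f0.
rewrite (bigID (mem s)) /= [X in _ + X]big1 ?addr0; last by move=> x /f0->; rewrite scale0r.
rewrite -big_filter; apply: perm_big; apply: uniq_perm; rewrite ?filter_uniq // => x.
by rewrite mem_filter; case: (boolP (x \in s)) => // /st.
Qed.

(** The support is chosen, and 0 is a default for functions of infinite support; [fin_evalE] shows
    that the choice does not matter. *)
Definition fin_eval (f : fct) : X :=
  match pselect (fin_supp f) with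
  | left H => \sum_(x <- undup (sval (cid H))) (f x : R) *: v x
  | right _ => 0
  end.

Lemma fin_evalE (f : fct) s : uniq s -> (forall x, x \notin s -> f x = 0) ->
  fin_eval f = \sum_(x <- s) (f x : R) *: v x.
Proof.
move=> us f0; rewrite /fin_eval; case: pselect => [H|[]]; last by exists s.
case: cid => /= t tP; pose r := undup (s ++ t).
have E u : uniq u -> {subset u <= s ++ t} -> (forall x, x \notin u -> f x = 0) ->
    \sum_(x <- u) (f x : R) *: v x = \sum_(x <- r) (f x : R) *: v x.
  move=> uu ust uP; apply/esym/fin_supp_sum; rewrite ?undup_uniq // => x /ust.
  by rewrite mem_undup.
rewrite !E ?undup_uniq // => x; rewrite ?mem_undup ?mem_cat => H'; rewrite ?H' ?orbT //.
exact: tP.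
Qed.

Lemma fin_eval_linear a (f g : fct) : fin_supp f -> fin_supp g ->
  fin_eval (a *: f + g) = a *: fin_eval f + fin_eval g.
Proof.
move=> [s sP] [t tP]; pose r := undup (s ++ t).
have rP x : x \notin r -> x \notin s /\ x \notin t.
  by rewrite mem_undup mem_cat negb_or => /andP.
rewrite !(@fin_evalE _ r) ?undup_uniq //.
- rewrite scaler_sumr -big_split; apply: eq_bigr => x _.
  by rewrite fct_linE scalerDl scalerA.
- by move=> x /rP[_ /tP].
- by move=> x /rP[/sP].
by move=> x /rP[/sP f0 /tP g0]; rewrite fct_linE f0 g0 scaler0 addr0.
Qed.

End Eval.

Definition fin_delta (x : I) : fct := fun y => (x == y)%:R.

Lemma fin_delta_supp x : fin_supp (fin_delta x).
Proof.
by exists [:: x] => y; rewrite inE /fin_delta eq_sym => /negPf->.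
Qed.

Lemma fin_eval_delta (X : lmodType R) (v : I -> X) x : fin_eval v (fin_delta x) = v x.
Proof.
rewrite (@fin_evalE _ _ _ [:: x]) //; last first.
  by move=> y; rewrite inE /fin_delta eq_sym => /negPf->.
by rewrite big_seq1 /fin_delta eqxx scale1r.
Qed.

(** The uniqueness clause is what turns agreement on the basis into agreement of maps when
    projectivity is derived. *)
Lemma free_module_exists : exists (F : lmodType R) (b : I -> F),
  forall (X : lmodType R) (v : I -> X),
  exists h : {linear F -> X}, (forall i, h (b i) = v i) /\
    forall h' : {linear F -> X}, (forall i, h' (b i) = v i) -> h' =1 h.
Proof.
have [F [j [ji jP]]] := sub_ex fin_supp_psub.
have /choice[b bP] i : exists x, fin_delta i = j x by apply/jP/fin_delta_supp.
have js x : fin_supp (j x) by apply/jP; exists x.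
exists F, b => X v.
have L a x y : fin_eval v (j (a *: x + y)) = a *: fin_eval v (j x) + fin_eval v (j y).
  by rewrite linearP fin_eval_linear.
exists (lin (fun x => fin_eval v (j x)) L); split=> [i|h' h'P x].
  by rewrite linE -bP fin_eval_delta.
have [s sP] := js x; pose r := undup s.
have rP y : y \notin r -> j x y = 0 by rewrite mem_undup; apply: sP.
have -> : x = \sum_(y <- r) (j x y : R) *: b y.
  apply: ji; rewrite linear_sum; apply/funext => z.
  have -> : (\sum_(y <- r) j ((j x y : R) *: b y)) z = \sum_(y <- r) (j x y : R) *: fin_delta y z.
    by elim: (r) => [|y u IH]; rewrite ?big_nil // !big_cons fct_addE IH linearZ -bP.
  have [zr|zr] := boolP (z \in r); last first.
    rewrite rP // big_seq big1 // => y yr; rewrite /fin_delta.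
    by case: eqP yr zr => [->->|_ _ _] //; rewrite scaler0.
  rewrite (bigD1_seq z) ?undup_uniq //= big1 => [|y yz]; rewrite /fin_delta.
    by rewrite eqxx addr0 /GRing.scale /= mulr1.
  by rewrite (negPf yz) scaler0.
rewrite !linear_sum; apply: eq_bigr => y _; rewrite !linearZ h'P; congr (_ *: _).
by rewrite linE -bP fin_eval_delta.
Qed.

End Free.

Lemma proj_cover (R : pzRingType) (M : lmodType R) :
  exists (P : lmodType R) (p : {linear P -> M}), projective P /\ forall y, exists x, p x = y.
Proof.
have [F [b bP]] := free_module_exists R M.
have [p [pP _]] := bP M id.
exists F, p; split=> [X Y g f gs|y]; last by exists (b y).
have /choice[v vP] i : exists x, g x = f (b i) by apply: gs.
have [h [hP _]] := bP X v; exists h => x.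
have [k [_ kU]] := bP Y (fun i => f (b i)).
rewrite (kU f) // -(kU (g \o h)) // => i.
by rewrite /= hP.
Qed.

(** * Vanishing of Ext *)
Section Ext.
Variable R : pzRingType.
Implicit Types (A B C K U V W M N P Q X Y Z : lmodType R).

(* [ext0 i M V] says that Ext^(i+1)(M, V) = 0 (note the shift). *)
Fixpoint ext0 (i : nat) M V : Prop :=
  match i with
  | 0 => forall K W (j : {linear K -> W}) (p : {linear W -> M}), ses j p ->
           forall f : {linear K -> V}, exists g : {linear W -> V}, forall k, g (j k) = f k
  | i'.+1 => forall K W (j : {linear K -> W}) (p : {linear W -> M}), ses j p ->
           projective W -> ext0 i' K V
  end.

Lemma ext0_extend K W M V (j : {linear K -> W}) (p : {linear W -> M}) :
  ses j p -> ext0 0 M V -> forall f : {linear K -> V}, exists g : {linear W -> V},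
    forall k, g (j k) = f k.
Proof. by move=> jp MV f; apply: MV jp f. Qed.

Lemma proj_ses M : exists K P (j : {linear K -> P}) (p : {linear P -> M}),
  ses j p /\ projective P.
Proof.
have [P [p [Pp ps]]] := proj_cover M.
by have [K [j jp]] := ses_ker ps; exists K, P, j, p.
Qed.

Lemma ses_split_ret K W M (j : {linear K -> W}) (p : {linear W -> M})
    (s : {linear M -> W}) : ses j p -> (forall x, p (s x) = x) ->
  exists t : {linear W -> K}, (forall k, t (j k) = k) /\ forall w, j (t w) = w - s (p w).
Proof.
move=> [ji ps jp] sP.
have [|t tP] := colift (f := idfun \- (s \o p)) ji.
  by move=> z /=; apply/jp; rewrite linearB /= sP subrr.
exists t; split=> // k; apply: ji; rewrite tP /=.
by rewrite (proj2 (jp (j k)) (ex_intro _ k erefl)) linear0 subr0.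
Qed.

Lemma ext0_proj i P V : projective P -> ext0 i P V.
Proof.
elim: i P V => [|i IH] P V Pp K W j p jp => [f|Wp].
  have [_ ps _] := jp; have [s sP] := proj_split Pp ps.
  have [t [tj _]] := ses_split_ret jp sP.
  by exists (f \o t) => k /=; rewrite tj.
have [_ ps _] := jp; have [s sP] := proj_split Pp ps.
have [t [tj _]] := ses_split_ret jp sP.
by apply: IH; apply: proj_retract Wp; exists j, t.
Qed.

(** In the lowest degree the extension of M is pulled back along r to one of N, and the map found
    there is restricted along w |-> (w, s (p w)). In higher degrees a cover of N is built from the
    given cover of M, and K is a summand of its kernel. *)
Lemma ext0_retract i M N V : retract M N -> ext0 i N V -> ext0 i M V.
Proof.
elim: i M N V => [|i IH] M N V [s [r rs]] NV K W j p jp => [f|Wp].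
  have [Z [z1 [z2 [zE zP zI]]]] := pullback p r.
  have [ji ps jpE] := jp.
  have [j' j'P] : exists j' : {linear K -> Z}, forall k, z1 (j' k) = j k /\ z2 (j' k) = 0.
    have [|h hP] := choice (X := K) (P := fun k z => z1 z = j k /\ z2 z = 0).
      by move=> k; apply: zP; rewrite linear0; apply/jpE; exists k.
    have L a x y : h (a *: x + y) = a *: h x + h y.
      apply/subr0_eq/zI; rewrite linearB linearP.
        by rewrite !(proj1 (hP _)) linearP subrr.
      by rewrite !(proj2 (hP _)) scaler0 addr0 subrr.
    by exists (lin h L).
  have jz : ses j' z2.
    split=> [x y E|y|x].
    - by apply: ji; rewrite -(proj1 (j'P x)) -(proj1 (j'P y)) E.
    - have [w wP] := ps (r y).
      by have [z [_ <-]] := zP _ _ wP; exists z.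
    split=> [z20|[k ->]]; last by case: (j'P k).
    have [|k kP] := proj1 (jpE (z1 x)); first by rewrite zE z20 linear0.
    exists k; apply/subr0_eq/zI; rewrite linearB.
      by rewrite (proj1 (j'P k)) kP subrr.
    by rewrite (proj2 (j'P k)) z20 subrr.
  have [g gP] := NV _ _ _ _ jz f.
  have [t tP] : exists t : {linear W -> Z}, forall w, z1 (t w) = w /\ z2 (t w) = s (p w).
    have [|h hP] := choice (X := W) (P := fun w z => z1 z = w /\ z2 z = s (p w)).
      by move=> w; apply: zP; rewrite rs.
    have L a x y : h (a *: x + y) = a *: h x + h y.
      apply/subr0_eq/zI; rewrite linearB linearP.
        by rewrite !(proj1 (hP _)) subrr.
      by rewrite !(proj2 (hP _)) 2!linearP subrr.
    by exists (lin h L).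
  exists (g \o t) => k /=; rewrite -gP; congr (g _); apply/subr0_eq/zI; rewrite linearB.
    by rewrite (proj1 (tP _)) (proj1 (j'P k)) subrr.
  by rewrite (proj2 (tP _)) (proj2 (j'P k)) (ses0 _ jp) linear0 subrr.
have [K' [Q [j' [q [jq Qp]]]]] := proj_ses N.
have [ji ps jpE] := jp; have [j'i qs jqE] := jq.
(* W covers the summand s(M) of N, and Q, projected along s(M), covers the complement. *)
have [h hP] : exists h : {linear (W * Q)%type -> N},
    forall x, h x = s (p x.1) + (q x.2 - s (r (q x.2))).
  by exists ((s \o p \o fst) \+ ((q \o snd) \- (s \o r \o q \o snd))) => x.
have hs y : exists x, h x = y.
  have [w wP] := ps (r y); have [x xP] := qs y.
  by exists (w, x); rewrite hP /= wP xP addrC subrK.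
have [L [l lh]] := ses_ker hs; have [li _ lhE] := lh.
have LV := NV _ _ _ _ lh (proj_prod Wp Qp).
apply: IH LV.
have [|s' s'P] := colift (f := inL W Q \o j) li.
  by move=> k; apply/lhE; rewrite hP /= (ses0 _ jp) !linear0 ?subrr !addr0.
have [|r' r'P] := colift (f := fst \o l) ji.
  move=> x; apply/jpE.
  have := ses0 x lh; rewrite hP => /(congr1 r).
  by rewrite linearD linearB !rs subrr addr0 linear0.
by exists s', r' => x; apply: ji; rewrite r'P /= s'P.
Qed.

Lemma pull_sub B Q K C (p : {linear B -> C}) (j : {linear K -> Q}) (g : {linear Q -> C})
    Z (z1 : {linear Z -> B}) (z2 : {linear Z -> Q}) :
  (forall z, p (z1 z) = g (z2 z)) ->
  (forall b q, p b = g q -> exists z, z1 z = b /\ z2 z = q) ->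
  (forall z, z1 z = 0 -> z2 z = 0 -> z = 0) ->
  ses j g ->
  exists j' : {linear K -> Z}, ses j' z1 /\ forall k, z2 (j' k) = j k.
Proof.
move=> zE zP zI [ji gs jg].
have [|h hP] := choice (X := K) (P := fun k z => z1 z = 0 /\ z2 z = j k).
  by move=> k; apply: zP; rewrite linear0; apply/esym/jg; exists k.
have L a x y : h (a *: x + y) = a *: h x + h y.
  apply/subr0_eq/zI; rewrite linearB linearP.
    by rewrite !(proj1 (hP _)) scaler0 addr0 subrr.
  by rewrite !(proj2 (hP _)) linearP subrr.
exists (lin h L); split; last by move=> k; case: (hP k).
split=> [x y E|y|x].
- by apply: ji; rewrite -(proj2 (hP x)) -(proj2 (hP y)); congr (z2 _).
- have [q /esym qP] := gs (p y).
  by have [z [<- _]] := zP _ _ qP; exists z.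
split=> [z10|[k ->]]; last by case: (hP k).
have [|k kP] := proj1 (jg (z2 x)); first by rewrite -zE z10 linear0.
exists k; apply/subr0_eq/zI; rewrite linearB.
  by rewrite (proj1 (hP k)) z10 subrr.
by rewrite (proj2 (hP k)) kP subrr.
Qed.

(** With Q projective the sequence through A splits, which compares different projective
    presentations as in Schanuel's lemma. *)
Lemma ses_pull A B C Q K (i : {linear A -> B}) (p : {linear B -> C})
    (j : {linear K -> Q}) (g : {linear Q -> C}) :
  ses i p -> ses j g ->
  exists Z (z1 : {linear Z -> B}) (z2 : {linear Z -> Q})
    (j' : {linear K -> Z}) (i' : {linear A -> Z}), [/\ ses j' z1, ses i' z2 &
    (forall k, z2 (j' k) = j k) /\ (forall a, z1 (i' a) = i a)].
Proof.
move=> ip jg; have [Z [z1 [z2 [zE zP zI]]]] := pullback p g.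
have [_ ps _] := ip; have [_ gs _] := jg.
have [j' [j'z j'P]] := pull_sub zE zP zI jg.
have zE' z : g (z2 z) = p (z1 z) by rewrite zE.
have zP' q b : g q = p b -> exists z, z2 z = q /\ z1 z = b.
  by move=> E; have [z [? ?]] := zP _ _ (esym E); exists z.
have zI' z : z2 z = 0 -> z1 z = 0 -> z = 0 by move=> ? ?; apply: zI.
have [i' [i'z i'P]] := pull_sub zE' zP' zI' ip.
by exists Z, z1, z2, j', i'.
Qed.

Lemma ses_split_retract K W M (j : {linear K -> W}) (p : {linear W -> M}) :
  ses j p -> projective M -> retract K W.
Proof.
move=> jp Mp; have [_ ps _] := jp; have [s sP] := proj_split Mp ps.
by have [t [tj _]] := ses_split_ret jp sP; exists j, t.
Qed.

Lemma ses_split_prod K W M (j : {linear K -> W}) (p : {linear W -> M}) :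
  ses j p -> projective M -> retract W (K * M)%type.
Proof.
move=> jp Mp; have [_ ps _] := jp; have [s sP] := proj_split Mp ps.
have [t [tj tE]] := ses_split_ret jp sP.
have L a x y : (t (a *: x + y), p (a *: x + y)) = a *: (t x, p x) + (t y, p y) :> (K * M)%type.
  by rewrite !linearP.
exists (lin (fun x => (t x, p x) : (K * M)%type) L), ((j \o fst) \+ (s \o snd)) => x /=.
by rewrite tE subrK.
Qed.

(** The map is extended in two stages: from K to Z, the preimage of A in W, and from Z to W, where W
    / Z = C. *)
Lemma ext0_mid0 A B C V (i : {linear A -> B}) (p : {linear B -> C}) : ses i p ->
  ext0 0 A V -> ext0 0 C V -> ext0 0 B V.
Proof.
move=> ip AV CV K W j q jq f.
have [Z [z1 [z2 [zE zP zI]]]] := pullback q i.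
have [_ qs _] := jq; have [ii ps ipE] := ip; have [ji _ jqE] := jq.
have z1i : injective z1.
  apply: lin_inj => z z10; apply: zI => //; apply: (inj0 ii).
  by rewrite -zE z10 linear0.
have [|j' j'P] := colift (f := j) z1i.
  move=> k; have [|z [<- _]] := zP (j k) 0; last by exists z.
  by rewrite (ses0 _ jq) linear0.
have jz : ses j' z2.
  split=> [x y E|y|x]; first by apply: ji; rewrite -!j'P E.
    by have [w wP] := qs (i y); have [z [_ <-]] := zP _ _ wP; exists z.
  split=> [z20|[k ->]].
    have [|k kP] := proj1 (jqE (z1 x)); first by rewrite zE z20 linear0.
    by exists k; apply: z1i; rewrite j'P.
  by apply: (inj0 ii); rewrite -zE j'P (ses0 _ jq).
have [g gP] := AV _ _ _ _ jz f.
have zpq : ses z1 (p \o q).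
  split=> // [y|x].
    by have [b <-] := ps y; have [w <-] := qs b; exists w.
  split=> /= [/ipE[a aP]|[k ->]]; first by have [z [<- _]] := zP _ _ aP; exists z.
  by rewrite zE (ses0 _ ip).
have [h hP] := CV _ _ _ _ zpq g.
by exists h => k; rewrite -gP -hP j'P.
Qed.

(** Both claims are proved together. The second follows from the first in the same degree by pulling
    back along a projective cover of C. The first in degree i + 1 follows from the second in degree
    i: the kernels K of W -> B and K' of W -> C form an exact sequence 0 -> K -> K' -> A -> 0. *)
Lemma ext0_mid_left V i :
  (forall A B C (u : {linear A -> B}) (p : {linear B -> C}), ses u p ->
     ext0 i A V -> ext0 i C V -> ext0 i B V) /\
  (forall A B C (u : {linear A -> B}) (p : {linear B -> C}), ses u p ->
     ext0 i B V -> ext0 i.+1 C V -> ext0 i A V).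
Proof.
have step i' : (forall A B C (u : {linear A -> B}) (p : {linear B -> C}), ses u p ->
     ext0 i' A V -> ext0 i' C V -> ext0 i' B V) ->
  (forall A B C (u : {linear A -> B}) (p : {linear B -> C}), ses u p ->
     ext0 i' B V -> ext0 i'.+1 C V -> ext0 i' A V).
  move=> mid A B C u p up BV CV.
  have [K [Q [j [q [jq Qp]]]]] := proj_ses C.
  have [Z [z1 [z2 [j' [i1 [jz iz _]]]]]] := ses_pull up jq.
  apply: (ext0_retract (ses_split_retract iz Qp)).
  exact: (mid _ _ _ _ _ jz (CV _ _ _ _ jq Qp) BV).
elim: i => [|i [mid left]].
  have mid : forall A B C (u : {linear A -> B}) (p : {linear B -> C}), ses u p ->
      ext0 0 A V -> ext0 0 C V -> ext0 0 B V by move=> A B C u p; apply: ext0_mid0.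
  by split=> //; apply: step.
(* [step] asks for the first claim again, so two equal goals remain and are treated in parallel. *)
split; last apply: step.
all: move=> A B C u p up AV CV K W j q jq Wp.
all: have [_ qs _] := jq; have [_ ps upE] := up.
all: have [|K' [j' jq']] := @ses_ker _ _ _ (p \o q); first
  by move=> y; have [b <-] := ps y; have [w <-] := qs b; exists w.
all: have [ui _ _] := up; have [ji _ jqE] := jq; have [j'i _ jq'E] := jq'.
all: have [|l lP] := colift (f := j) j'i; first
  by move=> k; apply/jq'E; rewrite /= (ses0 _ jq) linear0.
all: have [|r rP] := colift (f := q \o j') ui; first
  by move=> k; apply/upE; have /= := ses0 k jq'.
all: apply: (left _ _ _ l r); last exact: AV.
all: try exact: (CV _ _ _ _ jq' Wp).
all: split=> [x y E|y|x]; first by apply: ji; rewrite -!lP E.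
all: try (split=> [r0|[k ->]]; last
  by apply: (inj0 ui); rewrite rP /= lP (ses0 _ jq)).
all: try (have [|k kP] := proj1 (jqE (j' x));
  [by have := rP x; rewrite r0 linear0 | by exists k; apply: j'i; rewrite lP]).
all: have [w wP] := qs (u y).
all: have [|k kP] := proj1 (jq'E w); first by rewrite /= wP (ses0 _ up).
all: by exists k; apply: ui; rewrite rP /= -kP.
Qed.

Lemma ext0_mid i A B C V (u : {linear A -> B}) (p : {linear B -> C}) : ses u p ->
  ext0 i A V -> ext0 i C V -> ext0 i B V.
Proof. exact: (proj1 (ext0_mid_left V i)). Qed.

Lemma ext0_left i A B C V (u : {linear A -> B}) (p : {linear B -> C}) : ses u p ->
  ext0 i B V -> ext0 i.+1 C V -> ext0 i A V.
Proof. exact: (proj2 (ext0_mid_left V i)). Qed.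

Lemma ext0_prod i A B V : ext0 i A V -> ext0 i B V -> ext0 i (A * B)%type V.
Proof. by have [j [p jp]] := ses_prod A B; apply: ext0_mid jp. Qed.

(** The pullback Z of B and W over C is a summand of A x W, as W is projective, and K is the kernel
    of Z -> B. *)
Lemma ext0_right i A B C V (u : {linear A -> B}) (p : {linear B -> C}) : ses u p ->
  ext0 i A V -> ext0 i.+1 B V -> ext0 i.+1 C V.
Proof.
move=> up AV BV K W j q jq Wp.
have [Z [z1 [z2 [j' [i' [jz iz _]]]]]] := ses_pull up jq.
apply: (ext0_left jz _ BV).
apply: (ext0_retract (ses_split_prod iz Wp)).
by apply: ext0_prod => //; apply: ext0_proj.
Qed.

Lemma ext0_cover i K P M V (j : {linear K -> P}) (p : {linear P -> M}) : ses j p ->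
  projective P -> ext0 i K V -> ext0 i.+1 M V.
Proof. by move=> jp Pp KV; apply: (ext0_right jp KV); apply: ext0_proj. Qed.

(** A single projective presentation is enough to test Ext^1. *)
Lemma ext0_cover0 K P M V (j : {linear K -> P}) (p : {linear P -> M}) : ses j p ->
  projective P -> (forall f : {linear K -> V}, exists g : {linear P -> V}, forall k, g (j k) = f k) ->
  ext0 0 M V.
Proof.
move=> jp Pp H K' W j' q jq f.
have [ji ps jpE] := jp; have [j'i qs jqE] := jq.
have [h hP] := Pp _ _ q p qs.
have [|t tP] := colift (f := h \o j) j'i.
  by move=> k; apply/jqE; rewrite /= -hP (ses0 _ jp).
have [g gP] := H (f \o t).
(* On P x K' the map g + f factors through the surjection h + j' onto W. *)
have hs w : exists x, ((h \o fst) \+ (j' \o snd) : {linear (P * K')%type -> W}) x = w.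
  have [x xP] := ps (q w).
  have [|k kP] := proj1 (jqE (w - h x)); first by rewrite linearB -hP xP subrr.
  by exists (x, k); rewrite /= -kP addrC subrK.
have [|d dP] := factor (f := (g \o fst) \+ (f \o snd)) hs.
  move=> [x k] /= E.
  have px : p x = 0.
    have := congr1 q E; rewrite linearD -hP (ses0 _ jq) addr0 linear0.
    by [].
  have [k' k'P] := proj1 (jpE x) px; rewrite k'P gP /= -linearD.
  suff -> : t k' + k = 0 by rewrite linear0.
  by apply: (inj0 j'i); rewrite linearD tP /= -k'P.
by exists d => k; have := dP (0, k); rewrite /= !linear0 !add0r.
Qed.

Lemma ext0_lift K Y V V' (v : {linear V -> Y}) (y : {linear Y -> V'}) (f : {linear K -> V'}) :
  ses v y -> ext0 0 K V -> exists g : {linear K -> Y}, forall k, y (g k) = f k.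
Proof.
move=> vy KV; have [vi ys vyE] := vy.
have [Z [z1 [z2 [zE zP zI]]]] := pullback f y.
have [j' [jz j'P]] := pull_sub zE zP zI vy.
have [r rP] := KV _ _ _ _ jz idfun.
have [_ z1s z1E] := jz.
have [|g gP] := factor (f := z2 \- (v \o r)) z1s.
  by move=> z /z1E[k ->] /=; rewrite j'P rP subrr.
exists g => k; have [z <-] := z1s k.
by rewrite gP /= linearB (ses0 _ vy) subr0 zE.
Qed.

Lemma ext0_snd i M V Y V' (v : {linear V -> Y}) (y : {linear Y -> V'}) : ses v y ->
  ext0 i M Y -> ext0 i.+1 M V -> ext0 i M V'.
Proof.
move=> vy; elim: i M => [|i IH] M MY MV; last first.
  by move=> K W j q jq Wp; apply: IH; [apply: MY jq Wp|apply: MV jq Wp].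
have [K [P [j [p [jp Pp]]]]] := proj_ses M.
apply: (ext0_cover0 jp Pp) => f.
have [h hP] := ext0_lift f vy (MV _ _ _ _ jp Pp).
have [g gP] := MY _ _ _ _ jp h.
by exists (y \o g) => k /=; rewrite gP.
Qed.

(** In the lowest degree, v f extends to h : Q -> Y. The obstruction to landing in V is a map c : K
    -> V'; it extends to P, lifts to Y because P is projective, and is then subtracted from h. *)
Lemma ext0_fst i M V Y V' (v : {linear V -> Y}) (y : {linear Y -> V'}) : ses v y ->
  ext0 i M V' -> ext0 i.+1 M Y -> ext0 i.+1 M V.
Proof.
move=> vy; elim: i M => [|i IH] M MV MY; last first.
  by move=> K W j q jq Wp; apply: IH; [apply: MV jq Wp|apply: MY jq Wp].
move=> K P j p jp Pp; have KY := MY _ _ _ _ jp Pp.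
move=> K' Q j' q jq f.
have [h hP] := KY _ _ _ _ jq (v \o f).
have [vi ys vyE] := vy; have [_ qs jqE] := jq.
have [|c cP] := factor (f := y \o h) qs.
  by move=> x /jqE[k ->] /=; rewrite hP /= (ses0 _ vy).
have [d dP] := MV _ _ _ _ jp c.
have [t tP] := Pp _ _ y d ys.
have [|g gP] := colift (f := h \- (t \o j \o q)) vi.
  by move=> x; apply/vyE; rewrite linearB /= -tP dP cP subrr.
exists g => k; apply: vi.
by rewrite gP /= hP (ses0 _ jq) !linear0 ?subr0 ?addr0.
Qed.

End Ext.

(** * Finite direct sums and add(U) *)
Section DirectSums.
Variable R : pzRingType.
Implicit Types (A B C K U V W M N P Q X Y Z : lmodType R).

Lemma dsum_ext n (M : 'I_n -> lmodType R) (x y : dsum M) : (forall i, x i = y i) -> x = y.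
Proof. exact: functional_extensionality_dep. Qed.

Definition dproj n (M : 'I_n -> lmodType R) i : {linear dsum M -> M i} :=
  lin (fun x : dsum M => x i) (fun a x y => erefl).

Definition dinj_fun n (M : 'I_n -> lmodType R) i (x : M i) : dsum M :=
  dfwith (fun j => 0 : M j) x.

Fact dinj_linear n (M : 'I_n -> lmodType R) i a (x y : M i) :
  dinj_fun (a *: x + y) = a *: dinj_fun x + dinj_fun y.
Proof.
apply: dsum_ext => j; rewrite [RHS]/(a *: dinj_fun x j + dinj_fun y j) /dinj_fun.
have [<-|ij] := eqVneq i j; first by rewrite !dfwith_in.
by rewrite !dfwith_out // scaler0; apply: esym; apply: addr0.
Qed.
Definition dinj n (M : 'I_n -> lmodType R) i : {linear M i -> dsum M} :=
  lin (@dinj_fun n M i) (@dinj_linear n M i).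

Lemma dinj_in n (M : 'I_n -> lmodType R) i (x : M i) : dinj M i x i = x.
Proof. exact: dfwith_in. Qed.
Lemma dinj_out n (M : 'I_n -> lmodType R) i j (x : M i) : i != j -> dinj M i x j = 0.
Proof. exact: dfwith_out. Qed.

Lemma dsum_sumE n (M : 'I_n -> lmodType R) (I : finType) (F : I -> dsum M) i :
  (\sum_k F k) i = \sum_k F k i.
Proof. exact: (linear_sum (dproj M i)). Qed.

Lemma dsum_decomp n (M : 'I_n -> lmodType R) (x : dsum M) :
  \sum_i dinj M i (dproj M i x) = x.
Proof.
apply: dsum_ext => j; rewrite dsum_sumE (bigD1 j) // big1 => [|i ij].
  by apply: etrans (addr0 _) _; rewrite dinj_in.
by rewrite dinj_out.
Qed.

Lemma dsum_map n (M : 'I_n -> lmodType R) V (f : forall i, {linear V -> M i}) :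
  exists g : {linear V -> dsum M}, forall x i, g x i = f i x.
Proof.
have L a x y : ((fun i => f i (a *: x + y)) : dsum M) = a *: ((fun i => f i x) : dsum M) + ((fun i => f i y) : dsum M).
  by apply: dsum_ext => i; rewrite linearP.
by exists (lin (fun x : V => (fun i => f i x) : dsum M) L).
Qed.

(** Membership in add(U) as a factorization of the identity of Y into finitely many maps through U.
    This form passes through additive functors without mention of powers or complements. *)
Definition inadd U Y : Prop :=
  exists (I : finType) (s : I -> {linear Y -> U}) (r : I -> {linear U -> Y}),
    forall y, \sum_i r i (s i y) = y.

Lemma retract_inadd U Y : retract Y U -> inadd U Y.
Proof.
by move=> [s [r rs]]; exists unit, (fun=> s), (fun=> r) => y; rewrite big_const card_unit /= addr0.
Qed.

Lemma retract_refl M : retract M M.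
Proof. by exists idfun, idfun. Qed.

Lemma inadd_refl U : inadd U U.
Proof. exact/retract_inadd/retract_refl. Qed.

Lemma inadd_trans U V W : inadd U V -> inadd V W -> inadd U W.
Proof.
move=> [I [s [r rs]]] [J [t [u ut]]].
exists (I * J)%type, (fun x => s x.1 \o t x.2), (fun x => u x.2 \o r x.1) => y.
rewrite -[RHS]ut -(pair_bigA _ (fun i j => u j (r i (s i (t j y))))) exchange_big /=.
by apply: eq_bigr => j _; rewrite -linear_sum rs.
Qed.

Lemma inadd_retract U X Y : retract X Y -> inadd U Y -> inadd U X.
Proof. by move=> XY UY; apply: (inadd_trans UY); apply: retract_inadd. Qed.

Lemma inadd_family U Y n (M : 'I_n -> lmodType R)
    (s : forall i, {linear Y -> M i}) (r : forall i, {linear M i -> Y}) :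
  (forall i, inadd U (M i)) -> (forall y, \sum_i r i (s i y) = y) -> inadd U Y.
Proof.
move=> /choice[I /(_ _)/cid IP] rs.
pose t i := sval (IP i); pose u i := sval (cid (svalP (IP i))).
have utE i y : \sum_k u i k (t i k y) = y := svalP (cid (svalP (IP i))) y.
exists {i : 'I_n & I i}, (fun x => t (tag x) (tagged x) \o s (tag x)),
  (fun x => r (tag x) \o u (tag x) (tagged x)) => y.
rewrite -[RHS]rs -(sig_big_dep (fun=> true) (fun _ _ => true) (fun i k => r i (u i k (t i k (s i y))))).
by apply: eq_bigr => i _; rewrite -linear_sum utE.
Qed.

Lemma inadd_dsum U n (M : 'I_n -> lmodType R) :
  (forall i, inadd U (M i)) -> inadd U (dsum M).
Proof. by move=> UM; apply: (inadd_family UM); apply: dsum_decomp. Qed.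

Lemma inadd_prod U M N : inadd U M -> inadd U N -> inadd U (M * N)%type.
Proof.
move=> UM UN; pose F (b : 'I_2) := if b == ord0 then M else N.
apply: (@inadd_family U (M * N)%type 2 F
  (fun b => if b == ord0 as c return {linear (M * N)%type -> (if c then M else N)} then fst else snd)
  (fun b => if b == ord0 as c return {linear (if c then M else N) -> (M * N)%type} then inL M N else inR M N)).
  by move=> b; rewrite /F; case: ifP.
by move=> [x y]; rewrite big_ord_recl big_ord1 /=; congr pair; rewrite /= ?addr0 ?add0r.
Qed.

Lemma inadd_power U n : inadd U (mod_power U n).
Proof. by apply: inadd_dsum => i; apply: inadd_refl. Qed.

Lemma inadd_power_retract U Y : inadd U Y -> exists n, retract Y (mod_power U n).
Proof.
move=> [I [s [r rs]]]; exists #|I|.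
have [f fP] := @dsum_map #|I| (fun=> U) Y (fun i => s (enum_val i)).
have L a x y : \sum_i r (enum_val i) ((a *: x + y : mod_power U #|I|) i) =
    a *: \sum_i r (enum_val i) (x i) + \sum_i r (enum_val i) (y i).
  by rewrite scaler_sumr -big_split; apply: eq_bigr => i _; exact: linearP.
exists f, (lin (fun x : mod_power U #|I| => \sum_i r (enum_val i) (x i)) L) => y.
rewrite linE -[RHS]rs [RHS](reindex (fun i => enum_val (A := I) i)); last exact: onW_bij (enum_val_bij I).
by apply: eq_bigr => i _; rewrite fP.
Qed.

Lemma mod_iso_sym M N : mod_iso M N -> mod_iso N M.
Proof.
move=> [f [g fK gK]]; have [|h [fh hf]] := bij_lin_inv (can_inj fK).
  by move=> y; exists (g y).
by exists h; exists f.
Qed.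

Lemma mod_iso_trans M N P : mod_iso M N -> mod_iso N P -> mod_iso M P.
Proof. by move=> [f fb] [g gb]; exists (g \o f); apply: bij_comp. Qed.

Lemma mod_iso_retract M N : mod_iso M N -> retract M N.
Proof.
move=> [f [g fK gK]]; have [|h [fh hf]] := bij_lin_inv (can_inj fK).
  by move=> y; exists (g y).
by exists f, h.
Qed.

Lemma retract_trans M N P : retract M N -> retract N P -> retract M P.
Proof.
by move=> [s [r rs]] [t [u ut]]; exists (t \o s), (r \o u) => x; rewrite /= ut rs.
Qed.

Lemma retract_compl M N (s : {linear M -> N}) (r : {linear N -> M}) :
  (forall x, r (s x) = x) -> exists K, mod_iso N (M * K)%type /\
    exists (t : {linear N -> K}) (j : {linear K -> N}), (forall k, r (j k) = 0) /\
      (forall k, t (j k) = k) /\ forall x, s (r x) + j (t x) = x.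
Proof.
move=> rs; have [|K [j rj]] := @ses_ker _ _ _ r; first by move=> y; exists (s y).
have [t [tj tE]] := ses_split_ret rj rs.
have L a x y : (r (a *: x + y), t (a *: x + y)) = a *: (r x, t x) + (r y, t y) :> (M * K)%type.
  by rewrite !linearP.
have ts x : t (s x) = 0.
  by have [ji _ _] := rj; apply: (inj0 ji); rewrite tE rs subrr.
exists K; split; last first.
  exists t, j; split=> [k|]; first exact: ses0 rj.
  by split=> // x; rewrite tE addrC subrK.
exists (lin (fun x => (r x, t x) : (M * K)%type) L), (fun x => s x.1 + j x.2) => [x|[x k]] /=.
  by rewrite tE addrC subrK.
by rewrite !linearD rs (ses0 _ rj) addr0 ts tj add0r.
Qed.

Lemma in_addP U Y : in_add U Y <-> inadd U Y.
Proof.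
split=> [[n [Z YZ]]|/inadd_power_retract[n [s [r rs]]]].
  apply: inadd_retract (inadd_power U n).
  exact: (retract_trans (retract_prodl Y Z) (mod_iso_retract YZ)).
have [K [iso _]] := retract_compl rs.
by exists n, K; apply: mod_iso_sym.
Qed.

Lemma proj_regular : projective (R^o : lmodType R).
Proof.
move=> X Y g f gs; have [x xP] := gs (f 1).
exists (scal_map x) => u.
by rewrite linE linearZ xP -linearZ /= /GRing.scale /= mulr1.
Qed.

Lemma proj_inadd U P : projective U -> inadd U P -> projective P.
Proof.
move=> Up [I [s [r rs]]] X Y g f gs.
have /choice[h hP] i : exists h : {linear U -> X}, forall x, f (r i x) = g (h x).
  exact: (Up X Y g (f \o r i)).
have L a x y : \sum_i h i (s i (a *: x + y)) = a *: \sum_i h i (s i x) + \sum_i h i (s i y).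
  by rewrite scaler_sumr -big_split; apply: eq_bigr => i _; rewrite !linearP.
exists (lin (fun x => \sum_i h i (s i x)) L) => x.
by rewrite linE linear_sum -{1}[x]rs linear_sum; apply: eq_bigr => i _; rewrite hP.
Qed.

Lemma zero_proj P : zero_module P -> projective P.
Proof. by move=> P0 X Y g f _; exists \0 => x; rewrite [x]P0 !linear0. Qed.

Lemma mod_power_cons U n : retract (mod_power U n.+1) (U * mod_power U n)%type.
Proof.
have [f fP] := @dsum_map n (fun=> U) (mod_power U n.+1) (fun j => @dproj _ (fun=> U) (lift ord0 j)).
have L1 a x y : ((a *: x + y : mod_power U n.+1) ord0, f (a *: x + y)) =
  a *: ((x ord0, f x) : (U * mod_power U n)%type) + (y ord0, f y) :> (U * mod_power U n)%type.
  by congr pair; rewrite ?linearP.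
pose g (x : (U * mod_power U n)%type) : mod_power U n.+1 :=
  fun i => if unlift ord0 i is Some j then x.2 j else x.1.
have L2 a x y : g (a *: x + y) = a *: g x + g y.
  apply: dsum_ext => j; rewrite /g.
  have -> : (a *: (g x : mod_power U n.+1) + g y) j = a *: g x j + g y j by [].
  by rewrite /g; case: unliftP.
exists (lin (fun x : mod_power U n.+1 => (x ord0, f x) : (U * mod_power U n)%type) L1), (lin g L2).
by move=> x; apply: dsum_ext => j; rewrite !linE /g; case: unliftP => [k ->|->] //=; rewrite fP.
Qed.

Lemma ext0_power i U V n : ext0 i U V -> ext0 i (mod_power U n) V.
Proof.
move=> UV; elim: n => [|n IH].
  by apply: ext0_proj; apply: zero_proj => x; apply: dsum_ext => -[].
exact: ext0_retract (mod_power_cons U n) (ext0_prod UV IH).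
Qed.

Lemma ext0_inadd_fst i U V Y : inadd U Y -> ext0 i U V -> ext0 i Y V.
Proof. by move=> /inadd_power_retract[n ret] UV; apply: (ext0_retract ret); apply: ext0_power. Qed.

Lemma ext0_inadd_snd i M U Y : inadd U Y -> ext0 i M U -> ext0 i M Y.
Proof.
move=> [I [s [r rs]]]; elim: i M => [|i IH] M MU K W j p jp => [f|Wp]; last first.
  by apply: IH; apply: MU jp Wp.
have /choice[h hP] i : exists h : {linear W -> U}, forall k, h (j k) = s i (f k).
  exact: (MU _ _ _ _ jp (s i \o f)).
have L a x y : \sum_i r i (h i (a *: x + y)) = a *: \sum_i r i (h i x) + \sum_i r i (h i y).
  by rewrite scaler_sumr -big_split; apply: eq_bigr => i _; rewrite !linearP.
exists (lin (fun x => \sum_i r i (h i x)) L) => k.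
by rewrite linE -[RHS]rs; apply: eq_bigr => i _; rewrite hP.
Qed.

End DirectSums.

(** * Projective resolutions *)
Section Resolutions.
Variable R : pzRingType.
Implicit Types (A B C K U V W M N P Q X Y Z : lmodType R).

Section Splice.
Variables (K W M : lmodType R) (j : {linear K -> W}) (p : {linear W -> M}).
Hypotheses (jp : ses j p) (Wp : projective W) (P : proj_resolution K).

Definition splice_mod (i : nat) : lmodType R := if i is i'.+1 then P i' else W.
Definition splice_d (i : nat) : {linear splice_mod i.+1 -> splice_mod i} :=
  match i with
  | 0 => j \o pres_aug P : {linear splice_mod 1 -> splice_mod 0}
  | i'.+1 => pres_d P i'
  end.

Fact splice_proj i : projective (splice_mod i).
Proof. by case: i => [|i] //; apply: pres_proj. Qed.
Fact splice_surj x : exists q, p q = x.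
Proof. by case: jp. Qed.
Fact splice_exact0 x : p x = 0 <-> exists q, x = splice_d 0 q.
Proof.
have [_ _ jpE] := jp; rewrite jpE; split=> [[k ->]|[q ->]]; last by exists (pres_aug P q).
by have [q <-] := pres_aug_surj P k; exists q.
Qed.
Fact splice_exactS i (x : splice_mod i.+1) :
  splice_d i x = 0 <-> exists q, x = splice_d i.+1 q.
Proof.
case: i x => [|i] x; last exact: pres_exactS.
rewrite -pres_exact0 /=; split=> [|->]; last by rewrite linear0.
by have [ji _ _] := jp; apply: inj0.
Qed.

Definition splice : proj_resolution M :=
  @ProjResolution R M splice_mod splice_d p splice_proj splice_surj splice_exact0 splice_exactS.
End Splice.

Section Shift.
Variables (M : lmodType R) (P : proj_resolution M) (K : lmodType R) (j : {linear K -> P 0%N}).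
Hypothesis jp : ses j (pres_aug P).
Variable q : {linear P 1%N -> K}.
Hypothesis jq : forall x, j (q x) = pres_d P 0 x.

Fact shift_surj x : exists y, q y = x.
Proof.
have [ji _ jpE] := jp; have [|y yP] := proj1 (@pres_exact0 _ _ P (j x)); first exact: ses0 jp.
by exists y; apply: ji; rewrite jq.
Qed.
Fact shift_exact0 x : q x = 0 <-> exists y, x = pres_d P 1 y.
Proof.
rewrite -pres_exactS -jq; split=> [->|]; first by rewrite linear0.
by have [ji _ _] := jp; apply: inj0.
Qed.
Definition shift : proj_resolution K :=
  @ProjResolution R K (fun i => P i.+1) (fun i => pres_d P i.+1) q
    (fun i => @pres_proj _ _ P i.+1) shift_surj shift_exact0
    (fun i => @pres_exactS _ _ P i.+1).
End Shift.

Lemma shift_ex M (P : proj_resolution M) : exists K (j : {linear K -> P 0%N}),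
  ses j (pres_aug P) /\ exists q : {linear P 1%N -> K}, forall x, j (q x) = pres_d P 0 x.
Proof.
have [K [j jp]] := ses_ker (@pres_aug_surj _ _ P).
exists K, j; split=> //; have [ji _ jpE] := jp.
by apply: colift => // z; apply/jpE/pres_exact0; exists z.
Qed.

Lemma ext0_Ext_pos_vanish M N : (forall i, ext0 i M N) -> Ext_pos_vanish M N.
Proof.
move=> MN P i; elim: i M MN P => [|i IH] M MN P f fd.
all: have [K [j [jp [q jq]]]] := shift_ex P.
  have [|h hP] := factor (q := q) (f := f) (shift_surj jp jq).
    by move=> x /(shift_exact0 jp jq)[y ->].
  have [g gP] := MN 0 _ _ _ _ jp h.
  by exists g => x; rewrite -jq gP hP.
have KN k : ext0 k K N by apply: (MN k.+1 _ _ _ _ jp (@pres_proj _ _ P 0)).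
have [g gP] := IH K KN (shift jp jq) f fd.
by exists g => x; apply: gP.
Qed.

Fixpoint syzygy M (i : nat) : lmodType R :=
  if i is i'.+1 then syzygy (sval (cid (proj_ses M))) i' else M.

Lemma proj_resolution_exists M : inhabited (proj_resolution M).
Proof.
pose S M := cid (proj_ses M); pose K M := sval (S M).
pose S1 M := cid (svalP (S M)); pose P M := sval (S1 M).
pose S2 M := cid (svalP (S1 M)); pose j M := sval (S2 M) : {linear K M -> P M}.
pose S3 M := cid (svalP (S2 M)); pose p M := sval (S3 M) : {linear P M -> M}.
have jp M' : ses (j M') (p M') := proj1 (svalP (S3 M')).
have Pp M' : projective (P M') := proj2 (svalP (S3 M')).
pose syz i := iter i K M.
split; apply: (@ProjResolution R M (fun i => P (syz i))
  (fun i => j (syz i) \o p (syz i.+1)) (p M)) => [i|x|x|i x]; first exact: Pp.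
- by have [_ ps _] := jp M.
- have [_ _ jpE] := jp M; rewrite jpE; split=> [[k ->]|[q ->]]; last by exists (p _ q).
  by have [_ ps _] := jp (K M); have [q <-] := ps k; exists q.
have [ji _ _] := jp (syz i); have [_ _ jpE] := jp (syz i.+1); have [_ ps _] := jp (syz i.+2).
split=> [/(inj0 ji)/jpE[k ->]|[q ->]] /=; last by rewrite (ses0 _ (jp (syz i.+1))) linear0.
by have [q <-] := ps k; exists q.
Qed.

Lemma Ext_pos_vanish_ext0 M N : Ext_pos_vanish M N -> forall i, ext0 i M N.
Proof.
move=> H i; elim: i M H => [|i IH] M H; last first.
  move=> K W j p jp Wp; apply: IH => P n f fd.
  exact: (H (splice jp Wp P) n.+1 f fd).
have [K [W [j [p [jp Wp]]]]] := proj_ses M.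
have [P] := proj_resolution_exists K.
apply: (ext0_cover0 jp Wp) => f.
have [|g gP] := H (splice jp Wp P) 0 (f \o pres_aug P : {linear P 0%N -> N}).
  move=> x /=; suff -> : pres_aug P (pres_d P 0 x) = 0 by rewrite linear0.
  by apply/pres_exact0; exists x.
exists g => k; have [x <-] := pres_aug_surj P k.
by have /= <- := gP x.
Qed.

(** By the shift in [ext0] this is projective dimension at most n; for n = 0 it says Ext^1(M, -) =
    0. *)
Definition pd_le n M := forall V, ext0 n M V.

Lemma pd_le0 M : pd_le 0 M <-> projective M.
Proof.
split=> [M0|Mp V]; last exact: ext0_proj.
have [K [P [j [p [jp Pp]]]]] := proj_ses M.
have [g gP] := M0 K _ _ _ _ jp idfun.
have [ji ps jpE] := jp.
have [|s sP] := factor (f := idfun \- (j \o g)) ps.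
  by move=> x /jpE[k ->] /=; rewrite gP subrr.
apply: proj_retract Pp; exists s, p => x; have [y <-] := ps x.
by rewrite sP /= linearB (ses0 _ jp) subr0.
Qed.

Lemma pd_leS n M : pd_le n M -> pd_le n.+1 M.
Proof.
elim: n M => [|n IH] M MV V K W j p jp Wp.
  apply: (@ext0_proj R 0 K V); apply: proj_retract Wp; exact: ses_split_retract jp (proj1 (pd_le0 M) MV).
by apply: IH => V'; apply: MV jp Wp.
Qed.

Lemma pd_le_leq n m M : (n <= m)%N -> pd_le n M -> pd_le m M.
Proof.
move=> /subnK <-; elim: (m - n)%N => [|k IH] //.
by rewrite addSn => /IH; apply: pd_leS.
Qed.

Lemma finite_pdimP M : finite_pdim M <-> exists n, pd_le n M.
Proof.
split=> [[n [P P0]]|[n]].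
  exists n; elim: n M P P0 => [|n IH] M P P0.
    have [|s sP] := factor (q := pres_aug P) (f := idfun) (@pres_aug_surj _ _ P).
      by move=> x /pres_exact0[y ->]; rewrite (P0 1%N _ y) // linear0.
    apply/pd_le0; apply: proj_retract (@pres_proj _ _ P 0).
    by exists s, (pres_aug P) => x; have [y <-] := pres_aug_surj P x; rewrite sP.
  have [K [j [jp [q jq]]]] := shift_ex P.
  move=> V; apply: (ext0_cover jp (@pres_proj _ _ P 0)).
  by apply: (IH K (shift jp jq)) => i ni; apply: P0.
(* The zero module; its trivial resolution prolongs a finite one. *)
pose Z : lmodType R := dsum (fun _ : 'I_0 => R^o : lmodType R).
elim: n M => [|n IH] M Mn.
  have Z0 : zero_module Z by move=> x; apply: dsum_ext => -[].
  have [P PZ] : exists P : proj_resolution Z, forall i, zero_module (P i).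
    have zP (x : Z) : x = 0 <-> exists q : Z, x = (\0 : {linear Z -> Z}) q.
      by rewrite [x]Z0; split=> // _; exists 0.
    have sP (x : Z) : exists q : Z, (\0 : {linear Z -> Z}) q = x by exists 0; rewrite [x]Z0.
    exists (@ProjResolution R Z (fun=> Z) (fun=> \0) \0 (fun=> zero_proj Z0) sP
      (fun x => conj (fun _ => proj1 (zP x) (Z0 x)) (fun _ => erefl))
      (fun _ x => conj (fun _ => proj1 (zP x) (Z0 x)) (fun _ => erefl))) => //.
  have jp : ses (\0 : {linear Z -> M}) (idfun : {linear M -> M}).
    split=> [x y _|y|x]; [by rewrite [x]Z0 [y]Z0|by exists y|].
    by split=> [/= ->|[k ->]] //; exists 0.
  by exists 0%N, (splice jp (proj1 (pd_le0 M) Mn) P) => -[|i _] //; apply: PZ.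
have [K [W [j [p [jp Wp]]]]] := proj_ses M.
have [|m [P P0]] := IH K; first by move=> V; apply: (Mn V _ _ _ _ jp Wp).
by exists m.+1, (splice jp Wp P) => -[|i] // /P0.
Qed.

End Resolutions.

(** * Finitely generated modules, coresolutions, finitistic dimension *)
Section FiniteType.
Variable R : pzRingType.
Implicit Types (A B C F K U V W M N P Q X Y Z T : lmodType R).

Definition fpd M := exists n, pd_le n M.

Lemma pd_le_mid n A B C (u : {linear A -> B}) (p : {linear B -> C}) : ses u p ->
  pd_le n A -> pd_le n C -> pd_le n B.
Proof. by move=> up An Cn V; apply: ext0_mid up (An V) (Cn V). Qed.

Lemma pd_le_left n A B C (u : {linear A -> B}) (p : {linear B -> C}) : ses u p ->
  pd_le n B -> pd_le n.+1 C -> pd_le n A.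
Proof. by move=> up Bn Cn V; apply: ext0_left up (Bn V) (Cn V). Qed.

Lemma pd_le_right n A B C (u : {linear A -> B}) (p : {linear B -> C}) : ses u p ->
  pd_le n A -> pd_le n.+1 B -> pd_le n.+1 C.
Proof. by move=> up An Bn V; apply: ext0_right up (An V) (Bn V). Qed.

Lemma pd_le_inadd n U Y : inadd U Y -> pd_le n U -> pd_le n Y.
Proof. by move=> UY Un V; apply: ext0_inadd_fst UY (Un V). Qed.

Lemma fpd_mid A B C (u : {linear A -> B}) (p : {linear B -> C}) : ses u p ->
  fpd A -> fpd C -> fpd B.
Proof.
move=> up [n An] [m Cm]; exists (maxn n m).
exact: pd_le_mid up (pd_le_leq (leq_maxl n m) An) (pd_le_leq (leq_maxr n m) Cm).
Qed.

Lemma fpd_left A B C (u : {linear A -> B}) (p : {linear B -> C}) : ses u p ->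
  fpd B -> fpd C -> fpd A.
Proof.
move=> up [n Bn] [m Cm]; exists (maxn n m).
exact: pd_le_left up (pd_le_leq (leq_maxl n m) Bn) (pd_leS (pd_le_leq (leq_maxr n m) Cm)).
Qed.

Lemma fpd_right A B C (u : {linear A -> B}) (p : {linear B -> C}) : ses u p ->
  fpd A -> fpd B -> fpd C.
Proof.
move=> up [n An] [m Bm]; exists (maxn n m).+1.
exact: pd_le_right up (pd_le_leq (leq_maxl n m) An) (pd_leS (pd_le_leq (leq_maxr n m) Bm)).
Qed.

Lemma fpd_inadd U Y : inadd U Y -> fpd U -> fpd Y.
Proof. by move=> UY [n Un]; exists n; apply: pd_le_inadd UY Un. Qed.

Lemma fpd_retract X Y : retract X Y -> fpd Y -> fpd X.
Proof. by move=> XY; apply/fpd_inadd/retract_inadd. Qed.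

Lemma fpd_proj P : projective P -> fpd P.
Proof. by move=> /pd_le0; exists 0%N. Qed.

Definition fgen M := exists (I : finType) (g : I -> M), forall x, exists a : I -> R,
  x = \sum_i a i *: g i.

Lemma fin_genP M : fin_gen M <-> fgen M.
Proof.
split=> [[n [g gP]]|[I [g gP]]]; first by exists 'I_n, g.
exists #|I|, (fun i => g (enum_val i)) => x; have [a ->] := gP x.
exists (fun i => a (enum_val i)).
by rewrite (reindex (fun i => enum_val (A := I) i)) //; apply: onW_bij (enum_val_bij I).
Qed.

Lemma fgen_surj M N (f : {linear M -> N}) : (forall y, exists x, f x = y) -> fgen M -> fgen N.
Proof.
move=> fs [I [g gP]]; exists I, (f \o g) => y; have [x <-] := fs y.
by have [a ->] := gP x; exists a; rewrite linear_sum; apply: eq_bigr => i _; rewrite linearZ.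
Qed.

Lemma fgen_mid A B C (u : {linear A -> B}) (p : {linear B -> C}) : ses u p ->
  fgen A -> fgen C -> fgen B.
Proof.
move=> [ui ps upE] [I [g gP]] [J [h hP]].
have /choice[k kP] i : exists x, p x = h i by apply: ps.
exists (I + J)%type, (fun x => match x with inl i => u (g i) | inr j => k j end) => x.
have [a aP] := hP (p x).
have [|y yP] := proj1 (upE (x - \sum_i a i *: k i)).
  rewrite linearB aP linear_sum; apply/eqP; rewrite subr_eq0; apply/eqP.
  by apply: eq_bigr => i _; rewrite linearZ /= kP.
have [b bP] := gP y.
exists (fun z => match z with inl i => b i | inr j => a j end).
rewrite big_sumType /= -[LHS](subrK (\sum_i a i *: k i)) yP {1}bP linear_sum.
by congr (_ + _); apply: eq_bigr => i _; rewrite linearZ.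
Qed.

Lemma fgen_retract X Y : retract X Y -> fgen Y -> fgen X.
Proof. by move=> [s [r rs]]; apply: (fgen_surj (f := r)) => x; exists (s x). Qed.

Lemma fgen_zero M : zero_module M -> fgen M.
Proof.
by move=> M0; exists void, (of_void _) => x; exists (of_void _); rewrite [LHS]M0 [RHS]M0.
Qed.

Lemma fgen_prod A B : fgen A -> fgen B -> fgen (A * B)%type.
Proof. by have [j [p jp]] := ses_prod A B; apply: fgen_mid jp. Qed.

Lemma fgen_inadd U Y : inadd U Y -> fgen U -> fgen Y.
Proof.
move=> /inadd_power_retract[n YU] fU; apply: (fgen_retract YU).
elim: n {YU} => [|n IH]; first by apply: fgen_zero => x; apply: dsum_ext => -[].
exact: fgen_retract (mod_power_cons U n) (fgen_prod fU IH).
Qed.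

Lemma fgen_regular : fgen (R^o : lmodType R).
Proof. by exists unit, (fun=> 1) => x; exists (fun=> x); rewrite big_const card_unit /= addr0 [RHS]mulr1. Qed.

Lemma fgen_cover M : fgen M ->
  exists F (p : {linear F -> M}), inadd (R^o : lmodType R) F /\ forall y, exists x, p x = y.
Proof.
move=> /fin_genP[n [g gP]].
have L a (x y : mod_power (R^o : lmodType R) n) :
    \sum_i ((a *: x + y : mod_power (R^o : lmodType R) n) i : R) *: g i =
    a *: (\sum_i (x i : R) *: g i) + \sum_i (y i : R) *: g i.
  rewrite scaler_sumr -big_split; apply: eq_bigr => i _.
  by rewrite /= scalerA -scalerDl.
exists (mod_power (R^o : lmodType R) n), (lin (fun x : mod_power (R^o : lmodType R) n => \sum_i (x i : R) *: g i) L).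
split=> [|y]; first exact: inadd_power.
by have [a ->] := gP y; exists a.
Qed.

Lemma cyclic_sub M (x : M) : exists K (j : {linear K -> M}) (k : K),
  [/\ injective j, j k = x, forall y, exists r, y = r *: k & fgen K].
Proof.
have [K [j [ji jE]]] := sub_ex (psub_im (scal_map x)).
have [k kE] : exists k, x = j k by apply/jE; exists 1; rewrite /= scale1r.
have kP y : exists r, y = r *: k.
  have [r rE] : exists r, j y = r *: x by apply/jE; exists y.
  by exists r; apply: ji; rewrite rE kE linearZ_LR.
exists K, j, k; split=> //; exists unit, (fun=> k) => y; have [r ->] := kP y.
by exists (fun=> r); rewrite big_const card_unit /= addr0.
Qed.

Definition noetherian := forall K M (j : {linear K -> M}), injective j -> fgen M -> fgen K.

Definition pfin M := fgen M /\ fpd M.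

Lemma PfinP M : Pfin M <-> pfin M.
Proof. by rewrite /Pfin fin_genP finite_pdimP. Qed.

Lemma pfin_inadd U Y : inadd U Y -> pfin U -> pfin Y.
Proof. by move=> UY [? ?]; split; [apply: fgen_inadd UY _|apply: fpd_inadd UY _]. Qed.

Lemma pfin_retract X Y : retract X Y -> pfin Y -> pfin X.
Proof. by move=> XY; apply/pfin_inadd/retract_inadd. Qed.

Lemma pfin_regular : pfin (R^o : lmodType R).
Proof. by split; [apply: fgen_regular|apply/fpd_proj/proj_regular]. Qed.

Lemma pfin_right A B C (u : {linear A -> B}) (p : {linear B -> C}) : ses u p ->
  pfin A -> pfin B -> pfin C.
Proof.
move=> up [_ Af] [Bg Bf]; split; last exact: fpd_right up Af Bf.
by have [_ ps _] := up; apply: fgen_surj ps Bg.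
Qed.

(* Coresolutions of length n by add(U) that stay exact under Hom(-, U). *)
Fixpoint cores U n N : Prop :=
  match n with
  | 0 => inadd U N
  | n'.+1 => exists Y N' (j : {linear N -> Y}) (p : {linear Y -> N'}),
      [/\ ses j p, inadd U Y, ext0 0 N' U & cores U n' N']
  end.

(** Each step passes to a cokernel N' and lowers by one the degree in which Ext(S, N) is known to
    vanish. After d steps Ext^1(N', N) = 0, so the last embedding splits and N lies in add(U). *)
Lemma cores_exist U (S : lmodType R -> Prop) d :
  (forall N, S N -> forall i, ext0 i N U) -> (forall N, S N -> pd_le d N) ->
  (forall N, S N -> exists Y N' (j : {linear N -> Y}) (p : {linear Y -> N'}),
     [/\ ses j p, inadd U Y & S N']) ->
  forall N, S N -> cores U d N.
Proof.
move=> SU Sd Sstep N SN.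
have H : forall Z, S Z -> ext0 d Z N by move=> Z SZ; apply: Sd.
elim: d N SN {Sd} H => [|d IH] N SN H; have [Y [N' [j [p [jp UY SN']]]]] := Sstep N SN.
  have [t tP] := H _ SN' _ _ _ _ jp idfun.
  by apply: inadd_retract UY; exists j, t.
exists Y, N', j, p; split=> //; first exact: SU.
apply: IH => // Z SZ; apply: (ext0_snd jp); last exact: H.
by apply: ext0_inadd_snd UY _; apply: SU.
Qed.

Lemma cores_coresolution U n N : cores U n N ->
  exists (s : nat) (C : nat -> lmodType R) (iota : {linear N -> C 0%N})
         (d : forall j, {linear C j -> C j.+1}),
    [/\ forall j, in_add U (C j),
        forall j, (s < j)%N -> zero_module (C j),
        injective iota,
        forall x, d 0%N x = 0 <-> exists r, x = iota r &
        forall j x, d j.+1 x = 0 <-> exists y, x = d j y].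
Proof.
elim: n N => [|n IH] N /=.
  pose Z : lmodType R := dsum (fun _ : 'I_0 => R^o : lmodType R).
  have Z0 : zero_module Z by move=> x; apply: dsum_ext => -[].
  move=> UN; exists 0%N, (fun i => if i is 0 then N else Z), idfun, (fun i => \0).
  split=> [[|j]|[|j] _||x|j x] //; first exact/in_addP.
  - apply/in_addP; exists void, (fun=> \0), (fun=> \0) => y.
    by rewrite [LHS]Z0 [RHS]Z0.
  - by split=> // _; exists x.
  by split=> // _; exists 0; rewrite [x]Z0 [RHS]Z0.
move=> [Y [N' [j [p [[ji ps jpE] UY _ /IH[s [C [i [d [CU Cz ii C0 CS]]]]]]]]]].
pose C' k : lmodType R := if k is k'.+1 then C k' else Y.
pose d' k : {linear C' k -> C' k.+1} :=
  match k return {linear C' k -> C' k.+1} with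
  | 0 => i \o p : {linear C' 0%N -> C' 1%N}
  | k'.+1 => d k'
  end.
exists s.+1, C', j, d'.
split=> [[|k]|[|k] // /Cz||x|[|k] x] //; first exact/in_addP.
- exact: CU.
- by rewrite -jpE; split=> /= [/(inj0 ii)|->] //; rewrite linear0.
- by rewrite C0; split=> -[y ->]; [have [z <-] := ps y; exists z|exists (p y)].
exact: CS.
Qed.

(** Dimension shifting in the second variable: against M, the modules C j behave like injectives. *)
Lemma coresolution_ext0 T (s : nat) (C : nat -> lmodType R) N (iota : {linear N -> C 0%N})
    (d : forall j, {linear C j -> C j.+1}) M :
  (forall j, in_add T (C j)) -> (forall j, (s < j)%N -> zero_module (C j)) ->
  injective iota -> (forall x, d 0%N x = 0 <-> exists r, x = iota r) ->
  (forall j x, d j.+1 x = 0 <-> exists y, x = d j y) ->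
  (forall i, ext0 i M T) -> ext0 s M N.
Proof.
move=> CT Cz ii d0 dS MT.
elim: s C N iota d CT Cz ii d0 dS => [|s IH] C N iota d CT Cz ii d0 dS.
  have is_ x : exists y, iota y = x.
    by have [|y ->] := proj1 (d0 x); [exact: Cz|exists y].
  have [g [ig gi]] := bij_lin_inv ii is_.
  apply: (ext0_inadd_snd (U := T)) => //.
  by apply: (inadd_retract (Y := C 0%N)); [exists iota, g|apply/in_addP].
have [N' [q [j [qs ji jE]]]] := image_ex (d 0%N).
apply: (@ext0_fst _ s _ _ (C 0%N) N' iota q); last first.
- by apply: ext0_inadd_snd (MT _); apply/in_addP.
- apply: (IH (fun i => C i.+1) N' j (fun i => d i.+1)) => //.
    by move=> i si; apply: Cz.
  by move=> x; rewrite dS; split=> -[y ->]; [exists (q y)|have [z <-] := qs y; exists z]; rewrite jE.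
split=> // x; rewrite -d0 jE; split=> [->|]; first by rewrite linear0.
exact: inj0.
Qed.

Lemma findim_bound T : noetherian -> has_add_coresolution T ->
  (forall M, pfin M -> forall i, ext0 i M T) ->
  exists s, forall M, pfin M -> pd_le s M.
Proof.
move=> noeth [s [C [iota [d [CT Cz ii d0 dS]]]]] H; exists s => M Mp.
have MR : ext0 s M (R^o : lmodType R).
  by apply: (coresolution_ext0 CT Cz ii d0 dS); apply: H.
(* After passing to syzygies, the kernel K of a cover is finitely generated projective, hence in
   add(R); so Ext^1(N, K) = 0, the cover splits and N is projective. *)
have step n N : fgen N -> ext0 n N (R^o : lmodType R) -> pd_le n.+1 N -> pd_le n N.
  elim: n N => [|n IH] N Ng NR Nn.
  1,2: have [F [p [RF ps]]] := fgen_cover Ng.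
  1,2: have Fp : projective F by apply: proj_inadd RF; apply: proj_regular.
  1,2: have [K [j jp]] := ses_ker ps; have [ji _ jpE] := jp.
  1,2: have Kg : fgen K by apply: (noeth _ _ j) => //; apply: fgen_inadd RF fgen_regular.
    have Kp : projective K by apply/pd_le0 => V; apply: (Nn V _ _ _ _ jp Fp).
    have RK : inadd (R^o : lmodType R) K.
      have [G [q [RG qs]]] := fgen_cover Kg.
      have [t tP] := proj_split Kp qs.
      by apply: inadd_retract RG; exists t, q.
    have [g gP] := ext0_extend jp (@ext0_inadd_snd R 0 N _ _ RK NR) idfun.
    have [|t tP] := factor (f := idfun \- (j \o g)) ps.
      by move=> x /jpE[k ->] /=; rewrite gP subrr.
    apply/pd_le0; apply: proj_retract Fp; exists t, p => x; have [y <-] := ps x.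
    by rewrite tP /= linearB (ses0 _ jp) subr0.
  have Kn : pd_le n K.
    by apply: IH => //; [apply: NR jp Fp|move=> V; apply: (Nn V _ _ _ _ jp Fp)].
  by move=> V; apply: ext0_cover jp Fp (Kn V).
(* Continued by zeros, the coresolution also has every length i >= s, which gives the vanishing in
   all higher degrees. *)
have MRt k : ext0 (s + k) M (R^o : lmodType R).
  have E i : (s <= i)%N -> ext0 i M (R^o : lmodType R).
    move=> si; apply: (coresolution_ext0 CT _ ii d0 dS); last by apply: H.
    by move=> j ij; apply: Cz; apply: leq_ltn_trans ij.
  by apply: E; apply: leq_addr.
have [Mg [n Mn]] := Mp.
have : pd_le (s + n) M by apply: pd_le_leq Mn; apply: leq_addl.
elim: n {Mn} => [|n IH]; first by rewrite addn0.
by rewrite addnS => Mn; apply: IH; apply: step.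
Qed.

End FiniteType.

(** * The contravariant functor Hom(-, U) *)
Section Hom.
Variables (R S : pzRingType) (U : lmodType R) (sigma : {rmorphism S -> endo U}).
Implicit Types (M N P Q X Y Z : lmodType R).

(* S acts on Hom(N, U) through sigma : S -> End(U). *)
Record hommod (sg : S -> endo U) N := HomMod { hom_fun :> {linear N -> U} }.

Section Structure.
Variable N : lmodType R.
Local Notation H := (hommod sigma N).

HB.instance Definition _ := gen_eqMixin H.
HB.instance Definition _ := gen_choiceMixin H.

Lemma hommodP (f g : H) : f =1 g -> f = g.
Proof.
case: f g => [[f cf]] [[g cg]] /= fg.
have E : f = g by apply: functional_extensionality_dep.
case: _ / E cg {fg} => cg.
case: cf cg => [[fa] [fs]] [[ga] [gs]].
by rewrite (Prop_irrelevance fa ga) (Prop_irrelevance fs gs).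
Qed.

Definition hom_zero : H := HomMod _ (\0 : {linear N -> U}).
Definition hom_opp (f : H) : H := HomMod _ (\- f : {linear N -> U}).
Definition hom_add (f g : H) : H := HomMod _ (f \+ g : {linear N -> U}).
Definition hom_scale (a : S) (f : H) : H := HomMod _ (sigma a \o f : {linear N -> U}).

Fact hom_addA : associative hom_add.
Proof. by move=> f g h; apply: hommodP => x; apply: addrA. Qed.
Fact hom_addC : commutative hom_add.
Proof. by move=> f g; apply: hommodP => x; apply: addrC. Qed.
Fact hom_add0 : left_id hom_zero hom_add.
Proof. by move=> f; apply: hommodP => x; apply: add0r. Qed.
Fact hom_addN : left_inverse hom_zero hom_opp hom_add.
Proof. by move=> f; apply: hommodP => x; apply: addNr. Qed.

HB.instance Definition _ := GRing.isZmodule.Build H hom_addA hom_addC hom_add0 hom_addN.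

Fact hom_scaleA a b f : hom_scale a (hom_scale b f) = hom_scale (a * b) f.
Proof. by apply: hommodP => x /=; rewrite rmorphM. Qed.
Fact hom_scale1 : left_id 1 hom_scale.
Proof. by move=> f; apply: hommodP => x /=; rewrite rmorph1. Qed.
Fact hom_scaleDr : right_distributive hom_scale +%R.
Proof. by move=> a f g; apply: hommodP => x /=; rewrite linearD. Qed.
Fact hom_scaleDl f : {morph hom_scale^~ f : a b / a + b}.
Proof. by move=> a b; apply: hommodP => x /=; rewrite rmorphD. Qed.

HB.instance Definition _ := GRing.Zmodule_isLmodule.Build S H
  hom_scaleA hom_scale1 hom_scaleDr hom_scaleDl.
End Structure.

Local Notation H N := (hommod sigma N : lmodType S).

Fact hom_map_linear N N' (f : {linear N -> N'}) a (g h : hommod sigma N') :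
  HomMod sigma ((a *: g + h) \o f) = a *: (HomMod sigma (g \o f) : H N) + HomMod sigma (h \o f).
Proof. exact: hommodP. Qed.
Definition hom_map N N' (f : {linear N -> N'}) : {linear H N' -> H N} :=
  lin (fun g : H N' => HomMod sigma (g \o f) : H N) (hom_map_linear f).

Lemma hom_sumE N (I : finType) (F : I -> H N) x : (\sum_i F i : hommod sigma N) x = \sum_i F i x.
Proof.
by apply: (big_morph (fun f : hommod sigma N => f x) (id1 := 0) (op1 := +%R)).
Qed.

Lemma hom_inadd M N : inadd M N -> inadd (H M) (H N).
Proof.
move=> [I [s [r rs]]]; exists I, (fun i => hom_map (r i)), (fun i => hom_map (s i)) => y.
apply: hommodP => x; rewrite hom_sumE -[in RHS](rs x) linear_sum.
by apply: eq_bigr.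
Qed.

Lemma hom_proj : bijective sigma -> projective (H U).
Proof.
move=> [tau sK tK]; apply: proj_retract (@proj_regular S).
have L1 a (f g : H U) : tau (Endo (a *: f + g)) = a *: (tau (Endo f) : S^o) + tau (Endo g).
  apply: (can_inj sK); rewrite [RHS]rmorphD [X in _ = X + _]rmorphM !tK.
  exact: endoP.
have L2 a (x y : S^o) : HomMod sigma (sigma (a *: x + y)) =
    a *: (HomMod sigma (sigma x) : H U) + HomMod sigma (sigma y).
  by apply: hommodP => u /=; rewrite rmorphD rmorphM.
exists (lin (fun f : H U => tau (Endo f) : S^o) L1),
  (lin (fun x : S^o => HomMod sigma (sigma x) : H U) L2) => f.
by apply: hommodP => u; rewrite !linE /= tK.
Qed.

Lemma hom_cores_pd n N : bijective sigma -> cores U n N -> pd_le n (H N).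
Proof.
move=> /hom_proj Up; elim: n N => [|n IH] N /=.
  by move=> UN; apply/pd_le0; apply: (proj_inadd Up); apply: hom_inadd.
move=> [Y [N' [j [p [jp UY N'U CN']]]]] V.
apply: (@ext0_cover _ n (H N') (H Y) (H N) V (hom_map p) (hom_map j)); last exact: IH.
  have [ji ps jpE] := jp; split=> [f g E|f|f].
  - apply: hommodP => x; have [y <-] := ps x.
    exact: (congr1 (fun h : H Y => h y) E).
  - have [g gP] := N'U _ _ _ _ jp f.
    by exists (HomMod _ g); apply: hommodP => x; apply: gP.
  split=> [E|[g ->]]; last by apply: hommodP => x /=; rewrite (ses0 _ jp) linear0.
  have [|g gP] := factor (f := f) ps.
    by move=> x /jpE[k ->]; apply: (congr1 (fun h : H N => h k) E).
  by exists (HomMod _ g); apply: hommodP => x; have /= := gP x.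
by apply: (proj_inadd Up); apply: hom_inadd.
Qed.

End Hom.

(** * Artinian modules and the Jacobson radical *)
Section Artinian.
Variable R : pzRingType.
Implicit Types (A B C F K U V W M Q X Y Z : lmodType R).

(** The minimum condition for arbitrary families of submodules, so that each application can choose
    its own family. *)
Definition artinian M := forall F : (M -> Prop) -> Prop, (exists N, psub N /\ F N) ->
  exists N, [/\ psub N, F N & forall N', psub N' -> F N' ->
    (forall x, N' x -> N x) -> forall x, N x -> N' x].

Lemma artinian_chain M :
  (forall I : nat -> submodule M, (forall n, {subset I n.+1 <= I n}) ->
     exists n, forall m, (n <= m)%N -> I m =i I n) -> artinian M.
Proof.
move=> chain F [N0 [sN0 FN0]]; apply: contrapT => H.
pose T := {N : M -> Prop | psub N /\ F N}.
have step (t : T) : exists t' : T, (forall x, sval t' x -> sval t x) /\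
    exists x, sval t x /\ ~ sval t' x.
  case: t => N [sN FN] /=; apply: contrapT => H'; apply: H; exists N; split=> // N' sN' FN' N'N x Nx.
  apply: contrapT => N'x; apply: H'.
  by exists (exist _ N' (conj sN' FN')); split=> //; exists x.
have [g gP] := choice step.
pose t n := iter n g (exist _ N0 (conj sN0 FN0) : T).
have [n /(_ n.+1 (leqnSn n)) E] := chain (fun n => mksub (proj1 (svalP (t n))))
  (fun n x => fun H => introT (mksubP _ _) (proj1 (gP (t n)) x (elimT (mksubP _ _) H))).
have [x [xt xg]] := proj2 (gP (t n)).
apply: xg; apply: (elimT (mksubP (proj1 (svalP (t n.+1))) x)).
by rewrite E; apply/mksubP.
Qed.

Lemma artinian_sub K M (j : {linear K -> M}) : injective j -> artinian M -> artinian K.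
Proof.
move=> ji MA F [N [sN FN]].
pose im (L : K -> Prop) y := exists x, L x /\ y = j x.
have sim L : psub L -> psub (im L).
  move=> sL; split=> [|a _ _ [x [Lx ->]] [y [Ly ->]]].
    by exists 0; rewrite linear0; split=> //; apply: psub0.
  by exists (a *: x + y); rewrite linearP; split=> //; apply: (proj2 sL).
have imP L x : im L (j x) -> L x by move=> [y [Ly /ji ->]].
have [|P [sP [L [sL FL PE]] Pm]] := MA (fun P => exists L, [/\ psub L, F L & P = im L]).
  by exists (im N); split; [apply: sim|exists N].
exists L; split=> // N' sN' FN' N'L x Lx.
apply: imP; apply: (Pm (im N')); [exact: sim|by exists N'| |by rewrite PE; exists x].
by move=> _ [y [N'y ->]]; rewrite PE; exists y; split=> //; apply: N'L.
Qed.

Lemma artinian_quot M Q (q : {linear M -> Q}) : (forall y, exists x, q x = y) ->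
  artinian M -> artinian Q.
Proof.
move=> qs MA F [N [sN FN]].
have [|P [sP [L [sL FL PE]] Pm]] := MA (fun P => exists L, [/\ psub L, F L & P = (fun x => L (q x))]).
  by exists (fun x => N (q x)); split; [exact: (psub_preim q sN)|exists N].
exists L; split=> // N' sN' FN' N'L y; have [x <-] := qs y => Lx.
apply: (Pm (fun x => N' (q x))); [exact: psub_preim|by exists N'| |by rewrite PE].
by move=> z N'z; rewrite PE; apply: N'L.
Qed.

(** First the trace on A is minimised, then the image in C among the members whose trace is that
    small. A member contained in the result has the same trace and the same image, hence equals
    it. *)
Lemma artinian_mid A B C (u : {linear A -> B}) (p : {linear B -> C}) : ses u p ->
  artinian A -> artinian C -> artinian B.
Proof.
move=> [ui ps upE] AA CA F [N [sN FN]].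
have sim L : psub L -> psub (fun c => exists2 b, L b & c = p b).
  move=> [L0 LL]; split=> [|a _ _ [x Lx ->] [y Ly ->]]; first by exists 0; rewrite ?linear0.
  by exists (a *: x + y); rewrite ?linearP //; apply: LL.
have [|P1 [sP1 [L1 [sL1 FL1 P1E]] P1m]] :=
    AA (fun P => exists L, [/\ psub L, F L & P = (fun x => L (u x))]).
  by exists (fun x => N (u x)); split; [exact: (psub_preim u sN)|exists N].
have [|P2 [sP2 [L2 [sL2 FL2 L2P1 P2E]] P2m]] := CA (fun P => exists L,
    [/\ psub L, F L, forall a, L (u a) -> P1 a & P = (fun c => exists2 b, L b & c = p b)]).
  exists (fun c => exists2 b, L1 b & c = p b); split; first exact: sim.
  by exists L1; split=> // a; rewrite P1E.
exists L2; split=> // N' sN' FN' N'L2 x L2x.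
have P1N' a : P1 a -> N' (u a).
  apply: (P1m (fun x => N' (u x))); [exact: psub_preim|by exists N'|].
  by move=> y N'y; apply/L2P1/N'L2.
have [y N'y xy] : exists2 y, N' y & p x = p y.
  apply: (P2m (fun c => exists2 b, N' b & c = p b)); first exact: sim.
  - by exists N'; split=> // a N'a; apply/L2P1/N'L2.
  - by move=> _ [b N'b ->]; rewrite P2E; exists b => //; apply: N'L2.
  by rewrite P2E; exists x.
have [|a aE] := proj1 (upE (x - y)); first by rewrite linearB xy subrr.
rewrite -(subrK y x); apply: psubD => //; rewrite aE; apply/P1N'/L2P1.
by rewrite -aE; apply: psubB => //; apply: N'L2.
Qed.

Lemma artinian_fgen M : artinian (R^o : lmodType R) -> fgen M -> artinian M.
Proof.
move=> RA /fgen_cover[F [p [/inadd_power_retract[n [s [r rs]]] ps]]].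
apply: (artinian_quot ps); apply: (artinian_sub (j := s) (can_inj rs)).
elim: n {s r rs} => [|n IH].
  move=> G [N [sN GN]]; exists N; split=> // N' [N'0 _] _ _ x _.
  by rewrite (_ : x = 0) //; apply: dsum_ext => -[].
have [t [v tv]] := mod_power_cons (R^o : lmodType R) n.
apply: (artinian_sub (j := t) (can_inj tv)).
have [j [q jq]] := ses_prod (R^o : lmodType R) (mod_power (R^o : lmodType R) n).
exact: artinian_mid jq RA IH.
Qed.

Lemma zorn_sub M (N : M -> Prop) y : psub N -> ~ N y ->
  exists L, [/\ psub L, forall x, N x -> L x, ~ L y &
    forall L', psub L' -> (forall x, L x -> L' x) -> ~ L' y -> forall x, L' x -> L x].
Proof.
move=> sN Ny; pose P L := [/\ psub L, forall x, N x -> L x & ~ L y].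
pose T := {L : M -> Prop | P L}.
have [||||[L [sL NL Ly]] Lm] := @classical_sets.Zorn T (fun s t => `[< forall x, sval s x -> sval t x >]).
- by move=> t; apply/asboolP.
- by move=> r s t /asboolP rs /asboolP st; apply/asboolP => x /rs/st.
- move=> [s sP] [t tP] /asboolP /= st /asboolP /= ts; have E : s = t.
    by apply/funext => x; apply/propext; split; [apply: st|apply: ts].
  by case: _ / E tP {st ts} => tP; congr exist; apply: Prop_irrelevance.
- move=> S Stot; have [[s0 Ss0]|S0] := pselect (exists s, S s); last first.
    have PN : P N by [].
    by exists (exist _ N PN) => s Ss; case: S0; exists s.
  have PU : P (fun x => exists2 s, S s & sval s x).
    split=> [|x Nx|[s Ss]]; last by case: s Ss => s [].
      split=> [|a x z [s Ss sx] [t St tz]].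
        by exists s0 => //; case: s0 {Ss0} => s [[]].
      have [/asboolP st|/asboolP ts] := Stot s t Ss St.
        by exists t => //; have [[_ tL] _ _] := svalP t; apply: tL => //; apply: st.
      by exists s => //; have [[_ tL] _ _] := svalP s; apply: tL => //; apply: ts.
    by exists s0 => //; have [_ H _] := svalP s0; apply: H.
  by exists (exist _ _ PU) => s Ss; apply/asboolP => x /= sx; exists s.
exists L; split=> // L' sL' LL' L'y x L'x.
have PL' : P L' by split=> // z /NL/LL'.
by have /(congr1 sval) /= <- := Lm (exist _ L' PL') (introT (asboolP _) LL').
Qed.

End Artinian.

Section JacobsonRadical.
Variable R : pzRingType.

Lemma psub_jrad : psub (fun x : R^o => x \in jrad_pred (R := R)).
Proof. exact: jrad_submod_closed. Qed.

Lemma jrad_mull (a x : R) : x \in jrad_pred (R := R) -> a * x \in jrad_pred (R := R).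
Proof. exact: (psubZ psub_jrad). Qed.

Lemma jrad_left_inv (a : R) : a \in jrad_pred (R := R) -> exists u, u * (1 - a) = 1.
Proof.
move=> aJ; apply: contrapT => H.
have sN : psub (fun x : R^o => exists r : R, x = r * (1 - a) :> R).
  split=> [|b _ _ [r ->] [s ->]]; first by exists 0; rewrite mul0r.
  by exists (b * r + s); rewrite mulrDl -mulrA.
have [|L [sL NL L1 Lm]] := @zorn_sub R (R^o : lmodType R) _ (1 : R^o) sN.
  by move=> [u uP]; apply: H; exists u.
have mP : max_left_ideal ((fun x => `[< L x >]) : {pred R^o}).
  split; [exact: psub_submod|exact/asboolP|].
  move=> m' [m0 mL] m1 sub x xm; apply/asboolP.
  have Lm' y : L y -> y \in m' by move=> Ly; apply: sub; apply/asboolP.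
  exact: (Lm (fun x => x \in m') (conj m0 mL) Lm' (elimT negP m1)).
have /asboolP La := elimT (jrad_predP a) aJ _ mP.
apply: L1; rewrite -(subrK a (1 : R)); apply: (psubD sL) => //.
by apply: NL; exists 1; rewrite mul1r.
Qed.

Lemma jradP (x : R) : x \in jrad_pred (R := R) <-> forall a, exists u, u * (1 - a * x) = 1.
Proof.
split=> [xJ a|H]; first by apply: jrad_left_inv; apply: jrad_mull.
apply/jrad_predP => m [[m0 mL] m1 mm]; apply/negPn/negP => xm.
pose M : R^o -> Prop := fun y => exists2 z, z \in m & exists a : R, y = (z : R) + a * x.
have sM : psub M.
  split=> [|b _ _ [z zm [c ->]] [t tm [d ->]]].
    by exists 0 => //; exists 0; rewrite mul0r addr0.
  exists (b *: z + t); first exact: mL.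
  by exists (b * c + d); rewrite /GRing.scale /= mulrDr mulrDl !mulrA addrACA.
have [z zm [a E]] : M 1.
  apply: contrapT => M1; move/negP: xm; apply.
  apply: (mm (fun y => `[< M y >])); [exact: psub_submod|exact/asboolP| |].
    by move=> z zm; apply/asboolP; exists z => //; exists 0; rewrite mul0r addr0.
  by apply/asboolP; exists 0 => //; exists 1; rewrite mul1r add0r.
have [u uP] := H a; move/negP: m1; apply.
have -> : (1 : R) = u * z + 0 by rewrite addr0 -uP; congr (u * _); rewrite [X in X - _]E addrK.
exact: mL.
Qed.

Lemma jrad_unit (a : R) : a \in jrad_pred (R := R) ->
  exists u, u * (1 - a) = 1 /\ (1 - a) * u = 1.
Proof.
move=> aJ; have [u uP] := jrad_left_inv aJ.
have uE : u = 1 - (- (u * a)).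
  by rewrite opprK -[X in X + _]uP mulrBr mulr1 subrK.
have [|v vP] := @jrad_left_inv (- (u * a)).
  by rewrite -mulNr; apply: jrad_mull.
exists u; split=> //; rewrite -uE in vP.
by rewrite -[1 - a]mul1r -{1}vP -[v * u * _]mulrA uP mulr1.
Qed.

End JacobsonRadical.

Lemma artin_algebra_artinian (k : comNzRingType) (A : algType k) :
  artin_algebra A -> artinian (A^o : lmodType A).
Proof.
move=> [kA /fin_genP Ag] F [N [sN FN]].
have sk (L : A -> Prop) : @psub A A^o L -> @psub k A L.
  move=> sL; split=> [|c x y Lx Ly]; first exact: (psub0 sL).
  by rewrite -mulr_algl; apply: (proj2 sL).
have AA := artinian_fgen (artinian_chain kA) Ag.
have [|P [_ [sP FP] Pm]] := AA (fun P => @psub A A^o P /\ F P).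
  by exists N; split=> //; apply: sk.
exists P; split=> // N' sN' FN' N'P; apply: Pm => //; exact: sk.
Qed.

(** * Basic Artinian rings *)
Section TopMap.
Variables (R : pzRingType) (f : idem R) (I : submodule R^o).

(** Presents R f / I f as a quotient of R by r |-> r f, so that its elements can be treated as ring
    elements. *)
Lemma lprin_quot_map : exists q : {linear R^o -> lprin_quot f I},
  (forall y, exists x, q x = y) /\
  forall r : R, q r = 0 <-> exists2 x : R, (x : R^o) \in I & r * (f : R) = x * (f : R).
Proof.
have fP (r : R) : (r * (f : R) : R^o) \in lprin_pred f.
  by rewrite unfold_in -mulrA idemE.
pose S := Submodule (@lprin_ideal_submod_closed R f I).
pose c (r : R^o) : lprin f := @Submod _ _ (Submodule (lprin_submod_closed f)) _ (fP r).
have cL a x y : c (a *: x + y) = a *: c x + c y.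
  by apply: val_inj; rewrite /= mulrDl -mulrA.
have piL a x y : quotmod_pi S (a *: x + y) = a *: (quotmod_pi S x : quotmod S) + quotmod_pi S y.
  by rewrite quotmod_piD; congr (_ + _); rewrite -quotmod_scale_pi.
pose q := lin (quotmod_pi S : lprin f -> quotmod S) piL \o lin c cL.
exists q; split=> [y|r].
  exists (submod_val (quotmod_repr y)); rewrite -[RHS]quotmod_reprK /=; congr quotmod_pi.
  by apply: val_inj; apply/eqP/(submod_valP (quotmod_repr y)).
have q0 : quotmod_pi S 0 = 0 :> quotmod S.
  exact: (linear0 (lin (quotmod_pi S : lprin f -> quotmod S) piL)).
apply: (@iff_trans _ (quotmod_pi S (c r) = quotmod_pi S 0)); first by rewrite q0.
split=> [/quotmod_piP|[x xI E]]; first by rewrite subr0 => /asboolP.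
by apply/quotmod_piP; rewrite subr0; apply/asboolP; exists x.
Qed.
End TopMap.

Lemma top_map (R : pzRingType) (f : idem R) : exists q : {linear R^o -> lprin_quot f (jrad R)},
  (forall y, exists x, q x = y) /\ forall r : R, q r = 0 <-> r * (f : R) \in jrad_pred (R := R).
Proof.
have [q [qs qE]] := lprin_quot_map f (jrad R).
exists q; split=> // r; rewrite qE; split=> [[x xJ ->]|rJ]; first exact: jrad_mulr.
by exists (r * (f : R)) => //; rewrite -mulrA idemE.
Qed.

Section BasicArtin.
Variable R : pzRingType.
Hypotheses (RA : artinian (R^o : lmodType R)) (RB : basic_ring R).
Implicit Types (A B C F K U V W M N Q X Y Z : lmodType R).
Local Notation J := (jrad_pred (R := R)).

Lemma idem_division (D : unitRingType) (x : D) :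
  (forall x : D, x != 0 -> x \is a GRing.unit) -> x * x = x -> x != 0 -> x = 1.
Proof. by move=> H E /H xu; apply: (mulrI xu); rewrite mulr1. Qed.

(* An ideal of a product of division rings is generated by a central idempotent;
   [c] lifts this idempotent for the image of [I]. *)
Lemma ideal_cut (I : R^o -> Prop) : psub I -> (forall a, a \in J -> I a) ->
  exists c : R, I c /\ forall r, I r -> r * (1 - c) \in J.
Proof.
move=> sI JI; have [q [D [pi [Du Ds DJ]]]] := RB.
have /choice[y yP] (i : 'I_q) : exists y : R, [/\ I y,
    forall j, j != i -> pi j y = 0 &
    (exists x : R, I x /\ pi i x != 0) -> pi i y = 1].
  have [[x [Ix x0]]|H] := pselect (exists x : R, I x /\ pi i x != 0); last first.
    by exists 0; split=> [|j _|/H//]; [exact: (psub0 sI)|rewrite rmorph0].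
  have [u uP] := Ds (dfwith (fun j => 0 : D j) ((pi i x)^-1)).
  exists (u * x); split=> [|j ji|_]; first exact: (psubZ sI).
    by rewrite rmorphM uP dfwith_out 1?eq_sym // mul0r.
  by rewrite rmorphM uP dfwith_in mulVr // Du.
exists (\sum_i y i); split=> [|r Ir].
  by apply: (psub_sum sI) => i; case: (yP i).
apply/(DJ _) => i; rewrite rmorphM rmorphB rmorph1 rmorph_sum (bigD1 i) //= big1 => [|j ji].
  have [r0|r0] := eqVneq (pi i r) 0; first by rewrite r0 mul0r.
  by have [_ _ ->] := yP i; [rewrite addr0 subrr mulr0|exists r].
by have [_ H _] := yP j; apply: H; rewrite eq_sym.
Qed.

(** An idempotent is 0 or 1 in each factor D i, and e f = f forces e to be 1 wherever f is. *)
Lemma jrad_idem_mull (e f : idem R) (x : R) : (e : R) * (f : R) = (f : R) ->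
  x * (f : R) \notin J -> (e : R) * (x * (f : R)) \notin J.
Proof.
move=> ef /negP xf; apply/negP => exf; apply: xf; have [q [D [pi [Du Ds DJ]]]] := RB.
apply/(DJ _) => i; apply/eqP/negPn/negP => x0.
have f1 : pi i (f : R) = 1.
  apply: idem_division => //; first exact: Du; first by rewrite -rmorphM idemE.
  by apply: contraNneq x0 => f0; rewrite rmorphM f0 mulr0.
have e1 : pi i (e : R) = 1 by have := congr1 (pi i) ef; rewrite rmorphM f1 mulr1.
have /(_ i) := proj1 (DJ _) exf.
by rewrite rmorphM e1 mul1r => E; rewrite E eqxx in x0.
Qed.

Lemma jrad_idem_orth (e f : idem R) (r : R) : (e : R) * (f : R) = 0 ->
  (e : R) * r * (f : R) \in J.
Proof.
move=> ef; have [q [D [pi [Du Ds DJ]]]] := RB; apply/(DJ _) => i; rewrite !rmorphM.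
have [->|f0] := eqVneq (pi i (f : R)) 0; first by rewrite mulr0.
have f1 : pi i (f : R) = 1 by apply: idem_division => //; [exact: Du|rewrite -rmorphM idemE].
have := congr1 (pi i) ef; rewrite rmorphM f1 mulr1 rmorph0 => ->.
by rewrite !mul0r.
Qed.

(** The c i lift the identities of the division rings in R/J; the second clause says that the image
    of each generates a simple left ideal. *)
Lemma central_family : exists (I : finType) (c : I -> R), \sum_i c i - 1 \in J /\
  forall i r, r * c i \in J \/ exists r', r' * (r * c i) - c i \in J.
Proof.
have [q [D [pi [Du Ds DJ]]]] := RB.
have /choice[c cP] (i : 'I_q) : exists y : R, pi i y = 1 /\ forall j, j != i -> pi j y = 0.
  have [u uP] := Ds (dfwith (fun j => 0 : D j) (1 : D i)).
  by exists u; split=> [|j ji]; rewrite uP ?dfwith_in // dfwith_out // eq_sym.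
exists 'I_q, c; split=> [|i r].
  apply/(DJ _) => i; rewrite rmorphB rmorph1 rmorph_sum (bigD1 i) //= big1 => [|j ji].
    by rewrite (proj1 (cP i)) addr0 subrr.
  by apply: (proj2 (cP j)); rewrite eq_sym.
have [r0|r0] := eqVneq (pi i r) 0.
  left; apply/(DJ _) => j; rewrite rmorphM; have [->|ji] := eqVneq j i; first by rewrite r0 mul0r.
  by rewrite (proj2 (cP i)) // mulr0.
have [u uP] := Ds (dfwith (fun j => 0 : D j) ((pi i r)^-1)).
right; exists u; apply/(DJ _) => j; rewrite rmorphB !rmorphM.
have [->|ji] := eqVneq j i; last by rewrite (proj2 (cP i)) // !mulr0 subrr.
by rewrite (proj1 (cP i)) mulr1 uP dfwith_in mulVr ?subrr // Du.
Qed.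

(** The power J^n, as an intersection of left ideals: elements need not be written as sums of
    products. *)
Fixpoint jpow (n : nat) (x : R) : Prop :=
  match n with
  | 0 => True
  | n'.+1 => forall N : R^o -> Prop, psub N ->
      (forall a b : R, a \in J -> jpow n' b -> N (a * b)) -> N x
  end.

Lemma psub_jpow n : psub (jpow n : R^o -> Prop).
Proof.
case: n => [|n] //=; split=> [N sN _|a x y Hx Hy N sN H]; first exact: psub0.
by apply: (proj2 sN); [apply: Hx|apply: Hy].
Qed.

Lemma jpowM n a b : a \in J -> jpow n b -> jpow n.+1 (a * b).
Proof. by move=> aJ nb N sN; apply. Qed.

(** [jpow] grows on the left, whereas [jnil] below applies the rightmost factor first. *)
Lemma jpowMr n x b : b \in J -> jpow n x -> jpow n.+1 (x * b).
Proof.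
move=> bJ; elim: n x => [|n IH] x nx.
  by move=> N sN H; rewrite -[x * b]mulr1; apply: H => //; apply: jrad_mull.
apply: (nx (fun x => jpow n.+2 (x * b))).
  split=> [|a u v Hu Hv]; first by rewrite mul0r; apply: (psub0 (psub_jpow n.+2)).
  by rewrite mulrDl -mulrA; apply: (proj2 (psub_jpow n.+2)).
by move=> c d cJ nd; rewrite -mulrA; apply: jpowM => //; apply: IH.
Qed.

Lemma jpow_span n m x : jpow (n + m) x -> forall N : R^o -> Prop, psub N ->
  (forall a b, jpow n a -> jpow m b -> N (a * b)) -> N x.
Proof.
elim: n x => [|n IH] x nmx N sN H.
  by rewrite -[x]mul1r; apply: H.
apply: nmx => // a b aJ nmb.
apply: (IH b nmb (fun b => forall a, a \in J -> N (a * b))) => //.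
  split=> [c _|c u v Nu Nv d dJ]; first by rewrite mulr0; exact: (psub0 sN).
  rewrite mulrDr mulrA; apply: (psubD sN); last exact: Nv.
  by apply: Nu; apply: jrad_mulr.
by move=> c d nc md a' a'J; rewrite mulrA; apply: H => //; apply: jpowM.
Qed.

(** Let P be the stable value of J^n, so that P = P P. If P is nonzero, a left ideal L minimal with
    P L nonzero equals P y for some y in L. Then y = u y with u in P, hence in J, so 1 - u is left
    invertible and y = 0. *)
Lemma jpow_nilpotent : exists n, forall x, jpow n x -> x = 0.
Proof.
have [|P [sP [n PE] Pm]] := RA (F := fun P => exists n, P = jpow n).
  by exists (jpow 0); split; [apply: psub_jpow|exists 0%N].
have jS m x : jpow m.+1 x -> jpow m x.
  elim: m x => [|m IH] x // H; apply: H; first exact: psub_jpow.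
  by move=> a b aJ /IH; apply: jpowM.
have stab m x : P x -> jpow m x.
  move=> Px; have [nm|/ltnW mn] := leqP n m.
    apply: (Pm (jpow m)) => //; [exact: psub_jpow|by exists m|].
    move=> y; rewrite PE -(subnK nm); elim: (m - n)%N y => [|k IH] y //.
    by rewrite addSn => /jS/IH.
  rewrite PE in Px; move: Px; rewrite -(subnK mn); elim: (n - m)%N => [|k IH] //.
  by rewrite addSn => /jS.
exists n; rewrite -PE => x Px; apply: contrapT => x0.
have [|L [sL [y Ly [z Pz zy0]] Lm]] :=
    RA (F := fun L => exists2 y, L y & exists2 z : R, P z & z * y <> 0).
  by exists (fun=> True); split=> //; exists (1 : R^o) => //; exists x => //; rewrite mulr1.
(* This is where P = P P enters: P (P w) = 0 implies P w = 0. *)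
have PP w : (forall a b : R, P a -> P b -> a * (b * w) = 0) -> forall b, P b -> b * w = 0.
  move=> H b Pb; have := stab (n + n)%N b Pb.
  move=> /jpow_span/(_ (fun b => b * w = 0)); rewrite -PE; apply.
    by split=> [|c u v Hu Hv]; rewrite ?mul0r // mulrDl -mulrA Hu Hv mulr0 addr0.
  by move=> a c Pa Pc; rewrite -mulrA H.
have sPy : psub (fun v : R^o => exists2 u : R, P u & v = u * y).
  split=> [|c _ _ [u Pu ->] [v Pv ->]]; first by exists 0; rewrite ?mul0r //; apply: (psub0 sP).
  by exists (c * u + v); [apply: (proj2 sP)|rewrite mulrDl -mulrA].
have [u Pu yE] : exists2 u : R, P u & y = u * y.
  apply: (Lm (fun v : R^o => exists2 u : R, P u & v = u * y)) => //.
    apply: contrapT => H; apply: zy0; apply: (PP y) => // a b Pa Pb.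
    apply: contrapT => H'; apply: H; exists (b * y); first by exists b.
    by exists a.
  by move=> _ [u Pu ->]; apply: (psubZ sL).
have uJ : u \in J.
  apply: (stab 1%N u Pu (fun x => x \in J)); first exact: psub_jrad.
  by move=> a b aJ _; apply: jrad_mulr.
have [v vP] := jrad_left_inv uJ.
by apply: zy0; rewrite -[y]mul1r -vP -mulrA mulrBl mul1r -yE subrr !mulr0.
Qed.

Fixpoint jnil (n : nat) M (x : M) : Prop :=
  match n with
  | 0 => x = 0
  | n'.+1 => forall a, a \in J -> jnil n' (a *: x)
  end.

Lemma jnil_exists : exists n, forall M (x : M), jnil n x.
Proof.
have [n nP] := jpow_nilpotent; exists n => M x.
have : forall b, jpow n b -> b *: x = 0 by move=> b /nP->; rewrite scale0r.
elim: n {nP} x => [|n IH] x H; first by rewrite /= -[x]scale1r H.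
by move=> a aJ; apply: IH => b nb; rewrite scalerA H //; apply: jpowMr.
Qed.

Lemma jrad_socle M (x : M) : x <> 0 ->
  exists r : R, r *: x <> 0 /\ forall a, a \in J -> a *: (r *: x) = 0.
Proof.
have [n /(_ M x)] := jnil_exists; elim: n x => [|n IH] x //= nx x0.
have [H|/existsNP[a /not_implyP[aJ ax0]]] := pselect (forall a, a \in J -> a *: x = 0).
  by exists 1; rewrite scale1r.
have [r [rax H]] := IH _ (nx a aJ) ax0.
by exists (r * a); rewrite -scalerA.
Qed.

Lemma psub_annih M : psub (fun x : M => forall a, a \in J -> a *: x = 0).
Proof.
split=> [a _|b x y Hx Hy a aJ]; first by rewrite scaler0.
by rewrite scalerDr scalerA Hx ?Hy ?addr0 //; apply: jrad_mulr.
Qed.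

Lemma jnil_filtration M : exists N Q (j : {linear N -> M}) (q : {linear M -> Q}),
  [/\ ses j q, forall (x : N) a, a \in J -> a *: x = 0 &
    forall n, (forall x : M, jnil n.+1 x) -> forall x : Q, jnil n x].
Proof.
have [N [j [ji jE]]] := sub_ex (psub_annih M).
have [Q [q jq]] := ses_coker ji; have [_ qs qE] := jq.
exists N, Q, j, q; split=> // [x a aJ|n H y].
  apply: ji; rewrite linearZ linear0; apply: (proj2 (jE (j x))) => //.
  by exists x.
have [x <-] := qs y; have := H x; elim: n x {H y} => [|n IH] x /= H.
  by apply/qE/jE.
by move=> a aJ; rewrite -linearZ; apply: IH; apply: H.
Qed.

(** Induction on the Loewy length, which is finite for every module because J is nilpotent; the
    bottom layer is split off. *)
Lemma jnil_ind (P : lmodType R -> Prop) :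
  (forall M, zero_module M -> P M) ->
  (forall N M Q (j : {linear N -> M}) (q : {linear M -> Q}), ses j q ->
     (forall (x : N) a, a \in J -> a *: x = 0) -> P Q -> P M) ->
  forall M, P M.
Proof.
move=> P0 PS M; have [n /(_ M)] := jnil_exists.
elim: n M => [|n IH] M H; first exact: P0.
have [N [Q [j [q [jq NJ QP]]]]] := jnil_filtration M.
by apply: PS jq NJ (IH _ (QP n H)).
Qed.

Lemma artinian_semisimple_fgen M : artinian M -> (forall (x : M) a, a \in J -> a *: x = 0) -> fgen M.
Proof.
move=> MA MJ.
(* The submodules L that span M together with finitely many elements. A minimal one must be 0: for x
   <> 0 in L, a submodule K with M = K + R x and x not in K would give the smaller member formed by
   L and K. *)
pose F (L : M -> Prop) := exists (I : finType) (g : I -> M), forall x, exists l (a : I -> R),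
  L l /\ x = l + \sum_i a i *: g i.
have [|L [sL [I [g gP]] Lm]] := MA F.
  exists (fun=> True); split=> //; exists void, (of_void M) => x.
  by exists x, (of_void R); split=> //; rewrite big1 ?addr0 // => -[].
suff L0 x : L x -> x = 0.
  exists I, g => x; have [l [a [/L0 -> ->]]] := gP x.
  by exists a; rewrite add0r.
move=> Lx; apply: contrapT => x0.
have s0 : psub (fun y : M => y = 0) by split=> [|a y z -> ->] //; rewrite scaler0 addr0.
have [K [sK _ Kx Km]] := zorn_sub s0 x0.
(* K is a maximal submodule avoiding x; since M is semisimple, M = K + R x. *)
have KR z : exists l r, K l /\ z = l + r *: x.
  have sKR : psub (fun z => exists l r, K l /\ z = l + r *: x).
    split=> [|a _ _ [l [r [Kl ->]]] [m [s [Km' ->]]]].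
      by exists 0, 0; split; [apply: psub0|rewrite scale0r addr0].
    exists (a *: l + m), (a * r + s); split; first exact: (proj2 sK).
    by rewrite scalerDr scalerDl scalerA addrACA.
  have [T [c [cJ cP]]] := central_family.
  have -> : z = \sum_i c i *: z.
    apply/eqP; rewrite eq_sym -subr_eq0 -scaler_suml -[X in _ - X]scale1r -scalerBl.
    by rewrite MJ.
  apply: (psub_sum sKR) => i.
  have [Kz|Kz] := pselect (K (c i *: z)).
    by exists (c i *: z), 0; rewrite scale0r addr0.
  have [l [r [Kl xE]]] : exists l r, K l /\ x = l + r *: (c i *: z).
    apply: contrapT => H; apply: Kz.
    apply: (Km (fun y => exists l r, K l /\ y = l + r *: (c i *: z))) => //.
    - split=> [|a _ _ [l [r [Kl ->]]] [m [s [Km' ->]]]].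
        by exists 0, 0; split; [apply: psub0|rewrite scale0r addr0].
      exists (a *: l + m), (a * r + s); split; first exact: (proj2 sK).
      by rewrite scalerDr [(_ + _) *: (_ *: _)]scalerDl scalerA addrACA.
    - by move=> y Ky; exists y, 0; rewrite scale0r addr0.
    by exists 0, 1; split; [apply: psub0|rewrite scale1r add0r].
  have [rJ|[r' r'J]] := cP i r.
    by case: Kx; rewrite xE scalerA MJ // addr0.
  exists (- (r' *: l)), r'; split; first by rewrite -scaleNr; apply: psubZ.
  rewrite {1}xE scalerDr addKr !scalerA; apply/eqP.
  by rewrite eq_sym -subr_eq0 -scalerBl -mulrA MJ.
have sLK : psub (fun y => L y /\ K y).
  split=> [|a y z [Ly Ky] [Lz Kz]]; first by split; exact: psub0.
  by split; [exact: (proj2 sL)|exact: (proj2 sK)].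
have FLK : F (fun y => L y /\ K y).
  exists (I + unit)%type, (fun o => if o is inl i then g i else x) => y.
  have [l [a [Ll yE]]] := gP y; have [m [r [Km' lE]]] := KR l.
  exists m, (fun o => if o is inl i then a i else r); split.
    split=> //; have -> : m = l - r *: x by rewrite lE addrK.
    by apply: psubB => //; apply: psubZ.
  by rewrite big_sumType /= big_const card_unit /= addr0 yE lE addrAC addrA.
have LK y : L y -> L y /\ K y by apply: (Lm _ sLK FLK) => z [].
by case: (LK x Lx).
Qed.

Lemma artinian_is_fgen M : artinian M -> fgen M.
Proof.
apply: (jnil_ind (P := fun M => artinian M -> fgen M)) => [N N0 _|N K Q j q jq NJ IH KA].
  exact: fgen_zero.
have [ji qs _] := jq; apply: (fgen_mid jq).
  by apply: artinian_semisimple_fgen => //; apply: artinian_sub ji KA.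
by apply/IH/(artinian_quot qs).
Qed.

(** The Hopkins-Levitzki theorem: finitely generated modules are artinian, and artinian modules are
    finitely generated by induction on the Loewy length. *)
Lemma basic_artin_noetherian : noetherian R.
Proof.
move=> K M j ji /(artinian_fgen RA) MA; apply: artinian_is_fgen.
exact: artinian_sub ji MA.
Qed.

(** The annihilator of x contains J, so [ideal_cut] gives c with c x = 0 and r (1 - c) in J whenever
    r x = 0. Hence r x |-> r (1 - c) is a well-defined section of the surjection from R f / J f. *)
Lemma top_retract (f : idem R) M (x : M) : (forall y, exists r, y = r *: x) ->
  (f : R) *: x = x -> (forall a, a \in J -> a *: x = 0) -> retract M (lprin_quot f (jrad R)).
Proof.
move=> xs fx Jx; have [q [qs qE]] := top_map f.
have [c [/= cx cP]] := ideal_cut (psub_ker (scal_map x)) Jx.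
pose ev := scal_map x.
have evs y : exists u, ev u = y by have [r ->] := xs y; exists r.
have [|rho rhoP] := factor (f := ev) qs.
  by move=> r /qE rJ; rewrite /= -fx scalerA Jx.
have L2 a (u v : R^o) : q ((a *: u + v : R) * (1 - c)) = a *: q (u * (1 - c)) + q (v * (1 - c)).
  by rewrite -linearP; congr (q _); rewrite mulrDl -mulrA.
have [|s sP] := factor (f := lin (fun u : R^o => q ((u : R) * (1 - c))) L2) evs.
  by move=> r /= /cP rJ; apply/qE; apply: jrad_mulr.
exists s, rho => y; have [r <-] := evs y.
by rewrite sP rhoP /= mulrBr mulr1 scalerBl -scalerA cx scaler0 subr0.
Qed.

Section Killed.
Variable e : idem R.
Hypothesis eS : fpd (lprin_quot (idem_compl e) (jrad R)).

(** Induction on the Loewy length, then on the number of generators of the bottom layer. A cyclic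
    piece R x of that layer satisfies (1 - e) x = x, hence is a summand of R (1 - e) / J (1 - e). *)
Lemma ekilled_fpd M : fgen M -> (forall x : M, (e : R) *: x = 0) -> fpd M.
Proof.
move=> + eM; apply: (jnil_ind (P := fun M => (forall x : M, (e : R) *: x = 0) -> fgen M -> fpd M)) => //.
  by move=> N N0 _ _; apply/fpd_proj/zero_proj.
move=> N {eM}M Q j q jq NJ IH eM Mg; have [ji qs _] := jq.
apply: (fpd_mid jq); last first.
  apply: IH (fgen_surj qs Mg) => y; have [x <-] := qs y.
  by rewrite -linearZ eM linear0.
have eN (x : N) : (e : R) *: x = 0 by apply: ji; rewrite linearZ /= eM linear0.
have [n [g gP]] := proj2 (fin_genP _) (basic_artin_noetherian ji Mg).
elim: n N g {j ji jq} gP NJ eN => [|n IHn] N g gP NJ eN.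
  by apply/fpd_proj/zero_proj => x; have [a ->] := gP x; rewrite big_ord0.
pose x := g ord0.
have [K [j [x' [ji jx xP _]]]] := cyclic_sub x; have [Q' [q' jq']] := ses_coker ji.
have [_ q's q'E] := jq'.
apply: (fpd_mid jq').
  apply: (fpd_retract _ eS); apply: (top_retract xP) => [|a aJ].
    by apply: ji; rewrite linearZ jx /= scalerBl scale1r eN subr0.
  by apply: ji; rewrite linearZ linear0 jx /= NJ.
apply: (IHn _ (fun i => q' (g (lift ord0 i)))) => [y|y a aJ|y]; have [z <-] := q's y.
- have [a ->] := gP z; exists (fun i => a (lift ord0 i)).
  rewrite big_ord_recl linearD [q' (a ord0 *: _)](_ : _ = 0) ?add0r; last first.
    by apply/q'E; exists (a ord0 *: x'); rewrite linearZ jx.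
  by rewrite linear_sum; apply: eq_bigr => i _; rewrite linearZ.
- by rewrite -linearZ NJ // linear0.
by rewrite -linearZ eN linear0.
Qed.

End Killed.

End BasicArtin.

(** * The functor M |-> eM *)
Section CornerFunctor.
Variables (R : pzRingType) (e : idem R).
Implicit Types (A B C F K U V W M N Q X Y Z : lmodType R).
Local Notation "'E' M" := (emod e M : lmodType (corner e)) (at level 8, M at level 0).
Local Notation P := (lprin e).

Lemma emod_valE M (x : emod e M) : (e : R) *: emod_val x = emod_val x.
Proof. exact/eqP/emod_valP. Qed.

Lemma emod_ext M (x y : emod e M) : emod_val x = emod_val y -> x = y.
Proof. exact: val_inj. Qed.

Lemma lprin_ext (x y : P) : submod_val x = submod_val y -> x = y.
Proof. exact: val_inj. Qed.

Fact ecut_subproof M (x : M) : (e : R) *: x \in emod_pred e (M := _).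
Proof. by rewrite unfold_in scalerA idemE. Qed.
Definition ecut M (x : M) : emod e M := Emod (ecut_subproof x).

Lemma ecutE M (x : M) : emod_val (ecut x) = (e : R) *: x.
Proof. by []. Qed.

Lemma ecutK M (x : emod e M) : ecut (emod_val x) = x.
Proof. by apply: emod_ext; apply: emod_valE. Qed.

Lemma ecutD M (x y : M) : ecut (x + y) = ecut x + ecut y.
Proof. by apply: emod_ext; apply: scalerDr. Qed.

Fact ecorner_subproof (a : R) : (e : R) * a * (e : R) \in corner_pred e.
Proof. by rewrite unfold_in !mulrA idemE -mulrA idemE. Qed.
Definition ecorner (a : R) : corner e := Corner (ecorner_subproof a).

Lemma emod_val_sum M (I : finType) (f : I -> emod e M) :
  emod_val (\sum_i f i) = \sum_i emod_val (f i).
Proof. by apply: (big_morph (@emod_val R e M)). Qed.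

Lemma ecut_scale M (a : R) (x : emod e M) :
  ecut (a *: emod_val x) = (ecorner a *: x : E M).
Proof. by apply: emod_ext; rewrite /= -[in LHS](emod_valE x) !scalerA. Qed.

Fact emap_subproof M N (f : {linear M -> N}) (x : emod e M) : f (emod_val x) \in emod_pred e (M := _).
Proof. by rewrite unfold_in -linearZ emod_valE. Qed.
Definition emap_fun M N (f : {linear M -> N}) (x : emod e M) : emod e N :=
  Emod (emap_subproof f x).
Fact emap_linear M N (f : {linear M -> N}) a (x y : E M) :
  emap_fun f (a *: x + y) = a *: (emap_fun f x : E N) + emap_fun f y.
Proof. by apply: emod_ext; rewrite /= linearP. Qed.
Definition emap M N (f : {linear M -> N}) : {linear E M -> E N} :=
  lin (emap_fun f : E M -> E N) (emap_linear f).

Lemma emapE M N (f : {linear M -> N}) (x : E M) : emod_val (emap f x) = f (emod_val x).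
Proof. by []. Qed.

Lemma emap_surj M N (f : {linear M -> N}) : (forall y, exists x, f x = y) ->
  forall y, exists x, emap f x = y.
Proof.
move=> fs y; have [x xE] := fs (emod_val y).
by exists (ecut x); apply: emod_ext; rewrite /= linearZ xE; apply: emod_valE.
Qed.

Lemma emap_inj M N (f : {linear M -> N}) : injective f -> injective (emap f).
Proof. by move=> fi x y /(congr1 (@emod_val R e N)) /fi; apply: emod_ext. Qed.

Lemma emap_ses K W M (j : {linear K -> W}) (p : {linear W -> M}) :
  ses j p -> ses (emap j) (emap p).
Proof.
move=> [ji ps jpE]; split; [exact: emap_inj|exact: emap_surj|move=> x].
split=> [/(congr1 (@emod_val R e M)) /jpE[k kE]|[k ->]].
  exists (ecut k); apply: emod_ext.
  by rewrite /= linearZ -kE; apply: esym; apply: emod_valE.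
by apply: emod_ext => /=; apply/jpE; exists (emod_val k).
Qed.

Lemma emap_inadd U Y : inadd U Y -> inadd (E U) (E Y).
Proof.
move=> [I [s [r rs]]]; exists I, (fun i => emap (s i)), (fun i => emap (r i)) => y.
by apply: emod_ext; rewrite emod_val_sum /= rs.
Qed.

Lemma emap_retract X Y : retract X Y -> retract (E X) (E Y).
Proof.
by move=> [s [r rs]]; exists (emap s), (emap r) => x; apply: emod_ext; rewrite /= rs.
Qed.

Fact lprin_one_subproof : ((e : R) : R^o) \in lprin_pred e.
Proof. by rewrite unfold_in idemE. Qed.
Definition lprin_one : P := @Submod _ _ (Submodule (lprin_submod_closed e)) _ lprin_one_subproof.

Lemma lprin_valE (x : P) : (submod_val x : R) * (e : R) = submod_val x.
Proof. exact/eqP/(submod_valP x). Qed.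

Lemma lprin_scale (x : P) : x = (submod_val x : R) *: lprin_one.
Proof. by apply: lprin_ext; rewrite /= -[LHS]lprin_valE. Qed.

Fact lprin_map_linear M (m : M) a (x y : P) :
  (submod_val (a *: x + y) : R) *: m = a *: ((submod_val x : R) *: m) + (submod_val y : R) *: m.
Proof. by rewrite scalerA -scalerDl. Qed.
Definition lprin_map M (m : M) : {linear P -> M} :=
  lin (fun x : P => (submod_val x : R) *: m) (lprin_map_linear m).

Lemma lprin_retract : retract P (R^o : lmodType R).
Proof.
have L1 a (x y : P) : submod_val (a *: x + y) = a *: submod_val x + submod_val y by [].
exists (lin (fun x : P => submod_val x : R^o) L1).
have cP (x : R^o) : (x * (e : R) : R^o) \in lprin_pred e by rewrite unfold_in -mulrA idemE.
pose c x : P := @Submod _ _ (Submodule (lprin_submod_closed e)) _ (cP x).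
have cL a x y : c (a *: x + y) = a *: c x + c y by apply: lprin_ext; rewrite /= mulrDl -mulrA.
by exists (lin c cL) => x; apply: lprin_ext; apply: lprin_valE.
Qed.

Lemma lprin_pfin : pfin P.
Proof. exact: pfin_retract lprin_retract (pfin_regular R). Qed.

Lemma lprin_proj : projective P.
Proof. exact: (proj_retract lprin_retract (@proj_regular R)). Qed.

Definition lprin_gen : emod e P := ecut lprin_one.

Lemma lprin_genE : emod_val lprin_gen = lprin_one.
Proof. by apply: lprin_ext; exact: (idemE e). Qed.

Fact lprin_corner_subproof (x : emod e P) : submod_val (emod_val x) \in corner_pred e.
Proof.
rewrite unfold_in -mulrA lprin_valE.
by apply/eqP; exact: (congr1 (@submod_val _ _ _) (emod_valE x)).
Qed.
Definition lprin_corner (x : emod e P) : corner e := Corner (lprin_corner_subproof x).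

Lemma lprin_corner_scale (x : E P) : x = lprin_corner x *: (lprin_gen : E P).
Proof.
apply: emod_ext; apply: etrans (lprin_scale _) _.
by apply: (congr1 (fun y => _ *: y)); rewrite lprin_genE.
Qed.

Lemma lprin_corner_linear a (x y : E P) :
  lprin_corner (a *: x + y) = a *: (lprin_corner x : (corner e)^o) + lprin_corner y.
Proof. exact: val_inj. Qed.

Lemma lprin_corner_iso : mod_iso (E P) ((corner e)^o : lmodType (corner e)).
Proof.
exists (lin (fun x : E P => lprin_corner x : (corner e)^o) lprin_corner_linear).
exists (fun x : (corner e)^o => (x : corner e) *: (lprin_gen : E P)) => x.
  by rewrite !linE -lprin_corner_scale.
by apply: val_inj; apply: etrans (congr1 (fun y : R => corner_val x * y) (idemE e)) (cornerr x).
Qed.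

Lemma lprin_corner_retract : retract (E P) ((corner e)^o : lmodType (corner e)).
Proof. exact: (mod_iso_retract lprin_corner_iso). Qed.

(** It suffices to treat F = R e: an eRe-map from eRe to eK and an R-map from R e to K are both
    given by one element of eK. *)
Lemma lprin_map_ext F K (sigma : {linear E F -> E K}) : inadd P F ->
  exists g : {linear F -> K}, forall x : E F, emod_val (sigma x) = g (emod_val x).
Proof.
move=> [I [s [r rs]]].
pose m i := emod_val (sigma (emap (r i) lprin_gen)).
have L a x y : \sum_i lprin_map (m i) (s i (a *: x + y)) =
    a *: (\sum_i lprin_map (m i) (s i x)) + \sum_i lprin_map (m i) (s i y).
  by rewrite scaler_sumr -big_split; apply: eq_bigr => i _; rewrite !linearP.
exists (lin (fun x => \sum_i lprin_map (m i) (s i x)) L) => x.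
have {1}-> : x = \sum_i emap (r i) (emap (s i) x).
  by apply: emod_ext; rewrite emod_val_sum /= rs.
rewrite linear_sum emod_val_sum linE; apply: eq_bigr => i _.
by rewrite [emap (s i) x]lprin_corner_scale !linearZ /= /m.
Qed.

Lemma lprin_map_uniq F K (f g : {linear F -> K}) : inadd P F ->
  (forall x : E F, f (emod_val x) = g (emod_val x)) -> f =1 g.
Proof.
move=> [I [s [r rs]]] fg x; rewrite -(rs x) !linear_sum; apply: eq_bigr => i _.
rewrite [s i x]lprin_scale !linearZ; congr (_ *: _).
by have := fg (emap (r i) lprin_gen); rewrite emapE lprin_genE.
Qed.

Lemma lprin_cover M : fgen (E M) ->
  exists F (p : {linear F -> M}), inadd P F /\ forall y, exists x, emap p x = y.
Proof.
move=> /fin_genP[n [g gP]].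
have L a (x y : mod_power P n) : \sum_i lprin_map (emod_val (g i)) ((a *: x + y : mod_power P n) i) =
    a *: (\sum_i lprin_map (emod_val (g i)) (x i)) + \sum_i lprin_map (emod_val (g i)) (y i).
  by rewrite scaler_sumr -big_split; apply: eq_bigr => i _; exact: linearP.
exists (mod_power P n), (lin (fun x : mod_power P n => \sum_i lprin_map (emod_val (g i)) (x i)) L).
split=> [|y]; first exact: inadd_power.
have [a ->] := gP y.
exists (ecut ((fun i => (corner_val (a i) : R) *: lprin_one) : mod_power P n)).
apply: emod_ext; rewrite emapE ecutE linearZ_LR emod_val_sum linE scaler_sumr.
by apply: eq_bigr => i _; rewrite linearZ_LR /= emod_valE scalerA cornerl.
Qed.

(** N is presented by tau : eF -> N with F a power of R e. Dividing F by the largest submodule Z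
    with eZ inside the kernel of tau gives M, and eZ is then the whole kernel. *)
Lemma realize (N : lmodType (corner e)) : fgen N ->
  exists M (phi : {linear E M -> N}), fgen M /\ bijective phi.
Proof.
move=> /fin_genP[n [g gP]].
pose F : lmodType R := mod_power P n.
have FL a (x y : E F) : \sum_i lprin_corner (emap (dproj _ i) (a *: x + y)) *: g i =
    a *: (\sum_i lprin_corner (emap (dproj _ i) x) *: g i) +
    \sum_i lprin_corner (emap (dproj _ i) y) *: g i.
  rewrite scaler_sumr -big_split; apply: eq_bigr => i _.
  by rewrite linearP lprin_corner_linear scalerDl scalerA.
pose tau := lin (fun x : E F => \sum_i lprin_corner (emap (dproj _ i) x) *: g i) FL.
have taus y : exists x, tau x = y.
  have [a ->] := gP y.
  exists (ecut ((fun i => (corner_val (a i) : R) *: lprin_one) : F)).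
  apply: eq_bigr => i _; congr (_ *: _); apply: val_inj.
  exact: etrans (congr1 (fun y : R => (e : R) * y) (cornerr (a i))) (cornerl (a i)).
have sZ : psub (fun x : F => forall r : R, tau (ecut (r *: x)) = 0).
  split=> [r|a x y Hx Hy r].
    by rewrite scaler0 (_ : ecut 0 = 0) ?linear0 //; apply: emod_ext; rewrite /= scaler0.
  by rewrite scalerDr ecutD linearD scalerA Hx Hy addr0.
have [M [q [qs qE]]] := quo_ex sZ.
have [|phi phiP] := factor (f := tau) (emap_surj qs).
  move=> x /(congr1 (@emod_val R e M)) /qE /(_ 1).
  by rewrite scale1r ecutK.
exists M, phi; split.
  apply: (fgen_surj qs); apply: fgen_inadd (inadd_power P n) _.
  by case: lprin_pfin.
apply: surj_inj_bij => [|y]; last by have [x <-] := taus y; exists (emap q x); rewrite phiP.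
apply: lin_inj => y; have [x <-] := emap_surj qs y; rewrite phiP => tx0.
apply: emod_ext => /=; apply/qE => r.
by rewrite ecut_scale linearZ_LR tx0 scaler0.
Qed.

Section FiniteDimension.
Hypotheses (noeth : noetherian R)
  (kill : forall M, fgen M -> (forall x : M, (e : R) *: x = 0) -> fpd M)
  (eRg : fgen (E (R^o : lmodType R))) (eRf : fpd (E (R^o : lmodType R))).

Lemma emod_fgen M : fgen M -> fgen (E M).
Proof.
move=> /fgen_cover[F [p [RF ps]]]; apply: (fgen_surj (emap_surj ps)).
exact: fgen_inadd (emap_inadd RF) eRg.
Qed.

(** M |-> eM is exact and sends add(R) into add(eR), so t can be any bound for the projective
    dimension of eR. *)
Lemma emod_pd_bound : exists t, forall n M, fgen M -> pd_le n M -> pd_le (t + n) (E M).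
Proof.
have [t Ht] := eRf; exists t; elim=> [|n IH] M Mg Mn.
  have [F [p [RF ps]]] := fgen_cover Mg.
  have [s sP] := proj_split (proj1 (pd_le0 M) Mn) ps.
  rewrite addn0; apply: (pd_le_inadd (U := E (R^o : lmodType R))) => //.
  by apply: emap_inadd; apply: inadd_retract RF; exists s, p.
have [F [p [RF ps]]] := fgen_cover Mg; have [K [j jp]] := ses_ker ps.
have Fp : projective F by apply: proj_inadd RF; apply: proj_regular.
have [ji _ _] := jp.
have Kg : fgen K by apply: (noeth ji); apply: fgen_inadd RF (fgen_regular R).
have Kn : pd_le n K by move=> V; apply: (Mn V _ _ _ _ jp Fp).
rewrite addnS; apply: (pd_le_right (emap_ses jp) (IH K Kg Kn)).
apply: (pd_le_inadd (emap_inadd RF)); apply: pd_le_leq Ht.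
by rewrite -addnS leq_addr.
Qed.

Lemma emod_pfin M : pfin M -> pfin (E M).
Proof.
move=> [Mg [n Mn]]; split; first exact: emod_fgen.
by have [t tP] := emod_pd_bound; exists (t + n)%N; apply: tP.
Qed.

(** The kernel and the cokernel of f are annihilated by e, hence of finite projective dimension. *)
Lemma emod_iso_fpd M N (f : {linear M -> N}) : fgen M -> fgen N ->
  (forall y, exists x, emap f x = y) -> (forall x, emap f x = 0 -> x = 0) ->
  fpd M -> fpd N.
Proof.
move=> Mg Ng fs fi Mf; have [I [q [j [qs ji jE]]]] := image_ex f.
have [K [k kq]] := ses_ker qs; have [ki _ kqE] := kq.
have If : fpd I.
  apply: (fpd_right kq) => //; apply: kill => [|x]; first exact: noeth ki Mg.
  apply: ki; rewrite linearZ linear0.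
  suff /(congr1 (@emod_val R e M)) : ecut (k x) = 0 by [].
  by apply: fi; apply: emod_ext; rewrite /= linearZ_LR jE (ses0 _ kq) linear0 ?scaler0.
have [C [c jc]] := ses_coker ji; have [_ cs jcE] := jc.
apply: (fpd_mid jc) => //; apply: kill => [|y]; first exact: fgen_surj cs Ng.
have [z <-] := cs y; rewrite -linearZ; apply/jcE.
have [x /(congr1 (@emod_val R e N)) /= xE] := fs (ecut z).
by exists (q (emod_val x)); rewrite -jE.
Qed.

(** The sequence need be exact only after e is applied: p has image R e M, and M / R e M is
    annihilated by e. In exchange F lies in add(R e), so that eF is projective. *)
Lemma emod_cover M : fgen M -> exists F K (j : {linear K -> F}) (p : {linear F -> M}),
  [/\ inadd P F, injective j, fgen K, ses (emap j) (emap p) & fpd K -> fpd M].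
Proof.
move=> Mg; have [F [p [PF ps]]] := lprin_cover (emod_fgen Mg).
have [N [q [i [qs ii iE]]]] := image_ex p.
have [K [j jq]] := ses_ker qs; have [ji _ jqE] := jq.
have [Fg Ff] : pfin F by apply: pfin_inadd PF lprin_pfin.
exists F, K, j, p; split=> //; first exact: noeth ji Fg.
  have [Ei _ Eq] := emap_ses jq; split=> // x; rewrite -Eq.
  split=> /(congr1 (@emod_val R e _)) /= H; apply: emod_ext => /=.
    by apply: (inj0 ii); rewrite -iE.
  by rewrite iE H linear0.
move=> Kf; apply: (@emod_iso_fpd N M i) => //; first exact: fgen_surj qs Fg.
- by move=> y; have [x <-] := ps y; exists (emap q x); apply: emod_ext; rewrite /= iE.
- by move=> x; rewrite -(linear0 (emap i)); apply: (emap_inj ii).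
exact: fpd_right jq Kf Ff.
Qed.

Lemma emod_fpd M : fgen M -> fpd (E M) -> fpd M.
Proof.
move=> + [n]; elim: n M => [|n IH] M Mg Mn; have [F [K [j [p [PF ji Kg jp]]]]] := emod_cover Mg.
  apply; have [_ ps _] := jp; have [s sP] := proj_split (proj1 (pd_le0 _) Mn) ps.
  have [t [tj _]] := ses_split_ret jp sP.
  (* The projection of eF onto eK along eM lifts to an idempotent of F. *)
  have [g gP] := lprin_map_ext t PF.
  have gg : (j \o g) \o (j \o g) =1 j \o g.
    apply: lprin_map_uniq PF _ => x /=.
    by rewrite -gP -[in LHS]emapE -gP tj.
  have [I [q [i [qs ii iE]]]] := image_ex g.
  have [C [c ic]] := ses_coker ii; have [_ cs icE] := ic.
  (* The image I of this idempotent is a summand of F contained in K, and eI = eK, so K / I is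
     annihilated by e. *)
  have If : fpd I.
    apply: fpd_proj; apply: proj_retract (proj_inadd lprin_proj PF).
    exists (j \o i), q => x; have [y <-] := qs x.
    by apply/ii/ji; rewrite -!iE /= -iE; apply: gg.
  apply: (fpd_mid ic) => //; apply: kill => [|y]; first exact: fgen_surj cs Kg.
  have [k <-] := cs y; rewrite -linearZ; apply/icE.
  have := gP (emap j (ecut k)); rewrite tj /= linearZ => kE.
  by exists (q ((e : R) *: j k)); rewrite -iE.
have Fp : projective (E F).
  apply: proj_inadd (emap_inadd PF).
  by apply: proj_retract lprin_corner_retract _; apply: proj_regular.
by apply; apply: IH => // V; apply: (Mn V _ _ _ _ jp Fp).
Qed.

End FiniteDimension.
End CornerFunctor.

(** * Decomposition into indecomposable summands *)

Lemma prod_swap_iso (R : pzRingType) (X Y : lmodType R) : mod_iso (X * Y)%type (Y * X)%type.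
Proof.
by exists (lin (fun x : (X * Y)%type => (x.2, x.1) : (Y * X)%type) (fun a x y => erefl)), (fun x => (x.2, x.1)) => -[].
Qed.

(** Among the summands of M that violate P one is minimal; in a nontrivial decomposition of it both
    factors are smaller and satisfy P. *)
Lemma indecomposable_ind (R : pzRingType) (M : lmodType R) (P : lmodType R -> Prop) :
  artinian M -> (forall Z, zero_module Z -> P Z) ->
  (forall W X Y : lmodType R, mod_iso W (X * Y)%type -> P X -> P Y -> P W) ->
  (forall W, indecomposable W -> retract W M -> P W) -> P M.
Proof.
move=> MA P0 PXY Pi; apply: contrapT => nPM.
have [|N [_ [W [j [[t tj] nPW NE]]] Nm]] := MA (fun N => exists (W : lmodType R) (j : {linear W -> M}),
    [/\ exists t : {linear M -> W}, cancel j t, ~ P W & N = (fun x => exists w, x = j w)]).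
  by exists (fun x => exists w, x = idfun w); split; [exact: (psub_im (idfun : {linear M -> M}))|exists M, idfun; split=> //; exists idfun].
have key (X Y : lmodType R) : mod_iso W (X * Y)%type -> ~ zero_module Y -> P X.
  move=> /mod_iso_sym[f [g fK gK]] Y0; apply: contrapT => nPX; apply: Y0 => y.
  pose h : {linear X -> M} := j \o f \o inL X Y.
  have [f' [ff' f'f]] := bij_lin_inv (can_inj fK) (fun y => ex_intro _ (g y) (gK y)).
  have hP : exists (W : lmodType R) (j : {linear W -> M}), [/\ exists t : {linear M -> W}, cancel j t,
      ~ P W & (fun x => exists w, x = h w) = (fun x => exists w, x = j w)].
    exists X, h; split=> //; exists (fst \o f' \o t) => x /=.
    by rewrite tj ff'.
  have hN x : (exists w, x = h w) -> N x by move=> [w ->]; rewrite NE; exists (f (w, 0)).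
  have [|w /(can_inj tj) /(can_inj fK) [_ //]] := Nm _ (psub_im h) hP hN (j (f (0, y))).
  by rewrite NE; exists (f (0, y)).
have W0 : ~ zero_module W by move=> /P0.
suff Wi : indecomposable W by apply: nPW; apply: Pi => //; exists j, t.
split=> // X Y XY; apply: contrapT => /not_orP[X0 Y0]; apply: nPW.
apply: (PXY _ _ _ XY); first exact: key XY Y0.
exact: key (mod_iso_trans XY (prod_swap_iso X Y)) X0.
Qed.

Lemma indecomposable_inadd (R : pzRingType) (A U M : lmodType R) : artinian M ->
  (forall X : lmodType R, indecomposable X -> inadd A X -> inadd U X) ->
  inadd A M -> inadd U M.
Proof.
move=> MA H AM; apply: (indecomposable_ind MA).
- move=> Z Z0; exists void, (fun=> \0), (fun=> \0) => y.
  by rewrite [LHS]Z0 [RHS]Z0.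
- move=> W X Y XY UX UY; apply: inadd_retract (inadd_prod UX UY).
  exact: mod_iso_retract XY.
by move=> W Wi WM; apply: H => //; apply: inadd_retract AM.
Qed.

Lemma indecomposable_summand (R : pzRingType) (M : lmodType R) : artinian M ->
  ~ zero_module M -> exists W : lmodType R, indecomposable W /\ retract W M.
Proof.
move=> MA M0; apply: contrapT => H; apply: M0.
apply: (indecomposable_ind MA) => [//|W X Y [f [g fK gK]] X0 Y0 w|W Wi WM].
  apply: (can_inj fK); rewrite [f w]surjective_pairing [f 0]surjective_pairing.
  by congr pair; [rewrite [LHS]X0 [RHS]X0|rewrite [LHS]Y0 [RHS]Y0].
by case: H; exists W.
Qed.

(** * e-torsion and approximations *)
Section Torsion.
Variable R : pzRingType.
Hypotheses (RA : artinian (R^o : lmodType R)) (RB : basic_ring R).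
Variable e : idem R.
Hypothesis eS : fpd (lprin_quot (idem_compl e) (jrad R)).
Implicit Types (A B C F K U V W M N Q X Y Z : lmodType R).
Local Notation J := (jrad_pred (R := R)).

Let noeth : noetherian R := basic_artin_noetherian RA RB.

(* The elements of the largest submodule annihilated by e. *)
Definition etors M (x : M) : Prop := forall r : R, (e : R) *: (r *: x) = 0.
Definition tfree M : Prop := forall x : M, etors x -> x = 0.

Lemma etors_map M N (f : {linear M -> N}) (x : M) : etors x -> etors (f x).
Proof. by move=> xt r; rewrite -!linearZ_LR xt linear0. Qed.

Lemma etors_psub M : psub (@etors M).
Proof.
split=> [r|a x y xt yt r]; first by rewrite !scaler0.
by rewrite !scalerDr [r *: (a *: x)]scalerA xt yt addr0.
Qed.

Lemma etorsZ M (x : M) a : etors x -> etors (a *: x).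
Proof. exact: (psubZ (etors_psub M)). Qed.

Lemma etors_killed M (x : M) : etors x -> (e : R) *: x = 0.
Proof. by move=> /(_ 1); rewrite scale1r. Qed.

Lemma killed_pfin M : fgen M -> (forall x : M, (e : R) *: x = 0) -> pfin M.
Proof. by move=> Mg eM; split=> //; apply: (ekilled_fpd RA RB eS). Qed.

Lemma tfree_inadd U Y : tfree U -> inadd U Y -> tfree Y.
Proof.
move=> Ut [I [s [r rs]]] y yt; rewrite -(rs y) big1 // => i _.
by rewrite [s i y](Ut _ (etors_map (s i) yt)) linear0.
Qed.

Section Approx.
Variables (X E : lmodType R) (phi : {linear X -> E}).
Hypothesis phiP : minimal_Pfin_approx phi.

Lemma approx_pfin : pfin X.
Proof. by apply/PfinP; case: phiP => -[]. Qed.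

Lemma approx_lift M (f : {linear M -> E}) : pfin M ->
  exists g : {linear M -> X}, forall x, f x = phi (g x).
Proof. by move=> /PfinP Mp; have [[_ H] _] := phiP; apply: H. Qed.

(* X / Rx has finite projective dimension, so X -> X / Rx followed by a lift of
   X / Rx -> E to X is an automorphism by minimality. *)
Lemma approx_killed (x : X) : etors x -> phi x = 0 -> x = 0.
Proof.
move=> xt px; have [K [j [k [ji jk kP Kg]]]] := cyclic_sub x.
have [Q [q jq]] := ses_coker ji; have [_ qs qE] := jq.
have Kp : pfin K.
  apply: killed_pfin => // y; have [r ->] := kP y; apply: ji.
  by rewrite !linearZ_LR jk xt linear0.
have [|f fP] := factor (f := phi) qs.
  by move=> y /qE[y' ->]; have [r ->] := kP y'; rewrite !linearZ_LR jk px scaler0.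
have [g gP] := approx_lift f (pfin_right jq Kp approx_pfin).
have ub : bijective (g \o q) by have [_ H] := phiP; apply: H => y; rewrite /= -gP fP.
apply: (bij_inj ub); rewrite /= linear0 linear0.
by have /qE -> : exists k, x = j k by [exists k]; rewrite linear0.
Qed.

Section Envelope.
Variables (f : idem R) (iota : {linear simple_top f -> E}).
Hypothesis iotaP : injective_envelope iota.

Lemma top_jrad (s : simple_top f) a : a \in J -> a *: s = 0.
Proof.
have [q [qs qE]] := top_map f; have [r <-] := qs s => aJ.
rewrite -linearZ_LR; apply/qE; apply: jrad_mulr; exact: jrad_mulr.
Qed.

Lemma top_fgen : fgen (simple_top f).
Proof. by have [q [qs qE]] := top_map f; apply: fgen_surj qs (fgen_regular R). Qed.

Lemma envelope_essential (y : E) : y <> 0 ->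
  exists r s, iota s = r *: y /\ s <> 0.
Proof.
move=> y0; have [_ _ ess] := iotaP.
have [|s /mksubP[r rE] s0] := ess (mksub (psub_im (scal_map y))).
  exists y; last exact/eqP.
  by apply/mksubP; exists 1; rewrite /= scale1r.
by exists r, s; split=> //; apply/eqP.
Qed.

(** A nonzero element of E has a nonzero multiple in the simple submodule S_f, and e acts
    injectively on S_f. *)
Lemma envelope_tfree : (e : R) * (f : R) = (f : R) -> tfree E.
Proof.
move=> ef y yt; apply: contrapT => y0; have [r [s [sE s0]]] := envelope_essential y0.
have [q [qs qE]] := top_map f; have [t tE] := qs s.
have tJ : t * (f : R) \notin J by apply/negP => /qE; rewrite tE.
move/negP: (jrad_idem_mull RB ef tJ); apply; rewrite mulrA; apply/qE.
have -> : q ((e : R) * t) = (e : R) *: q t by rewrite -linearZ_LR.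
have [_ ii _] := iotaP; apply: (inj0 ii); rewrite linearZ_LR tE sE.
exact: yt.
Qed.

(** Let I consist of the r with r w in S_f, and let c generate I modulo J. If w is not in S_f, then
    (1 - c) w is nonzero, so some r (1 - c) w is a nonzero element of S_f. But then r (1 - c) lies
    in I, hence in J, and kills w. *)
Lemma envelope_socle (w : E) : (forall a, a \in J -> a *: w = 0) -> exists s, w = iota s.
Proof.
move=> Jw; have [||c [[s0 cE] cP]] := @ideal_cut R RB (fun r => exists s, (r : R) *: w = iota s).
- split=> [|a u v [s sE] [t tE]]; first by exists 0; rewrite scale0r linear0.
  by exists (a *: s + t); rewrite linearP -sE -tE scalerDl -scalerA.
- by move=> a aJ; exists 0; rewrite linear0 Jw.
exists s0; apply: contrapT => ws.
have [|r [s [sE s0']]] := @envelope_essential ((1 - c) *: w).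
  by rewrite scalerBl scale1r cE => /subr0_eq.
apply: s0'; have [_ ii _] := iotaP; apply: (inj0 ii); rewrite sE scalerA Jw //.
have cJ : c * (1 - c) \in J by apply: cP; exists s0.
(* c is idempotent only modulo J, hence the second summand. *)
have -> : r * (1 - c) = r * (1 - c) * (1 - c) + r * (c * (1 - c)).
  by rewrite -mulrA -mulrDr -mulrDl subrK mul1r.
apply: (psubD (psub_jrad R)); last exact: jrad_mull.
by apply: cP; exists s; rewrite -scalerA.
Qed.

Lemma approx_tfree : (e : R) * (f : R) = (f : R) -> tfree X.
Proof.
move=> /envelope_tfree Et x xt; apply: approx_killed => //.
by apply: Et; apply: etors_map.
Qed.

(** The element f r x generates a summand of S_f; its embedding into E extends to M by
    injectivity. *)
Lemma envelope_separates M (x : M) (r : R) :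
  (forall a, a \in J -> a *: x = 0) -> (f : R) *: (r *: x) <> 0 ->
  exists g : {linear M -> E}, g x <> 0.
Proof.
move=> Jx y0; have [K [j [k [ji jk kP Kg]]]] := cyclic_sub ((f : R) *: (r *: x)).
have [|a aJ|s [t ts]] := top_retract RB (f := f) kP.
- by apply: ji; rewrite linearZ_LR jk scalerA idemE.
- by apply: ji; rewrite linearZ_LR jk !scalerA linear0 Jx //; apply: jrad_mulr; apply: jrad_mulr.
have [Einj ii _] := iotaP.
have [g gP] := Einj _ _ j (iota \o s) ji.
exists g => gx; apply: y0; rewrite -jk.
suff -> : k = 0 by rewrite linear0.
by apply: (can_inj ts); apply: ii; rewrite !linear0; apply: etrans (gP k) _; rewrite jk !linearZ_LR gx !scaler0.
Qed.

End Envelope.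
End Approx.

Section Embedding.
Variables (n : nat) (eps : 'I_n -> idem R) (E X : 'I_n -> lmodType R).
Variables (iota : forall i, {linear simple_top (eps i) -> E i}) (phi : forall i, {linear X i -> E i}).
Hypotheses (iotaP : forall i, injective_envelope (iota i)) (phiP : forall i, minimal_Pfin_approx (phi i)).

(** Choose a map h into add(U) with minimal kernel. A nonzero x in the kernel has a nonzero multiple
    annihilated by J, which some map M -> E i does not kill. This map lifts to the approximation X
    i, and adding the lift as a component makes the kernel smaller. *)
Lemma embedding (S : 'I_n -> Prop) U M : pfin M -> (forall i, S i -> inadd U (X i)) ->
  (forall z : M, z <> 0 -> exists i r, S i /\ (eps i : R) *: (r *: z) <> 0) ->
  exists Y (h : {linear M -> Y}), inadd U Y /\ injective h.
Proof.
move=> Mp UX HM; have MA := artinian_fgen RA (proj1 Mp).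
pose Z : lmodType R := dsum (fun _ : 'I_0 => R^o : lmodType R).
have [|L [_ [Y [h [UY LE]]] Lm]] := MA (fun L : M -> Prop => exists Y (h : {linear M -> Y}),
    inadd U Y /\ L = (fun x => h x = 0)).
  exists (fun x => (\0 : {linear M -> Z}) x = 0); split; first exact: (psub_ker (\0 : {linear M -> Z})).
  exists Z, \0; split=> //; exists void, (fun=> \0), (fun=> \0) => y.
  by apply: dsum_ext => -[].
exists Y, h; split=> //; apply: lin_inj => x hx; apply: contrapT => x0.
have [r [z0 Jz]] := jrad_socle RA x0.
have [i [r' [Si y0]]] := HM _ z0.
have [g gz] := envelope_separates (iotaP i) Jz y0.
have [g' g'P] := approx_lift (phiP i) g Mp.
have hL a u v : (h (a *: u + v), g' (a *: u + v)) = a *: (h u, g' u) + (h v, g' v) :> (Y * X i)%type.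
  by rewrite !linearP.
pose h' := lin (fun u => (h u, g' u) : (Y * X i)%type) hL.
have [] : h' x = 0.
  apply: (Lm (fun x => h' x = 0) (psub_ker h')).
  - by exists (Y * X i)%type, h'; split=> //; apply: inadd_prod => //; apply: UX.
  - by move=> u [hu _]; rewrite LE.
  by rewrite LE.
by move=> _ g'x; apply: gz; rewrite linearZ_LR g'P g'x linear0 scaler0.
Qed.

End Embedding.

Section Extension.
Variable U : lmodType R.
Hypotheses (Ut : tfree U) (Uext : forall M, pfin M -> forall i, ext0 i M U).
Hypotheses (eRg : fgen (emod e (R^o : lmodType R) : lmodType (corner e)))
  (eRf : fpd (emod e (R^o : lmodType R) : lmodType (corner e))).
Local Notation "'E' M" := (emod e M : lmodType (corner e)) (at level 8, M at level 0).

Let kill M : fgen M -> (forall x : M, (e : R) *: x = 0) -> fpd M := fun Mg eM => proj2 (killed_pfin Mg eM).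

Lemma emap_uniq M (f g : {linear M -> U}) :
  (forall x : E M, f (emod_val x) = g (emod_val x)) -> f =1 g.
Proof.
move=> fg x; apply/subr0_eq/Ut => r; rewrite -[f x - g x]/((f \- g) x) -!linearZ_LR /=.
by rewrite -(ecutE e (r *: x)) fg subrr.
Qed.

(* Extend over Re M using that U is torsion-free, then over M, since M / Re M is
   annihilated by e and hence Ext^1(M / Re M, U) = 0. *)
Lemma emap_ext M (sigma : {linear E M -> E U}) : fgen M ->
  exists g : {linear M -> U}, forall x : E M, emod_val (sigma x) = g (emod_val x).
Proof.
move=> Mg; have [F [p [PF ps]]] := lprin_cover (emod_fgen eRg Mg).
have [N [q [i [qs ii iE]]]] := image_ex p.
have [h hP] := lprin_map_ext (sigma \o emap e p) PF.
have [|h' h'P] := factor (f := h) qs.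
  move=> x qx; apply: Ut => r; rewrite -!linearZ_LR -(ecutE e (r *: x)) -hP /=.
  suff -> : emap_fun p (ecut e (r *: x)) = 0 by rewrite linear0.
  by apply: emod_ext; rewrite /= iE !linearZ_LR qx linear0 !scaler0.
have [C [c ic]] := ses_coker ii; have [_ cs cE] := ic.
have Cp : pfin C.
  apply: killed_pfin => [|y]; first exact: fgen_surj cs Mg.
  have [x <-] := cs y; rewrite -linearZ_LR; apply/cE.
  have [z /(congr1 (@emod_val R e M)) /= zE] := ps (ecut e x).
  by exists (q (emod_val z)); rewrite -iE.
have [g gP] := ext0_extend ic (Uext Cp 0) h'.
exists g => x; have [y <-] := ps x.
by rewrite emapE iE gP h'P -hP.
Qed.

(** For i = 0, a map eK -> eU comes from K -> U, which extends to F because F / K lies in P^{<oo}.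
    Here K is in P^{<oo} since eK, as a kernel of eF -> eM, has finite projective dimension. *)
Lemma emod_ext0 M i : pfin M -> ext0 i (E M) (E U).
Proof.
elim: i M => [|i IH] M [Mg Mf].
all: have [F [K [j [p [PF ji Kg jp Kf]]]]] := emod_cover noeth kill eRg Mg.
all: have Fp : projective (E F) by
  apply: proj_inadd (emap_inadd e PF); apply: proj_retract (lprin_corner_retract e) _; apply: proj_regular.
all: have Kp : pfin K by split=> //;
  apply: (emod_fpd noeth kill eRg Kg); apply: (fpd_left jp (fpd_proj Fp));
  case: (emod_pfin noeth eRg eRf (conj Mg Mf)).
  apply: (ext0_cover0 jp Fp) => f; have [g gP] := emap_ext f Kg.
  have [Q [q jq]] := ses_coker ji.
  have Qp : pfin Q by apply: pfin_right jq Kp _; apply: pfin_inadd PF (lprin_pfin e).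
  have [g' g'P] := ext0_extend jq (Uext Qp 0) g.
  by exists (emap e g') => k; apply: emod_ext; rewrite /= g'P gP.
exact: ext0_cover jp Fp (IH K Kp).
Qed.

End Extension.
End Torsion.

(** * The strong tilting eRe-module *)
Section CornerTilting.
Variable R : pzRingType.
Hypotheses (RA : artinian (R^o : lmodType R)) (RB : basic_ring R).
Variable e : idem R.
Hypothesis eS : fpd (lprin_quot (idem_compl e) (jrad R)).
Local Notation "'E' M" := (emod e M : lmodType (corner e)) (at level 8, M at level 0).
Hypotheses (eRg : fgen (E (R^o : lmodType R))) (eRf : fpd (E (R^o : lmodType R))).
Variable U : lmodType R.
Hypotheses (Up : pfin U) (Ut : tfree e U) (Uext : forall M, pfin M -> forall i, ext0 i M U).
Hypothesis Uemb : forall M, pfin M -> tfree e M ->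
  exists (Y : lmodType R) (h : {linear M -> Y}), inadd U Y /\ injective h.
Hypothesis bound : exists s, forall M : lmodType R, pfin M -> pd_le s M.
Implicit Types (M N Q V W X Y Z : lmodType R).

Let noeth : noetherian R := basic_artin_noetherian RA RB.
Let kill M : fgen M -> (forall x : M, (e : R) *: x = 0) -> fpd M :=
  fun Mg eM => proj2 (killed_pfin RA RB eS Mg eM).

Lemma tfree_quotient M : pfin M -> exists Q (q : {linear M -> Q}),
  [/\ pfin Q, tfree e Q, forall y, exists x, q x = y & forall x, q x = 0 <-> etors e x].
Proof.
move=> Mp; have [K [j [ji jE]]] := sub_ex (etors_psub e M).
have [Q [q jq]] := ses_coker ji; have [_ qs qE] := jq.
have Kp : pfin K.
  apply: (killed_pfin RA RB eS); first by apply: (noeth ji); case: Mp.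
  move=> x; apply: ji; rewrite linearZ_LR linear0; apply: etors_killed.
  by apply/jE; exists x.
exists Q, q; split=> // [|y|x]; first exact: pfin_right jq Kp Mp; last by rewrite qE jE.
have [x <-] := qs y => yt; apply/qE/jE => r.
have /qE/jE/etors_killed : q ((e : R) *: (r *: x)) = 0 by rewrite !linearZ_LR.
by rewrite scalerA idemE.
Qed.

(** Dividing M by its torsion does not change eM, and the torsion-free quotient embeds into
    add(U). *)
Lemma corner_step M : pfin M -> exists Y M' (j : {linear E M -> E Y}) (p : {linear E Y -> E M'}),
  [/\ ses j p, inadd U Y & pfin M'].
Proof.
move=> Mp; have [Q [q [Qp Qt qs qE]]] := tfree_quotient Mp.
have [Y [h [UY hi]]] := Uemb Qp Qt.
have [M' [p hp]] := ses_coker hi; have [_ ps pE] := hp.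
exists Y, M', (emap e h \o emap e q), (emap e p); split=> //; last first.
  exact: pfin_right hp Qp (pfin_inadd UY Up).
have [hi' ps' pE'] := emap_ses e hp; split=> // [|x].
  apply: lin_inj => x /= /(congr1 (@emod_val R e Y)) /= /(inj0 hi) /qE /etors_killed.
  by rewrite emod_valE => E0; apply: emod_ext.
rewrite pE'; split=> -[k ->]; last by exists (emap e q k).
by have [k' <-] := @emap_surj _ e _ _ _ qs k; exists k'.
Qed.

Lemma corner_pd_bound : exists d, forall M, pfin M -> pd_le d (E M).
Proof.
have [s sP] := bound; have [t tP] := emod_pd_bound noeth eRf.
by exists (t + s)%N => M Mp; apply: tP; [case: Mp|apply: sP].
Qed.

Lemma corner_cores : exists d, forall M (N : lmodType (corner e)), pfin M ->
  mod_iso N (E M) -> cores (E U) d N.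
Proof.
have [d dP] := corner_pd_bound; exists d => M N Mp NM.
apply: (@cores_exist _ _ (fun L : lmodType (corner e) => exists M, pfin M /\ mod_iso L (E M))); last by exists M.
- move=> N' [M' [M'p N'M']] i; apply: ext0_retract (mod_iso_retract N'M') _.
  exact: (emod_ext0 RA RB eS Ut Uext eRg eRf).
- by move=> N' [M' [M'p N'M']] V; apply: ext0_retract (mod_iso_retract N'M') (dP _ M'p V).
move=> N' [M' [M'p [f fb]]]; have [Y [M'' [j [p [[ji ps jpE] UY M''p]]]]] := corner_step M'p.
exists (E Y), (E M''), (j \o f), p; split; last by exists M''; split=> //; exists idfun; exists idfun.
  split=> // [|x]; first by apply: inj_comp => //; apply: bij_inj.
  rewrite jpE; split=> -[k ->]; last by exists (f k).
  by have [g fK gK] := fb; exists (g k); rewrite /= gK.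
exact: emap_inadd.
Qed.

Lemma corner_ext0 (N : lmodType (corner e)) : pfin N -> forall i, ext0 i N (E U).
Proof.
move=> [Ng Nf] i; have [M [f [Mg fb]]] := realize Ng.
have NM : mod_iso N (E M) by apply: mod_iso_sym; exists f.
have Mp : pfin M.
  split=> //; apply: (emod_fpd noeth kill eRg) => //.
  by apply: fpd_retract Nf; apply: mod_iso_retract; exists f.
apply: ext0_retract (mod_iso_retract NM) _.
exact: (emod_ext0 RA RB eS Ut Uext eRg eRf).
Qed.

Lemma corner_strong_tilting : strong_tilting (E U).
Proof.
have UP : pfin (E U) by apply: (emod_pfin noeth eRg eRf).
split; last by move=> N /PfinP Np; apply: ext0_Ext_pos_vanish; apply: corner_ext0.
split; first exact/PfinP; first by apply: ext0_Ext_pos_vanish; apply: corner_ext0.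
(* The regular module eRe is e (R e), and R e lies in P^{<oo}. *)
have [d dP] := corner_cores.
apply: cores_coresolution (dP _ _ (lprin_pfin e) _).
exact: mod_iso_sym (lprin_corner_iso e).
Qed.

(** Two copies of X in eU give matrix units in End(eU). They lift to End(U), with their relations by
    uniqueness of lifts, and yield a summand V x V of U with eV isomorphic to X. *)
Lemma corner_basic W : basic_module (U * W)%type -> basic_module (E U).
Proof.
move=> UWb X Y Xi /mod_iso_sym XY.
have [s [r rs]] := retract_trans (retract_prodl (X * X)%type Y) (mod_iso_retract XY).
pose s1 := s \o inL X X : {linear X -> E U}; pose s2 := s \o inR X X : {linear X -> E U}.
pose r1 := fst \o r : {linear E U -> X}; pose r2 := snd \o r : {linear E U -> X}.
have rs11 x : r1 (s1 x) = x by rewrite /= rs.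
have rs12 x : r1 (s2 x) = 0 by rewrite /= rs.
have rs21 x : r2 (s1 x) = 0 by rewrite /= rs.
have rs22 x : r2 (s2 x) = x by rewrite /= rs.
clearbody s1 s2 r1 r2; clear s r rs.
have Ug : fgen U by case: Up.
(* a, b, c lift the matrix units e11, e12, e21; V is the image of a. *)
have [a aP] := emap_ext RA RB eS Ut Uext eRg (s1 \o r1) Ug.
have [b bP] := emap_ext RA RB eS Ut Uext eRg (s1 \o r2) Ug.
have [c cP] := emap_ext RA RB eS Ut Uext eRg (s2 \o r1) Ug.
have uniq (f g : {linear U -> U}) : (forall x : E U, f (emod_val x) = g (emod_val x)) -> f =1 g.
  exact: emap_uniq.
have aa : a \o a =1 a.
  by apply: uniq => x; rewrite [LHS]/= -!aP [LHS]/= rs11.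
have bc : b \o c =1 a.
  by apply: uniq => x; rewrite [LHS]/= -cP -bP -aP [LHS]/= rs22.
have ac x : a (c x) = 0.
  by apply: (uniq (a \o c) \0) => y; rewrite [LHS]/= -cP -aP [LHS]/= rs12 linear0.
have ba x : b (a x) = 0.
  by apply: (uniq (b \o a) \0) => y; rewrite [LHS]/= -aP -bP [LHS]/= rs21 linear0.
have [V [q [i [qs ii iE]]]] := image_ex a.
have qi x : q (i x) = x.
  by have [y <-] := qs x; apply: ii; rewrite -!iE; apply: aa.
pose S := (i \o fst) \+ (c \o i \o snd) : {linear (V * V)%type -> U}.
have LT x y z : (q (x *: y + z), q (b (x *: y + z))) = x *: (q y, q (b y)) + (q z, q (b z)) :> (V * V)%type.
  by rewrite !linearP.
pose T := lin (fun y : U => (q y, q (b y)) : (V * V)%type) LT.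
have TS x : T (S x) = x.
  case: x => x y; congr pair; rewrite /= !linearD.
    rewrite qi [q (c _)](_ : _ = 0) ?addr0 //.
    by apply: ii; rewrite linear0 -iE ac.
  have [z <-] := qs x; rewrite -iE ba !linear0 add0r.
  by rewrite -[b (c _)]/((b \o c) _) bc iE !qi.
have [K [UK _]] := retract_compl TS.
have Vi : indecomposable V; last first.
  apply: (UWb V (K * W)%type Vi).
  have [f [g fK gK]] := UK.
  have LF x (y z : (U * W)%type) : ((f (x *: y + z).1).1, ((f (x *: y + z).1).2, (x *: y + z).2)) =
      x *: ((f y.1).1, ((f y.1).2, y.2)) + ((f z.1).1, ((f z.1).2, z.2)) :> ((V * V) * (K * W))%type.
    by rewrite /= !linearP.
  exists (lin (fun y : (U * W)%type => ((f y.1).1, ((f y.1).2, y.2)) : ((V * V) * (K * W))%type) LF).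
  exists (fun y => (g (y.1, y.2.1), y.2.2)) => [[x y]|[x [y z]]] /=.
    by rewrite -surjective_pairing fK.
  by rewrite gK.
have Vt : tfree e V.
  apply: tfree_inadd Ut _; apply: retract_inadd.
  exact: retract_trans (retract_prodl V V) (ex_intro _ S (ex_intro _ T TS)).
(* This carries indecomposability from X = eV over to V, whose summands are torsion-free. *)
have zE Z : tfree e Z -> zero_module (E Z) -> zero_module Z.
  move=> Zt Z0 x; apply: Zt => r.
  by have /(congr1 (@emod_val R e Z)) := Z0 (ecut e (r *: x)).
pose f := r1 \o emap e i : {linear E V -> X}; pose g := emap e q \o s1 : {linear X -> E V}.
have fg x : f (g x) = x.
  have -> : f (g x) = r1 (s1 (r1 (s1 x))).
    congr (r1 _); apply: emod_ext; rewrite !emapE -iE.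
    exact: esym (aP (s1 x)).
  by rewrite !rs11.
have gf x : g (f x) = x.
  apply: emod_ext; rewrite !emapE; apply: ii; rewrite -iE.
  rewrite -aP [LHS]/= rs11; apply: etrans (aP (emap e i x)) _.
  by rewrite emapE iE qi.
split=> [V0|Z1 Z2 [h hb]].
  apply: (proj1 Xi) => x; rewrite -(fg x) (_ : g x = 0) ?linear0 //.
  by apply: emod_ext; rewrite [LHS]V0 [RHS]V0.
have [h' hK h'K] := hb; have [k [hk kh]] := bij_lin_inv (can_inj hK) (fun y => ex_intro _ (h' y) (h'K y)).
have ret (Z : lmodType R) : retract Z (Z1 * Z2)%type -> tfree e Z.
  move=> ZZ; apply: tfree_inadd Vt _; apply: retract_inadd; apply: retract_trans ZZ _.
  by exists k, h.
have XZ : mod_iso X (E Z1 * E Z2)%type.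
  have L x (y z : X) : (emap e (fst \o h) (g (x *: y + z)), emap e (snd \o h) (g (x *: y + z))) =
      x *: (emap e (fst \o h) (g y), emap e (snd \o h) (g y)) +
      (emap e (fst \o h) (g z), emap e (snd \o h) (g z)) :> (E Z1 * E Z2)%type.
    by rewrite !linearP.
  exists (lin (fun x : X => (emap e (fst \o h) (g x), emap e (snd \o h) (g x)) : (E Z1 * E Z2)%type) L).
  exists (fun y => f (emap e (k \o inL Z1 Z2) y.1 + emap e (k \o inR Z1 Z2) y.2)) => [x|[y z]].
    rewrite -[RHS]fg; congr (f _); apply: emod_ext => /=; rewrite -linearD -[RHS]hk; congr (k _).
    by rewrite [RHS]surjective_pairing; congr pair; rewrite /= ?addr0 ?add0r.
  rewrite linE gf; congr pair; apply: emod_ext => /=; rewrite -linearD kh /=; rewrite ?addr0 ?add0r //.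
have [_ H] := Xi; have [Z0|Z0] := H _ _ XZ; [left|right]; apply: zE => //; apply: ret.
  exact: retract_prodl.
exact: retract_prodr.
Qed.

End CornerTilting.

(** * The socle of T'' *)
(** If f is an injective endomorphism with minimal image, then f u has the same image, and f
    cancels. *)
Lemma artinian_inj_surj (R : pzRingType) (M : lmodType R) (u : {linear M -> M}) :
  artinian M -> injective u -> forall y, exists x, u x = y.
Proof.
move=> MA ui y.
have [|N [_ [f fi NE] Nm]] := MA (fun N => exists2 f : {linear M -> M}, injective f & N = (fun x => exists w, x = f w)).
  by exists (fun x => exists w, x = idfun w); split; [exact: (psub_im (idfun : {linear M -> M}))|exists idfun].
have [|||w /fi ->] := Nm _ (psub_im (f \o u)) _ _ (f y).
- by exists (f \o u) => //; apply: inj_comp.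
- by move=> x [w ->]; rewrite NE; exists (u w).
- by rewrite NE; exists y.
by exists w.
Qed.

Fixpoint liter (R : pzRingType) (M : lmodType R) (z : {linear M -> M}) (n : nat) : {linear M -> M} :=
  if n is n'.+1 then z \o liter z n' else idfun.

Section Fitting.
Variables (R : pzRingType) (M : lmodType R) (z : {linear M -> M}).
Hypotheses (noeth : noetherian R) (MA : artinian M) (Mg : fgen M).

Lemma literD n m x : liter z (n + m) x = liter z n (liter z m x).
Proof. by elim: n => //= n ->. Qed.

Lemma liter_ker_stable : exists n, forall k x, liter z k x = 0 -> liter z n x = 0.
Proof.
have mono k m x : (k <= m)%N -> liter z k x = 0 -> liter z m x = 0.
  by move=> /subnK <-; rewrite literD => ->; rewrite linear0.
have sK : psub (fun x => exists k, liter z k x = 0).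
  split=> [|a x y [k kx] [m my]]; first by exists 0%N.
  exists (k + m)%N; rewrite linearP (mono _ _ _ (leq_addr m k) kx) (mono _ _ _ (leq_addl k m) my).
  by rewrite scaler0 addr0.
have [K [j [ji jE]]] := sub_ex sK.
have [I [g gP]] := noeth ji Mg.
have /choice[k kP] i : exists k, liter z k (j (g i)) = 0 by apply/jE; exists (g i).
exists (\max_i k i) => m x mx.
have [y ->] : exists y, x = j y by apply/jE; exists m.
have [a ->] := gP y; rewrite !linear_sum big1 // => i _.
by rewrite !linearZ_LR (mono _ _ _ (leq_bigmax i) (kP i)) scaler0.
Qed.

Lemma liter_im_stable : exists n, forall m x, exists y, liter z n x = liter z (n + m) y.
Proof.
have [|N [_ [n NE] Nm]] := @MA (fun N : M -> Prop => exists n, N = (fun x : M => exists w, x = liter z n w)).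
  by exists (fun x : M => exists w, x = liter z 0 w); split; [exact: (psub_im (liter z 0))|exists 0%N].
exists n => m x; apply: (Nm _ (psub_im (liter z (n + m)))).
- by exists (n + m)%N.
- by move=> _ [w ->]; rewrite NE; exists (liter z m w); rewrite literD.
by rewrite NE; exists x.
Qed.

(* Fitting's lemma; N is the summand of M on which z is bijective. *)
Lemma fitting : exists (N : lmodType R) (j : {linear N -> M}) (q : {linear M -> N}),
  [/\ forall x, q (j x) = x, forall x, z (j x) = 0 -> x = 0 &
      zero_module N -> exists n, forall x, liter z n x = 0].
Proof.
have [n1 kerP] := liter_ker_stable; have [n2 imP] := liter_im_stable.
(* The successor makes n positive, so that ker z lies in the kernel of the n-th iterate. *)
pose n := (n1 + n2).+1.
have kerN k x : liter z k x = 0 -> liter z n x = 0.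
  move=> /kerP H; have -> : n = (n2.+1 + n1)%N by rewrite /n addSn addnC.
  by rewrite literD H linear0.
have imN m x : exists y, liter z n x = liter z (n + m) y.
  have nE : n = (n1.+1 + n2)%N by [].
  have [y yE] := imP m x; exists y.
  by rewrite nE -addnA [LHS]literD yE -literD.
have [N [q [j [qs ji jE]]]] := image_ex (liter z n).
have jz x : liter z n (j x) = 0 -> x = 0.
  have [y <-] := qs x; rewrite -jE -literD => /kerN y0.
  by apply: ji; rewrite -jE y0 linear0.
have qji : injective (q \o j).
  by apply: lin_inj => x /= qj0; apply: jz; rewrite jE qj0 linear0.
have qjs y : exists x, (q \o j) x = y.
  have [x <-] := qs y; have [w wE] := imN n x.
  by exists (q w); apply: ji; rewrite /= -!jE -literD.
have [g [gK Kg]] := bij_lin_inv qji qjs.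
exists N, j, (g \o q); split=> [x|x zx|N0]; first exact: gK.
  by apply: jz; rewrite /n -addn1 literD /= zx linear0.
by exists n => x; rewrite jE (N0 (q x)) linear0.
Qed.
End Fitting.

Section SocleOfTilting.
Variable R : pzRingType.
Hypotheses (RA : artinian (R^o : lmodType R)) (RB : basic_ring R).
Variable e : idem R.
Hypothesis eS : fpd (lprin_quot (idem_compl e) (jrad R)).
Local Notation J := (jrad_pred (R := R)).
Variables (p : nat) (eps : 'I_p -> idem R) (E X T : 'I_p -> lmodType R).
Variables (iota : forall i, {linear simple_top (eps i) -> E i}) (phi : forall i, {linear X i -> E i}).
Hypotheses (iotaP : forall i, injective_envelope (iota i)) (phiP : forall i, minimal_Pfin_approx (phi i)).
Hypothesis e_eps : forall i, (e : R) * (eps i : R) = 0.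
Variables (tau : forall i, {linear T i -> X i}) (kap : forall i, {linear simple_top (eps i) -> T i}).
Hypotheses (taui : forall i, injective (tau i)) (kapi : forall i, injective (kap i)).
Variable T1 : lmodType R.
Local Notation T2 := (dsum T : lmodType R).
Local Notation TT := ((T1 * T2)%type : lmodType R).
Hypotheses (Tp : pfin TT) (Text : forall M : lmodType R, pfin M -> forall i, ext0 i M TT).
Hypothesis Temb : forall M : lmodType R, pfin M -> tfree e M ->
  exists (Y : lmodType R) (h : {linear M -> Y}), inadd T1 Y /\ injective h.
Hypothesis Tind : forall W : lmodType R, indecomposable W -> inadd T1 W -> retract W T1.
Hypothesis Tbasic : basic_module TT.
Implicit Types (M N Q V W Y Z : lmodType R).

Let noeth : noetherian R := basic_artin_noetherian RA RB.
Let T2p : pfin T2 := pfin_retract (retract_prodr T1 T2) Tp.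

(* N embeds into add(T1) with cokernel in P^{<oo}; the embedding splits, so N and
   T1 share an indecomposable summand, against basicness of T1 x T2. *)
Lemma tfree_summand_zero N : retract N T2 -> tfree e N -> zero_module N.
Proof.
move=> NT Nt; have Np : pfin N by apply: pfin_retract NT T2p.
have [Y [h [TY hi]]] := Temb Np Nt; have [M [q hq]] := ses_coker hi.
have Mp : pfin M.
  apply: pfin_right hq Np (pfin_inadd TY _).
  exact: pfin_retract (retract_prodl T1 T2) Tp.
have MN : ext0 0 M N.
  apply: (@ext0_inadd_snd _ 0 M TT N); last exact: Text.
  by apply: retract_inadd; apply: retract_trans NT (retract_prodr T1 T2).
have [g gP] := ext0_extend hq MN idfun.
have NT1 : inadd T1 N by apply: inadd_retract TY; exists h, g.
apply: contrapT => N0.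
have [W [Wi WN]] := indecomposable_summand (artinian_fgen RA (proj1 Np)) N0.
have [s1 [r1 rs1]] := Tind Wi (inadd_retract WN NT1).
have [s2 [r2 rs2]] := retract_trans WN NT.
pose s := lin (fun x : (W * W)%type => (s1 x.1, s2 x.2) : TT)
  (fun a x y => f_equal2 pair (linearP s1 a x.1 y.1) (linearP s2 a x.2 y.2)).
pose r := lin (fun x : TT => (r1 x.1, r2 x.2) : (W * W)%type)
  (fun a x y => f_equal2 pair (linearP r1 a x.1 y.1) (linearP r2 a x.2 y.2)).
have [|K [iso _]] := retract_compl (s := s) (r := r); last exact: (Tbasic Wi iso).
by move=> [x y]; rewrite /= rs1 rs2.
Qed.

Definition tops : lmodType R := dsum (fun i => simple_top (eps i) : lmodType R).

Lemma top_etors i (s : simple_top (eps i)) : etors e s.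
Proof.
have [q [qs qE]] := top_map (eps i); have [r <-] := qs s => r'.
rewrite -!linearZ_LR; apply/qE; have := jrad_idem_orth RB (r' * r) (e_eps i).
by rewrite -!mulrA.
Qed.

Lemma tops_etors (s : tops) : etors e s.
Proof. by move=> r; apply: dsum_ext => i; apply: (top_etors (s i)). Qed.

Lemma tops_pfin : pfin tops.
Proof.
apply: (killed_pfin RA RB eS) => [|s]; last exact: (etors_killed (tops_etors s)).
have H i : exists s : simple_top (eps i), forall x, exists r : R, x = r *: s.
  have [q [qs qE]] := top_map (eps i); exists (q 1) => x; have [r <-] := qs x.
  by exists r; rewrite -linearZ_LR /GRing.scale /= mulr1.
pose g i := sval (cid (H i)); have gP i : forall x, exists r : R, x = r *: g i := svalP (cid (H i)).
exists 'I_p, (fun i => dinj (fun i => simple_top (eps i) : lmodType R) i (g i)) => s.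
have /choice[a aP] i : exists r : R, s i = r *: g i by apply: gP.
exists a; rewrite -[LHS](dsum_decomp s); apply: eq_bigr => i _.
by rewrite -linearZ_LR -aP.
Qed.

Lemma kappa_exists : exists kappa : {linear tops -> T2}, forall s i, kappa s i = kap i (s i).
Proof.
have [f fP] := dsum_map (fun i => kap i \o @dproj _ _ (fun i => simple_top (eps i) : lmodType R) i).
by exists f => s i; rewrite fP.
Qed.

Section Kappa.
Variable kappa : {linear tops -> T2}.
Hypothesis kappaE : forall s i, kappa s i = kap i (s i).

Lemma kappa_inj : injective kappa.
Proof.
move=> s t st; apply: dsum_ext => i; apply: (@kapi i).
by rewrite -!kappaE st.
Qed.

(** In each component, phi i is injective on torsion elements and sends those annihilated by J into
    the socle S_i of E i. The copy of S_i in T i is thus mapped injectively to S_i, hence onto it,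
    and leaves no room for further elements. *)
Lemma socle_kappa (y : T2) : etors e y -> (forall a, a \in J -> a *: y = 0) ->
  exists s, y = kappa s.
Proof.
move=> yt Jy.
have H i : exists s, y i = kap i s.
  have yit : etors e (y i) := etors_map (dproj T i) yt.
  have Jyi a : a \in J -> a *: y i = 0.
    by move=> aJ; rewrite -[a *: y i]/((a *: y) i) Jy.
  have [_ ii _] := iotaP i.
  have Jsoc (w : X i) : (forall a, a \in J -> a *: w = 0) -> exists s, phi i w = iota i s.
    by move=> Jw; apply: (envelope_socle RB (iotaP i)) => a aJ; rewrite -linearZ_LR Jw ?linear0.
  have Jk (s : simple_top (eps i)) a : a \in J -> a *: tau i (kap i s) = 0.
    by move=> aJ; rewrite -!linearZ_LR top_jrad ?linear0.
  have [|u uP] := colift (f := phi i \o tau i \o kap i) ii.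
    by move=> s; apply: Jsoc; apply: Jk.
  have kill x : etors e x -> phi i x = 0 -> x = 0 by exact: (approx_killed RA RB eS (phiP i)).
  have ui : injective u.
    apply: lin_inj => s us; apply: (@kapi i); apply: (@taui i).
    rewrite [in RHS]linear0 linear0; apply: kill; first by do 2 apply: etors_map; apply: top_etors.
    by rewrite -[LHS]uP us linear0.
  have topA : artinian (simple_top (eps i)) by apply: artinian_fgen RA (top_fgen _).
  have us := artinian_inj_surj topA ui.
  have [|s sE] := Jsoc (tau i (y i)).
    by move=> a aJ; rewrite -linearZ_LR Jyi ?linear0.
  have [s' s'E] := us s; exists s'; apply: (@taui i); apply/subr0_eq/kill.
    by apply: (psubB (etors_psub e _)); apply: etors_map => //; apply: etors_map; apply: top_etors.
  by rewrite linearB sE -s'E uP subrr.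
by exists (fun i => sval (cid (H i))); apply: dsum_ext => i; rewrite kappaE; apply: svalP (cid (H i)).
Qed.

Lemma kappa_nilpotent (z : {linear T2 -> T2}) : (forall s, z (kappa s) = 0) ->
  exists n, forall x, liter z n x = 0.
Proof.
move=> zk; have T2A := artinian_fgen RA (proj1 T2p).
have [N [j [q [qj zj N0]]]] := fitting z noeth T2A (proj1 T2p).
apply: N0; apply: tfree_summand_zero; first by exists j, q.
move=> x xt; apply: contrapT => x0; have [r [rx Jrx]] := jrad_socle RA x0.
have [||s sE] := socle_kappa (y := j (r *: x)).
- by apply: etors_map; apply: etorsZ.
- by move=> a aJ; rewrite -linearZ_LR Jrx ?linear0.
by apply: rx; apply: zj; rewrite sE zk.
Qed.

Local Notation Gam := (endo TT).
Local Notation At := (Gam^c).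

(** If x is nonzero on S'', there are t in S'' and w = x t <> 0 such that w |-> t defines a map on R
    w. It extends to an endomorphism a of T, as Ext^1(T / R w, T) = 0. Then 1 - a x kills t,
    although it is invertible. *)
Lemma jrad_kappa (x : At) : x \in jrad_pred (R := At) ->
  forall s, (x : Gam) (inR T1 T2 (kappa s)) = 0.
Proof.
move=> xJ s; apply: contrapT => xs.
pose k : {linear tops -> TT} := inR T1 T2 \o kappa.
have [i wi] : exists i, (x : Gam) (k (dinj (fun i => simple_top (eps i) : lmodType R) i (s i))) <> 0.
  apply: contrapT => H; apply: xs; rewrite -(dsum_decomp s) !linear_sum big1 // => i _.
  by apply: contrapT => H'; apply: H; exists i.
have [q [qs qE]] := top_map (eps i).
pose ki : {linear simple_top (eps i) -> TT} := k \o dinj (fun i => simple_top (eps i) : lmodType R) i.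
pose w := (x : Gam) (ki (q 1)).
have qZ (r : R) : q r = r *: q 1 by rewrite -linearZ_LR /GRing.scale /= mulr1.
have w0 : w <> 0.
  move=> w0; apply: wi; have [r rE] := qs (s i).
  by rewrite -[X in _ X = _]/(ki (s i)) -rE qZ !linearZ_LR -/w w0 scaler0.
have Jw a : a \in J -> a *: w = 0.
  by move=> aJ; rewrite /w -2!linearZ_LR top_jrad ?linear0.
(* The factor 1 - c in t below leaves x t = w unchanged and makes every annihilator of w annihilate
   t. *)
have [c [/= cw cP]] := ideal_cut RB (psub_ker (scal_map w)) Jw.
have xw : (x : Gam) (ki (q (1 - c))) = w.
  by rewrite qZ !linearZ_LR -/w scalerBl scale1r cw subr0.
have [K [j [kk [ji jk kP Kg]]]] := cyclic_sub w.
have [Q [pr jpr]] := ses_coker ji.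
have Kp : pfin K.
  apply: (killed_pfin RA RB eS) => // y; have [r ->] := kP y; apply: ji.
  have wt : etors e w.
    apply: (etors_map (endo_fun (x : Gam))); apply: (etors_map ki); exact: top_etors.
  by rewrite !linearZ_LR jk linear0 wt.
set t := ki (q (1 - c)) in xw.
have [||f fP] := factor (q := scal_map kk) (f := scal_map t).
- by move=> y; have [r ->] := kP y; exists r.
- move=> r /= rk; rewrite /t -!linearZ_LR (_ : q _ = 0) ?linear0 //.
  apply/qE; apply: jrad_mulr; apply: cP.
  by rewrite -jk -linearZ_LR rk linear0.
have [a aP] := ext0_extend jpr (Text (pfin_right jpr Kp Tp) 0) f.
have aw : a w = t by rewrite -jk aP; have := fP 1; rewrite /= !scale1r.
(* Products in At are reversed: the radical element x a of At is the composite of x followed by a,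
   and u is composed after 1 - a x. *)
have [u [_ uP]] := jrad_unit (jrad_mulr (Endo a : At) xJ).
have E1 : (u : Gam) (t - a ((x : Gam) t)) = t := congr1 (fun f : Gam => f t) uP.
apply: w0; rewrite -xw -E1 xw aw subrr; by rewrite !linear0.
Qed.

Lemma endo_nilpotent (x : Gam) : (forall s, x (inR T1 T2 (kappa s)) = 0) ->
  (forall y, x (inL T1 T2 y) = 0) -> exists n, x ^+ n = 0.
Proof.
move=> xk xl; pose h : {linear T2 -> TT} := x \o inR T1 T2.
pose z : {linear T2 -> T2} := snd \o h.
have xE y : x y = h y.2.
  case: y => y1 y2; rewrite [RHS]/= -[RHS]add0r -(xl y1) -linearD; congr (x _).
  by congr pair; rewrite /= ?addr0 ?add0r.
have [n nP] : exists n, forall y, liter z n y = 0.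
  by apply: kappa_nilpotent => s; rewrite /= xk.
exists n.+1; apply: endoP => y.
have E1 : forall k, (x ^+ k.+1) y = h (liter z k y.2).
  elim=> [|k IH]; first by rewrite expr1 xE.
  by rewrite exprS -[LHS]/(x ((x ^+ k.+1) y)) IH xE.
by rewrite E1 nP linear0.
Qed.

(** Radical membership in the opposite ring asks for a right inverse of 1 - x b, while nilpotency is
    available for b x. *)
Lemma one_sub_swap (S : pzRingType) (x b w : S) : (1 - b * x) * w = 1 ->
  (1 - x * b) * (1 + x * w * b) = 1.
Proof.
move=> H; have E1 : x * w * b - x * b * (x * w * b) = x * b.
  by rewrite -[in RHS](mulr1 x) -H mulrBl mul1r mulrBr mulrBl !mulrA.
rewrite mulrBl mul1r mulrDr mulr1 opprD [- (x * b) - _]addrC addrA.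
by rewrite -[1 + _ - _]addrA E1 addrK.
Qed.

(** With f the projection onto T'', every composite b r f vanishes on T' and on S'', hence is
    nilpotent. *)
Lemma jrad_of_kappa (r : Gam) : (forall s, r (inR T1 T2 (kappa s)) = 0) ->
  (r * (1 - idem_val (summand_proj T1 T2)) : At) \in jrad_pred (R := At).
Proof.
move=> rk; set f : Gam := 1 - _; apply/jradP => b0; pose b : Gam := b0.
have fE y : f y = inR T1 T2 y.2.
  case: y => y1 y2; rewrite -[LHS]/((y1, y2) - (y1, 0)); congr pair; rewrite /= ?subrr //.
  by rewrite oppr0 addr0.
have [||n xn] := @endo_nilpotent (b * (r * f) : Gam).
- by move=> s; rewrite -[LHS]/(b (r (f (inR T1 T2 (kappa s))))) fE /= rk linear0.
- by move=> y; rewrite -[LHS]/(b (r (f (inL T1 T2 y)))) fE /= !linear0.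
pose x : Gam := b * (r * f).
have [w wP] : exists w : Gam, (1 - x) * w = 1.
  exists (\sum_(i < n) x ^+ i); apply: oppr_inj.
  by rewrite -mulNr opprB -subrX1 xn sub0r.
exists (1 + (r * f) * w * b : Gam).
exact: (@one_sub_swap Gam (r * f) b w wP).
Qed.

End Kappa.
End SocleOfTilting.

(** * The endomorphism ring of T *)
Definition rmorph_of (R S : pzRingType) (f : R -> S) (fB : forall x y, f (x - y) = f x - f y)
    (f1 : f 1 = 1) (fM : forall x y, f (x * y) = f x * f y) : {rmorphism R -> S} :=
  HB.pack f (GRing.isZmodMorphism.Build R S f fB) (GRing.isMonoidMorphism.Build R S f (f1, fM)).

(** A right module over End(T)^op is a left module over the double opposite, that is, over End(T);
    through this map Hom(-, T) becomes such a module. *)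
Definition opp_opp_rmorph (R : pzRingType) : {rmorphism (R^c)^c -> R} :=
  rmorph_of (f := (fun x => x) : (R^c)^c -> R) (fun x y => erefl) erefl (fun x y => erefl).

Lemma submod_valZ (R : pzRingType) (V : lmodType R) (S : submodule V) a (x : submod S) :
  submod_val (a *: x) = a *: submod_val x.
Proof. by []. Qed.

Lemma submod_valD (R : pzRingType) (V : lmodType R) (S : submodule V) (x y : submod S) :
  submod_val (x + y) = submod_val x + submod_val y.
Proof. by []. Qed.

Section TopResolution.
Variable R : pzRingType.
Variables (T1 T2 S : lmodType R) (kappa : {linear S -> T2}).
Local Notation TT := ((T1 * T2)%type : lmodType R).
Local Notation At := ((endo TT)^c).
Local Notation f := (idem_conv (idem_compl (idem_conv (summand_proj T1 T2)) : idem At)).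
Hypotheses (kext : forall h : {linear S -> TT}, exists g : {linear T2 -> TT}, forall s, g (kappa s) = h s)
  (Jk : forall x : endo TT, (x : At) \in jrad_pred (R := At) -> forall s, x (inR T1 T2 (kappa s)) = 0)
  (kJ : forall r : endo TT, (forall s, r (inR T1 T2 (kappa s)) = 0) ->
     (r * (1 - idem_val (summand_proj T1 T2)) : At) \in jrad_pred (R := At)).

(* The top of the projective module Hom(T2, TT) is Hom(S, TT). *)
Lemma top_quot_retract :
  retract (lprin_quot f (jrad_conv At)) (hommod (opp_opp_rmorph (endo TT)) S).
Proof.
pose H : lmodType (At^c) := hommod (opp_opp_rmorph (endo TT)) S.
have [q [qs qE]] := lprin_quot_map f (jrad_conv At).
pose k : {linear S -> TT} := inR T1 T2 \o kappa.
have L (a : At^c) (x y : (At^c)^o) :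
    HomMod (opp_opp_rmorph (endo TT)) ((endo_fun (a *: x + y : At^c) : {linear TT -> TT}) \o k) =
    a *: (HomMod (opp_opp_rmorph (endo TT)) ((endo_fun (x : At^c) : {linear TT -> TT}) \o k) : H) +
      HomMod (opp_opp_rmorph (endo TT)) ((endo_fun (y : At^c) : {linear TT -> TT}) \o k).
  exact: hommodP.
pose rho := lin (fun x : (At^c)^o => HomMod (opp_opp_rmorph (endo TT))
   ((endo_fun (x : At^c) : {linear TT -> TT}) \o k) : H) L.
have rhos y : exists x, rho x = y.
  have [g gP] := kext y.
  exists (Endo (g \o snd)); apply: hommodP => s; exact: gP.
have rho0 (x : (At^c)^o) : rho x = 0 <-> forall s, (x : endo TT) (k s) = 0.
  split=> [E s|H0]; last exact: hommodP.
  exact: (congr1 (fun h : H => h s) E).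
have fk s : (idem_val f : endo TT) (k s) = k s.
  rewrite -[LHS]/((0, kappa s) - (0, 0)); congr pair; rewrite /= ?subr0 //.
have [|u uP] := factor (f := rho) qs.
  move=> r /qE[x xJ rx]; apply/rho0 => s.
  have := congr1 (fun h : endo TT => h (k s)) rx.
  rewrite -[X in X = _]/((r : endo TT) ((idem_val f : endo TT) (k s))).
  rewrite -[X in _ = X]/((x : endo TT) ((idem_val f : endo TT) (k s))) !fk => ->.
  exact: Jk.
have [|v vP] := factor (f := q) rhos.
  move=> r /rho0 rk; apply/qE; exists (r * (idem_val f : At^c)); last first.
    by rewrite -mulrA (idemE f).
  exact: kJ.
by exists u, v => x; have [r <-] := qs x; rewrite uP vP.
Qed.

End TopResolution.

Section CornerIso.
Variables (R : pzRingType) (e : idem R) (T1 T2 : lmodType R).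
Local Notation TT := ((T1 * T2)%type : lmodType R).
Local Notation At := ((endo TT)^c).
Local Notation et := (idem_conv (summand_proj T1 T2) : idem At).
Local Notation "'E' M" := (emod e M : lmodType (corner e)) (at level 8, M at level 0).
Hypotheses (uniq : forall (M : lmodType R) (f g : {linear M -> T1}),
    (forall x : E M, f (emod_val x) = g (emod_val x)) -> f =1 g)
  (ext : forall (M : lmodType R) (h : {linear E M -> E T1}), fgen M ->
    exists g : {linear M -> T1}, forall x : E M, emod_val (h x) = g (emod_val x))
  (T1g : fgen T1) (T2g : fgen T2).

Definition corner_restr (x : corner et) : {linear T1 -> T1} :=
  fst \o endo_fun (corner_val x : endo TT) \o inL T1 T2.

Lemma corner_restrE (x : corner et) t :
  (corner_val x : endo TT) t = inL T1 T2 (corner_restr x t.1).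
Proof.
have /(congr1 (fun h : endo TT => h t)) := eqP (corner_valP x).
by move=> <-.
Qed.

Definition corner_endo (x : corner et) : endo (E T1) := Endo (emap e (corner_restr x)).

Lemma corner_endoB x y : corner_endo (x - y) = corner_endo x - corner_endo y.
Proof. by apply: endoP => u; apply: emod_ext. Qed.

Lemma corner_endo1 : corner_endo 1 = 1.
Proof. by apply: endoP => u; apply: emod_ext. Qed.

(** The order is reversed because the corner multiplies in the opposite ring. *)
Lemma corner_endoM x y : corner_endo (x * y) = corner_endo y * corner_endo x.
Proof.
apply: endoP => u; apply: emod_ext.
rewrite -[LHS]/((corner_val y : endo TT) ((corner_val x : endo TT) (inL T1 T2 (emod_val u)))).1.
by rewrite [(corner_val x : endo TT) _]corner_restrE.
Qed.

Definition corner_iso : {rmorphism corner et -> (endo (E T1))^c} :=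
  rmorph_of (f := corner_endo : corner et -> (endo (E T1))^c) corner_endoB corner_endo1 corner_endoM.

Definition corner_iso_opp : {rmorphism (corner et)^c -> endo (E T1)} :=
  rmorph_of (f := corner_endo : (corner et)^c -> endo (E T1)) corner_endoB corner_endo1
    (fun x y => corner_endoM y x).

Lemma corner_endo_bij : bijective corner_endo.
Proof.
have inj : injective corner_endo.
  move=> x y E0; apply: val_inj; apply: endoP => t; rewrite !corner_restrE; congr (inL _ _ _).
  apply: uniq => u.
  exact: (congr1 (fun h : endo (E T1) => emod_val (h u)) E0).
have surj : forall y, exists x, corner_endo x = y.
  move=> y; have [g gP] := ext y T1g.
  pose x : endo TT := Endo (inL T1 T2 \o g \o fst).
  have xP : (x : At) \in corner_pred et by rewrite unfold_in; apply/eqP/endoP.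
  exists (Corner xP); apply: endoP => u; apply: emod_ext; rewrite gP.
  by [].
have [h hP] := choice surj.
by exists h => // x; apply: inj; rewrite hP.
Qed.

(** The elements on the left are the endomorphisms of T that vanish on T' ([enl]) and take values in
    T' ([enr]), that is, Hom(T'', T') = Hom(eT'', eT'). *)
Lemma right_corner_retract :
  retract (mode et (lprin (idem_conv (idem_compl et))) : lmodType (corner et)^c)
    (hommod corner_iso_opp (E T2)).
Proof.
pose L0 := lprin (idem_conv (idem_compl et)).
pose H : lmodType ((corner et)^c) := hommod corner_iso_opp (E T2).
pose en (x : mode et L0) : endo TT := submod_val (mode_val x).
have enl x t : en x t = en x (inR T1 T2 t.2).
  have /(congr1 (fun h : endo TT => h t)) := eqP (submod_valP (mode_val x)).
  move=> <-; case: t => t1 t2.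
  rewrite -[LHS]/(en x ((t1, t2) - (t1, 0))); congr (en x _).
  by congr pair; rewrite /= ?subrr // oppr0 addr0.
have enr x t : en x t = inL T1 T2 (en x t).1.
  have E0 := congr1 (@submod_val _ _ _) (eqP (mode_valP x)).
  rewrite submod_valZ in E0.
  have E1 : (idem_val (summand_proj T1 T2) : endo TT) * en x = en x by apply: E0.
  by rewrite -{1}E1.
have enL (a : (corner et)^c) (x y : mode et L0 : lmodType (corner et)^c) :
    en (a *: x + y) = (corner_val a : endo TT) * en x + en y.
  rewrite /en.
  have -> : mode_val (a *: x + y) = ((corner_val a : At) : At^c) *: mode_val x + mode_val y by [].
  by rewrite submod_valD submod_valZ.
pose res (x : mode et L0) : {linear T2 -> T1} := fst \o endo_fun (en x) \o inR T1 T2.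
have L (a : (corner et)^c) (x y : mode et L0 : lmodType (corner et)^c) :
    HomMod corner_iso_opp (emap e (res (a *: x + y))) =
    a *: (HomMod corner_iso_opp (emap e (res x)) : H) + HomMod corner_iso_opp (emap e (res y)).
  apply: hommodP => u; apply: emod_ext.
  rewrite -[LHS]/(en (a *: x + y) (inR T1 T2 (emod_val u))).1 enL.
  rewrite -[LHS]/((corner_val a : endo TT) (en x (inR T1 T2 (emod_val u))) + en y (inR T1 T2 (emod_val u))).1.
  by rewrite enr.
pose s := lin (fun x : (mode et L0 : lmodType (corner et)^c) => HomMod corner_iso_opp (emap e (res x)) : H) L.
have si : injective s.
  move=> x y E0; apply: val_inj; apply: val_inj; apply: endoP => t.
  rewrite -[LHS]/(en x t) -[RHS]/(en y t) enr enl [RHS]enr [in RHS]enl; congr (inL _ _ _).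
  apply: (uniq (f := res x) (g := res y)) => u.
  exact: (congr1 (fun h : H => emod_val (h u)) E0).
have ss y : exists x, s x = y.
  have [g gP] := ext y T2g.
  pose x : endo TT := Endo (inL T1 T2 \o g \o snd).
  have xP : (x : (At^c)^o) \in lprin_pred (idem_conv (idem_compl et)).
    rewrite unfold_in; apply/eqP/endoP => -[t1 t2].
    rewrite -[LHS]/(inL T1 T2 (g (t2 - 0))) subr0 //.
  pose x1 : L0 := @Submod _ _ (Submodule (lprin_submod_closed _)) _ xP.
  have x1P : x1 \in mode_pred et (M := L0).
    by rewrite unfold_in; apply/eqP; apply: val_inj; apply: endoP.
  exists (Mode x1P); apply: hommodP => u; apply: emod_ext; rewrite gP.
  by [].
have [r [sr _]] := bij_lin_inv si ss.
by exists s, r.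
Qed.

End CornerIso.

(** * Finiteness of eA and assembly of the proof *)

(** Scalars from k are central, so e (a g) = (e a e) (e g) and the generators of A over k give
    generators e g of eA. *)
Lemma emod_regular_fgen (k : comNzRingType) (A : algType k) (e : idem A) :
  artin_algebra A -> fgen (emod e (A^o : lmodType A) : lmodType (corner e)).
Proof.
move=> [_ /fin_genP[I [g gP]]]; exists I, (fun i => ecut e (g i : A^o)) => x.
have [a aE] := gP (emod_val x); exists (fun i => ecorner e ((a i)%:A)).
apply: emod_ext; rewrite emod_val_sum -[LHS]emod_valE.
transitivity (idem_val e * \sum_i a i *: g i); first exact: (congr1 (fun y : A => idem_val e * y) aE).
rewrite mulr_sumr; apply: eq_bigr => i _.
rewrite -[RHS]/(idem_val e * (a i)%:A * idem_val e * (idem_val e * g i)).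
by rewrite -scalerAr mulr_algr -!scalerAl !mulrA !idemE.
Qed.

Lemma regular_lprin_retract (R : pzRingType) (e : idem R) :
  retract (R^o : lmodType R) (lprin e * lprin (idem_compl e))%type.
Proof.
pose c := idem_compl e.
have L a (x y : R^o) : (scal_map (lprin_one e) (a *: x + y), scal_map (lprin_one c) (a *: x + y)) =
   a *: (scal_map (lprin_one e) x, scal_map (lprin_one c) x) +
   (scal_map (lprin_one e) y, scal_map (lprin_one c) y) :> (lprin e * lprin c)%type.
  by rewrite !linearP.
have L' a (x y : (lprin e * lprin c)%type) :
    (submod_val (a *: x + y).1 + submod_val (a *: x + y).2 : R^o) =
    a *: (submod_val x.1 + submod_val x.2 : R^o) + (submod_val y.1 + submod_val y.2).
  rewrite -[LHS]/((a *: submod_val x.1 + submod_val y.1) + (a *: submod_val x.2 + submod_val y.2)).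
  by rewrite scalerDr addrACA.
exists (lin (fun x : R^o => (scal_map (lprin_one e) x, scal_map (lprin_one c) x) : (lprin e * lprin c)%type) L).
exists (lin (fun x : (lprin e * lprin c)%type => submod_val x.1 + submod_val x.2 : R^o) L') => x.
rewrite -[LHS]/(x * (e : R) + x * (1 - (e : R)) : R).
by rewrite -mulrDr addrC subrK mulr1.
Qed.

Lemma emod_regular_fpd (R : pzRingType) (e : idem R) :
  fpd (emod e (lprin (idem_compl e)) : lmodType (corner e)) ->
  fpd (emod e (R^o : lmodType R) : lmodType (corner e)).
Proof.
move=> cf; apply: fpd_retract (emap_retract e (regular_lprin_retract e)) _.
have [j [p jp]] := ses_prod (lprin e) (lprin (idem_compl e)).
apply: (fpd_mid (emap_ses e jp)) => //; apply: fpd_proj.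
by apply: proj_retract (lprin_corner_retract e) _; apply: proj_regular.
Qed.

Theorem theorem5p4 (k : comNzRingType) (A : algType k) (e : idem A)
    (m p : nat) (eps : 'I_(m + p) -> idem A)
    (E X T : 'I_(m + p) -> lmodType A)
    (iota : forall i, {linear simple_top (eps i) -> E i})
    (phi : forall i, {linear X i -> E i}) :
  artin_algebra A ->
  basic_ring A ->
  finite_pdim (lprin_quot (idem_compl e) (jrad A)) ->
  finite_pdim (emod e (lprin (idem_compl e)) : lmodType (corner e)) ->
  Pfin_contravariantly_finite (corner e) ->
  idem_splitting e eps ->
  (forall i, injective_envelope (iota i)) ->
  (forall i, minimal_Pfin_approx (phi i)) ->
  tilting_decomposition T eps X ->
  let T1 : lmodType A := T_left T in
  let T2 : lmodType A := T_right T in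
  let TT : lmodType A := (T1 * T2)%type in
  basic_strong_tilting TT ->
  let At : pzRingType := (endo TT)^c in
  let et : idem At := idem_conv (summand_proj T1 T2) in
  let eT1 : lmodType (corner e) := emod e T1 in
  let B : pzRingType := (endo eT1)^c in
  [/\ basic_strong_tilting eT1,
      exists psi : {rmorphism corner et -> B},
        bijective psi /\
        (* psi is k-linear *)
        forall (c : k) (f g : corner et),
          (forall t, (corner_val g : endo TT) t
                     = c%:A *: (corner_val f : endo TT) t) ->
          forall u : eT1, emod_val ((psi g : endo eT1) u)
                     = c%:A *: emod_val ((psi f : endo eT1) u),
      finite_pdim (lprin_quot (idem_conv (idem_compl et)) (jrad_conv At)) &
      finite_pdim (mode et (lprin (idem_conv (idem_compl et)))
                   : lmodType (corner et)^c)].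
Proof.
move=> AA RB /finite_pdimP eS /finite_pdimP cf _ [_ orth eE cE] iotaP phiP [Tl _ Tlind Tr] T1 T2 TT.
move=> [[[/PfinP TTp _ TTcor] TTs] TTb] At et eT1 B.
have RA := artin_algebra_artinian AA.
have noeth := basic_artin_noetherian RA RB.
have eRg := emod_regular_fgen e AA.
have eRf := emod_regular_fpd cf.
have TText (M : lmodType A) : pfin M -> forall i, ext0 i M TT.
  by move=> /PfinP Mp; apply: Ext_pos_vanish_ext0; apply: TTs.
have [s bound] := findim_bound noeth TTcor TText.
have T1r : retract T1 TT := retract_prodl T1 T2.
have T2r : retract T2 TT := retract_prodr T1 T2.
have Tlr i : retract (T (lshift p i)) T1.
  by exists (dinj _ i), (dproj _ i) => x; apply: dinj_in.
have Trr j : retract (T (rshift m j)) T2.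
  by exists (dinj _ j), (dproj _ j) => x; apply: dinj_in.
have e_left i : idem_val e * idem_val (eps (lshift p i)) = idem_val (eps (lshift p i)).
  rewrite eE mulr_suml (bigD1 i) //= big1 ?addr0 ?idemE // => j ji.
  by apply: orth; rewrite (inj_eq (@lshift_inj _ _)).
have e_right j : idem_val e * idem_val (eps (rshift m j)) = 0.
  by rewrite eE mulr_suml big1 // => i _; apply: orth; rewrite eq_lrshift.
pose AL : lmodType A := dsum (fun i : 'I_m => X (lshift p i)).
have ALt : tfree e AL.
  move=> x xt; apply: dsum_ext => i.
  apply: (approx_tfree RA RB eS (phiP (lshift p i)) (iotaP (lshift p i)) (e_left i)).
  exact: (etors_map (dproj _ i) xt).
have T1AL : inadd AL T1.
  by apply: inadd_dsum => i; apply/in_addP; case: (Tl i).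
have T1t : tfree e T1 := tfree_inadd ALt T1AL.
have Xart i : artinian (X i).
  by apply: (artinian_fgen RA); case: (approx_pfin (phiP i)).
have ALind (W : lmodType A) : indecomposable W -> inadd AL W -> retract W T1.
  move=> Wi /in_addP /(Tlind _ Wi)[i Wiso].
  exact: retract_trans (mod_iso_retract Wiso) (Tlr i).
(* X i decomposes into indecomposables of add(AL), each isomorphic to some T j with j <= m. *)
have XL i : inadd T1 (X (lshift p i)).
  apply: (indecomposable_inadd (A := AL)) => //.
    by move=> W Wi /(ALind _ Wi) /retract_inadd.
  apply: retract_inadd; exists (dinj (fun i : 'I_m => X (lshift p i)) i), (dproj _ i) => x.
  exact: dinj_in.
have TTX i : inadd TT (X i).
  case: (split_ordP i) => [l ->|j ->].
    exact: inadd_trans (retract_inadd T1r) (XL l).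
  have [_ _ [U [/in_addP TU XU]]] := Tr j.
  apply: inadd_retract (mod_iso_retract XU) _; apply: inadd_prod.
    exact: inadd_trans (retract_inadd T2r) (retract_inadd (Trr j)).
  exact: inadd_trans (retract_inadd T1r) TU.
have T1emb (M : lmodType A) : pfin M -> tfree e M ->
    exists (Y : lmodType A) (h : {linear M -> Y}), inadd T1 Y /\ injective h.
  move=> Mp Mt; apply: (embedding RA RB iotaP phiP (S := fun i => exists l, i = lshift p l)) => //.
    by move=> _ [l ->].
  (* Since z is not torsion, some e r z is nonzero, and e is the sum of the first m idempotents. *)
  move=> z z0; apply: contrapT => H; apply/z0/Mt => r.
  rewrite eE scaler_suml big1 // => l _; apply: contrapT => H'.
  by apply: H; exists (lshift p l), r; split=> //; exists l.
have TTemb (M : lmodType A) : pfin M ->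
    exists (Y : lmodType A) (h : {linear M -> Y}), inadd TT Y /\ injective h.
  move=> Mp; apply: (embedding RA RB iotaP phiP (S := fun=> True)) => //.
  move=> z z0; apply: contrapT => H; apply: z0.
  have -> : z = \sum_i idem_val (eps i) *: (1 *: z).
    rewrite -scaler_suml scale1r big_split_ord /= -eE -cE.
    by rewrite addrC subrK scale1r.
  by rewrite big1 // => i _; apply: contrapT => H'; apply: H; exists i, 1.
have T1p : pfin T1 := pfin_retract T1r TTp.
have T2p : pfin T2 := pfin_retract T2r TTp.
have T1ext (M : lmodType A) : pfin M -> forall i, ext0 i M T1.
  by move=> Mp i; apply: ext0_inadd_snd (retract_inadd T1r) (TText M Mp i).
have TTcores (M : lmodType A) : pfin M -> cores TT s M.
  apply: cores_exist => // N Np.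
  have [Y [h [TY hi]]] := TTemb N Np; have [Q [q hq]] := ses_coker hi.
  by exists Y, Q, h, q; split=> //; apply: pfin_right hq Np (pfin_inadd TY TTp).
have uniq (M : lmodType A) (f g : {linear M -> T1}) : _ := @emap_uniq A e T1 T1t M f g.
have ext (M : lmodType A) (h : {linear _ -> _}) (Mg : fgen M) :=
  emap_ext RA RB eS T1t T1ext eRg h Mg.
have cbij := @corner_endo_bij A e T1 T2 uniq ext (proj1 T1p).
split.
- split; last by apply: (corner_basic RA RB eS eRg T1p T1t T1ext TTb).
  apply: (corner_strong_tilting RA RB eS eRg eRf T1p T1t T1ext T1emb).
  by exists s.
- exists (corner_iso e T1 T2); split; first exact: cbij.
  move=> c f g fg u.
  by have /(congr1 fst) := fg (inL T1 T2 (emod_val u)).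
- have tau j : exists t : {linear T (rshift m j) -> X (rshift m j)}, injective t.
    have [_ _ [U [_ XU]]] := Tr j.
    have [t [r tr]] := retract_trans (retract_prodl (T (rshift m j)) U) (mod_iso_retract (mod_iso_sym XU)).
    by exists t; apply: can_inj tr.
  have kap j : exists t : {linear simple_top (eps (rshift m j)) -> T (rshift m j)}, injective t.
    by case: (Tr j).
  pose ta j := sval (cid (tau j)); pose ka j := sval (cid (kap j)).
  have tai j : injective (ta j) := svalP (cid (tau j)).
  have kai j : injective (ka j) := svalP (cid (kap j)).
  pose epsr j := eps (rshift m j).
  have [kappa kappaE] := kappa_exists ka.
  have Tind (W : lmodType A) : indecomposable W -> inadd T1 W -> retract W T1.
    by move=> Wi TW; apply: ALind => //; apply: inadd_trans TW.
  have Sp := tops_pfin RA RB eS e_right.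
  apply/finite_pdimP.
  (* T'' / S'' lies in P^{<oo}, so Ext^1(T'' / S'', T) = 0. *)
  have kext (h : {linear tops epsr -> TT}) : exists g : {linear T2 -> TT}, forall s, g (kappa s) = h s.
    have [Q [q kq]] := ses_coker (kappa_inj kai kappaE).
    exact: (ext0_extend kq (TText Q (pfin_right kq Sp T2p) 0) h).
  have Jk := jrad_kappa RA RB eS e_right TTp TText kappa.
  have kJ := jrad_of_kappa RA RB eS (fun j => iotaP (rshift m j)) (fun j => phiP (rshift m j)) e_right tai kai TTp TText T1emb Tind TTb kappaE.
  apply: fpd_retract (top_quot_retract kext Jk kJ) _.
  (* S'' lies in P^{<oo}, so it has a coresolution by add(T), which Hom(-, T) turns into a
     projective resolution of Hom(S'', T). *)
  exists s; apply: hom_cores_pd; last exact: TTcores.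
  by exists id.
apply/finite_pdimP; apply: fpd_retract (right_corner_retract uniq ext (proj1 T2p)) _.
have [d dP] := corner_cores RA RB eS eRg eRf T1p T1t T1ext T1emb (ex_intro _ s bound).
exists d; apply: hom_cores_pd; first exact: cbij.
by apply: dP T2p _; exists idfun; exists idfun.
Qed.
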